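(* Let $f$, $X$, $U$, $\beta$ be the data of a continuous-time polynomial control system as in the context, with maximum controlled invariant set $X_I$. Let $$p^* = \sup\ \mu_0(X)$$ where the supremum is over all triples $(\mu,\mu_0,\hat\mu_0)\in M(X\times U)\times M(X)\times M(X)$ of nonnegative measures satisfying $$\beta\int_{X\times U} v(x)\,d\mu(x,u)=\int_X v(x)\,d\mu_0(x)+\int_{X\times U}\mathrm{grad}\,v(x)\cdot f(x,u)\,d\mu(x,u)\quad\text{for all } v\in C^1(X),$$ $$\int_X w(x)\,d\mu_0(x)+\int_X w(x)\,d\hat\mu_0(x)=\int_X w(x)\,d\lambda(x)\quad\text{for all } w\in C(X).$$ Then $p^*=\lambda(X_I)$. Moreover, the supremum is attained with $\mu_0$ equal to the restriction of $\lambda$ to $X_I$, i.e. there exist $\mu,\hat\mu_0$ such that $(\mu,\lambda|_{X_I},\hat\mu_0)$ satisfies all the constraints and $\lambda|_{X_I}(X)=p^*$.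
   Context: Continuous-time relaxed control system: $\dot x(t)\in\mathrm{conv}\,f(x(t),U)$, where $f:\mathbb{R}^n\times\mathbb{R}^m\to\mathbb{R}^n$ has polynomial entries $f_i\in\mathbb{R}[x,u]$, $f(x,U)=\{f(x,u):u\in U\}$ and $\mathrm{conv}$ is the convex hull. The sets $X=\{x\in\mathbb{R}^n: g_{X_i}(x)\ge 0,\ i=1,\dots,n_X\}$ and $U=\{u\in\mathbb{R}^m: g_{U_i}(u)\ge0,\ i=1,\dots,n_U\}$ are compact, with $g_{X_i}\in\mathbb{R}[x]$ and $g_{U_i}\in\mathbb{R}[u]$ polynomials. $\beta>0$ is a given discount factor. The maximum controlled invariant (MCI) set $X_I$ is the set of all $x_0\in X$ for which there exists a (locally) absolutely continuous $x:[0,\infty)\to\mathbb{R}^n$ with $x(0)=x_0$, $\dot x(t)\in\mathrm{conv}\,f(x(t),U)$ for Lebesgue-almost every $t\ge0$, and $x(t)\in X$ for all $t\in[0,\infty)$. $M(S)$ is the vector space of (finite) signed Borel measures with support contained in $S$; $C(X)$ is the space of continuous real functions on $X$; $C^1(X)$ is the space of once continuously differentiable functions, understood as continuously differentiable functions on $\mathbb{R}^n$ considered on $X$ together with their gradients; $\lambda$ is the $n$-dimensional Lebesgue measure. *)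

(* Defs.v *)
From HB Require Import structures.
From mathcomp Require Import all_boot all_order all_algebra.
From mathcomp Require mpoly.
From mathcomp Require Import all_classical all_reals all_analysis.

Set Implicit Arguments.
Unset Strict Implicit.
Unset Printing Implicit Defensive.

Import Order.TTheory GRing.Theory Num.Theory.
Import numFieldNormedType.Exports.

Local Open Scope classical_set_scope.
Local Open Scope ring_scope.

Notation borel T := (g_sigma_algebraType (@open T)).

HB.instance Definition _ (S T : ptopologicalType) :=
  Topological.on (S * T)%type.

(* lebesgue_tuple n is the n-fold product of the one-dimensional Lebesgue
   measure and lebesgue_rV n its image on row vectors with their Borel
   sigma-algebra; lebesgue_rV_box gives its value on boxes, which
   characterizes it. *)
Section cons_measure.
Context {R : realType} {n : nat}.
Notation tupleR k := (k.-tuple (measurableTypeR R)).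
Variable mu : {sigma_finite_measure set (tupleR n) -> \bar R}.

Let cons_fun (p : measurableTypeR R * tupleR n) : tupleR n.+1 :=
  [the n.+1.-tuple _ of p.1 :: p.2].

Let mcons_fun : measurable_fun setT cons_fun.
Proof. exact: measurable_cons. Qed.

Definition cons_measure : set (tupleR n.+1) -> \bar R :=
  pushforward (lebesgue_measure \x mu)%E cons_fun.

Let cons_measure0 : cons_measure set0 = 0%E.
Proof. exact: measure0. Qed.

Let cons_measure_ge0 A : (0 <= cons_measure A)%E.
Proof. exact: measure_ge0. Qed.

Let cons_measure_sigma_additive : semi_sigma_additive cons_measure.
Proof. exact: measure_semi_sigma_additive. Qed.

HB.instance Definition _ := isMeasure.Build _ _ _ cons_measure
  cons_measure0 cons_measure_ge0 cons_measure_sigma_additive.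

Let cons_measure_sigma_finite : sigma_finite setT cons_measure.
Proof.
have [F FT Ffin] : sigma_finite setT (lebesgue_measure \x mu)%E.
  have /sigma_finiteP[F [TF ndF Foo]] :=
    sigma_finiteT (@lebesgue_measure R).
  have /sigma_finiteP[G [TG ndG Goo]] := sigma_finiteT mu.
  exists (fun k => F k `*` G k).
    rewrite -setXTT TF TG predeqE => -[x y]; split.
      move=> [/= [i _ Fix] [k _ Gky]]; exists (maxn i k) => //; split.
      - by move: x Fix; exact/subsetPset/ndF/leq_maxl.
      - by move: y Gky; exact/subsetPset/ndG/leq_maxr.
    by move=> [k _ []/= ? ?]; split; exists k.
  move=> k; have [? ?] := Foo k; have [? ?] := Goo k.
  split; first exact: measurableX.
  by rewrite product_measure1E// lte_mul_pinfty// ge0_fin_numE.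
pose uncons (t : tupleR n.+1) : measurableTypeR R * tupleR n :=
  (tnth t ord0, [tuple of behead t]).
have muncons : measurable_fun setT uncons.
  by apply: measurable_fun_pair;
    [exact: measurable_tnth|exact: measurable_behead].
exists (fun i => uncons @^-1` F i).
  by rewrite -preimage_bigcup -FT preimage_setT.
move=> i; have [mF Fi] := Ffin i; split.
  by rewrite -[X in measurable X]setTI; exact: muncons.
rewrite /cons_measure /pushforward -comp_preimage.
rewrite (_ : uncons \o cons_fun = id) ?preimage_id//.
apply/funext => -[x t]/=; rewrite /uncons /cons_fun/=; congr pair.
exact/val_inj.
Qed.

HB.instance Definition _ := Measure_isSigmaFinite.Build _ _ _ cons_measure
  cons_measure_sigma_finite.

End cons_measure.

Section lebesgue_rV.
Variable R : realType.
Notation tupleR k := (k.-tuple (measurableTypeR R)).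

Fixpoint lebesgue_tuple (n : nat) :
    {sigma_finite_measure set (tupleR n) -> \bar R} :=
  if n is k.+1 then cons_measure (lebesgue_tuple k) else \d_[tuple].

Variable n : nat.

Definition row_of_tuple (t : tupleR n) : borel 'rV[R]_n := \row_i tnth t i.

Let row_of_tupleE t i : row_of_tuple t 0 i = tnth t i.
Proof. exact: mxE. Qed.

Lemma measurable_row_of_tuple : measurable_fun setT row_of_tuple.
Proof.
have := @measurability _ _ (tupleR n) (borel 'rV[R]_n) setT row_of_tuple
  (@open 'rV[R]_n) erefl.
apply => _ [V oV <-].
rewrite setTI.
pose c (p : 'rV[rat]_n * nat) : 'rV[R]_n := map_mx ratr p.1.
pose D := [set p | ball (c p) p.2.+1%:R^-1 `<=` V].
have -> : V = \bigcup_p (if p \in D then ball (c p) p.2.+1%:R^-1 else set0).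
  apply/seteqP; split=> [x Vx|x [p _]];
    last by case: ifPn => // /set_mem; exact.
  have /nbhs_ballP[e /= e0 xeV] : nbhs x V by exact: open_nbhs_nbhs.
  have [k ke] : exists k, (k.+1%:R^-1 : R) < e / 2.
    have e20 : 0 < e / 2 by rewrite divr_gt0.
    have [k _ /(_ _ (leqnn k))] := near_infty_natSinv_lt (PosNum e20).
    by exists k.
  have k0 : 0 < (k.+1%:R^-1 : R) by rewrite invr_gt0.
  have /choice[q qx] : forall i, exists r : rat,
      ratr r \in `]x 0 i, x 0 i + k.+1%:R^-1[.
    by move=> i; apply: rat_in_itvoo; rewrite ltrDl.
  have cx : ball (c (\row_i q i, k)) k.+1%:R^-1 x.
    split=> // i j; rewrite ord1 !mxE /ball/= ltr_distl.
    have := qx j; rewrite in_itv/= => /andP[h1 h2].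
    by rewrite h2 andbT ltrBlDr (lt_trans h1)// ltrDl.
  exists (\row_i q i, k) => //; rewrite ifT//; apply/mem_set => y cy.
  apply: xeV; rewrite (splitr e).
  by apply: ball_triangle (le_ball (ltW ke) cy); apply/ball_sym/le_ball/cx/ltW.
rewrite preimage_bigcup; apply: countable_bigcupT_measurable => // p.
case: ifPn => _; last by rewrite preimage_set0.
rewrite (_ : _ @^-1` _ =
  \bigcap_(i in [set: 'I_n])
    ((@tnth _ (measurableTypeR R))^~ i @^-1` ball (c p 0 i) p.2.+1%:R^-1)).
  apply: fin_bigcap_measurable => // i _.
  rewrite -[X in measurable X]setTI; apply: measurable_tnth => //.
  by apply: measurable_realfun.open_measurable; exact: ball_open.
apply/seteqP; split => [t [_ h] i _|t h].
  by have := h 0 i; rewrite row_of_tupleE.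
split => [|i j]; first by rewrite invr_gt0.
by rewrite ord1 row_of_tupleE; exact: h.
Qed.

Definition lebesgue_rV : set (borel 'rV[R]_n) -> \bar R :=
  pushforward (lebesgue_tuple n) row_of_tuple.

Let mrow := measurable_row_of_tuple.

Let lebesgue_rV0 : lebesgue_rV set0 = 0%E.
Proof. exact: measure0. Qed.

Let lebesgue_rV_ge0 A : (0 <= lebesgue_rV A)%E.
Proof. exact: measure_ge0. Qed.

Let lebesgue_rV_sigma_additive : semi_sigma_additive lebesgue_rV.
Proof. exact: measure_semi_sigma_additive. Qed.

HB.instance Definition _ := isMeasure.Build _ _ _ lebesgue_rV
  lebesgue_rV0 lebesgue_rV_ge0 lebesgue_rV_sigma_additive.

End lebesgue_rV.

Lemma lebesgue_rV_box (R : realType) (n : nat) (a b : 'rV[R]_n) :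
  (forall i, a 0 i <= b 0 i) ->
  lebesgue_rV [set x : 'rV[R]_n | forall i, x 0 i \in `[a 0 i, b 0 i]] =
  (\prod_i (b 0 i - a 0 i))%:E.
Proof.
rewrite /lebesgue_rV /pushforward => ab.
rewrite (_ : _ @^-1` _ =
    [set t : n.-tuple (measurableTypeR R) |
      forall i, tnth t i \in `[a 0 i, b 0 i]]); last first.
  by apply/seteqP; split=> t /= h i; have := h i; rewrite mxE.
have {ab} : forall i, (a 0) i <= (b 0) i by [].
move: (a 0) (b 0) => {}a {}b.
elim: n a b => [|n IH] a b ab.
  rewrite big_ord0 /= diracE mem_set//.
  by move=> [].
rewrite big_ord_recl EFinM -IH; last by move=> i; exact: ab.
rewrite [LHS]/= /cons_measure /pushforward.
have mbox k (c d : 'I_k -> R) : measurable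
    [set t : k.-tuple (measurableTypeR R) | forall i, tnth t i \in `[c i, d i]].
  rewrite (_ : mkset _ = \bigcap_(i in [set: 'I_k])
    ((@tnth _ (measurableTypeR R))^~ i @^-1` `[c i, d i]%classic)); last first.
    by apply/seteqP; split=> t h i; [move=> _; exact: h|exact: (h i I)].
  apply: fin_bigcap_measurable => // i _.
  rewrite -[X in measurable X]setTI; exact: measurable_tnth.
rewrite (_ : _ @^-1` _ = `[a ord0, b ord0]%classic `*` [set t |
    forall i, tnth t i \in `[a (lift ord0 i), b (lift ord0 i)]]); last first.
  apply/seteqP; split=> -[x t] /= h.
    split=> [|i]; first exact: (h ord0).
    by have := h (lift ord0 i); rewrite tnthS.
  move=> i; have [j ->|->] := unliftP ord0 i; last exact: h.1.
  by rewrite tnthS; exact: h.2.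
rewrite product_measure1E//; last exact: mbox.
congr (_ * _)%E.
rewrite [LHS]lebesgue_measure_itv/= lte_fin; case: ltP => // ba.
by have /eqP -> : a ord0 == b ord0; [rewrite eq_le ab ba|rewrite subrr].
Qed.

Definition polyset (R : realType) (k l : nat)
    (g : 'I_l -> mpoly.mpoly k R) : set 'rV[R]_k :=
  [set x | forall i, 0 <= mpoly.meval (x 0) (g i)].

Definition vfield (R : realType) (n m : nat)
    (f : 'I_n -> mpoly.mpoly (n + m) R) (x : 'rV[R]_n) (u : 'rV[R]_m) :
    'rV[R]_n :=
  \row_i mpoly.meval (row_mx x u 0) (f i).

Definition conv_hull (R : realType) (n : nat) (A : set 'rV[R]_n) :
    set 'rV[R]_n :=
  smallest (@convex_set R 'rV[R]_n) A.

Definition abs_continuous (R : realType) (n : nat) (a b : R)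
    (x : R -> 'rV[R]_n) : Prop :=
  forall e : R, 0 < e -> exists2 d : R, 0 < d &
    forall (k : nat) (s t : 'I_k -> R),
      (forall i, [/\ a <= s i, s i <= t i & t i <= b]) ->
      trivIset setT (fun i => `]s i, t i[%classic) ->
      \sum_i (t i - s i) < d ->
      \sum_i `|x (t i) - x (s i)| < e.

(* The derivative at t = 0, which involves the irrelevant values of x at
   negative times, is dispensed with by the null set. *)
Definition trajectory (R : realType) (n m : nat)
    (f : 'I_n -> mpoly.mpoly (n + m) R) (U : set 'rV[R]_m)
    (x : R -> 'rV[R]_n) : Prop :=
  (forall T, 0 < T -> abs_continuous 0 T x) /\
  {ae @lebesgue_measure R, forall t, 0 <= t ->
    derivable x t 1 /\
    conv_hull [set vfield f (x t) u | u in U] ('D_1 x t)}.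

Definition MCI (R : realType) (n m : nat)
    (f : 'I_n -> mpoly.mpoly (n + m) R) (X : set 'rV[R]_n)
    (U : set 'rV[R]_m) : set 'rV[R]_n :=
  [set x0 | X x0 /\ exists x : R -> 'rV[R]_n,
    [/\ x 0 = x0, trajectory f U x & forall t, 0 <= t -> X (x t)]].

Definition msupport (R : realType) (T : ptopologicalType)
    (mu : set (borel T) -> \bar R) : set T :=
  [set z | forall V : set T, open V -> V z -> (0 < mu V)%E].

(* Nonnegative elements of M(S): a signed measure is finite, so its
   nonnegativity makes it a finite measure. *)
Definition Mplus (R : realType) (T : ptopologicalType) (S : set T)
    (mu : {measure set (borel T) -> \bar R}) : Prop :=
  fin_num_fun mu /\ msupport mu `<=` S.

Definition grad (R : realType) (n : nat) (v : 'rV[R]_n -> R)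
    (x : 'rV[R]_n) : 'rV[R]_n :=
  \row_i 'D_(delta_mx 0 i) v x.

Definition C1 (R : realType) (n : nat) (v : 'rV[R]_n -> R) : Prop :=
  (forall x, differentiable v x) /\ continuous (grad v).

Definition dotp (R : realType) (n : nat) (x y : 'rV[R]_n) : R :=
  \sum_i x 0 i * y 0 i.

Definition feasible (R : realType) (n m : nat)
    (f : 'I_n -> mpoly.mpoly (n + m) R) (X : set 'rV[R]_n)
    (U : set 'rV[R]_m) (beta : R)
    (mu : {measure set (borel ('rV[R]_n * 'rV[R]_m)%type) -> \bar R})
    (mu0 mu0' : {measure set (borel 'rV[R]_n) -> \bar R}) : Prop :=
  [/\ Mplus (X `*` U) mu, Mplus X mu0, Mplus X mu0',
    forall v : 'rV[R]_n -> R, C1 v ->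
      beta * \int[mu]_(z in X `*` U) v z.1 =
      \int[mu0]_(x in X) v x +
      \int[mu]_(z in X `*` U) dotp (grad v z.1) (vfield f z.1 z.2) &
    forall w : 'rV[R]_n -> R, {within X, continuous w} ->
      \int[mu0]_(x in X) w x + \int[mu0']_(x in X) w x =
      \int[@lebesgue_rV R n]_(x in X) w x].

Definition pstar (R : realType) (n m : nat)
    (f : 'I_n -> mpoly.mpoly (n + m) R) (X : set 'rV[R]_n)
    (U : set 'rV[R]_m) (beta : R) : \bar R :=
  ereal_sup [set p | exists mu mu0 mu0',
    feasible f X U beta mu mu0 mu0' /\ p = mu0 X].

(* Main.v *)
Require Import Defs.
From HB Require Import structures.
From mathcomp Require Import all_boot all_order all_algebra.
From mathcomp Require Import finmap.
From mathcomp Require mpoly.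
From mathcomp Require Import all_classical all_reals all_analysis.
From mathcomp Require Import measurable_realfun.
From mathcomp Require Import ring lra.
Import Order.TTheory GRing.Theory Num.Theory.
Import numFieldNormedType.Exports.
Local Open Scope classical_set_scope.
Local Open Scope ring_scope.

Set Implicit Arguments.
Unset Strict Implicit.
Unset Printing Implicit Defensive.

(* Upper bound.  If x0 in X is outside X_I, then, by compactness of approximate
   trajectories, the Euler paths issued from near x0 leave a neighbourhood of X
   before a fixed time, uniformly in the step.  The discounted exit cost
   inf_u sup_k (1 - hB)^k l(x_k), where l is a penalty for leaving X and the rate
   B >= beta exceeds the Lipschitz constant of f, is then Lipschitz, bounded below
   near x0 and at most (1 - hB) times its value one Euler step ahead.  Averaging it
   over small cubes gives C^1 functions v >= 0 with beta v - grad v . f <= eta on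
   X x U and v >= c > 0 near x0, eta being arbitrarily small and c fixed.  Tested
   against a feasible triple they show that mu_0 vanishes near x0.  Hence mu_0 is
   carried by X_I, and mu_0 <= lambda.

   Attainment.  Along a trajectory that stays in X, beta v - grad v . f >= 0
   forces v >= 0 at the initial point, for otherwise v would tend to -oo.  So
   beta v - grad v . f |-> int_{X_I} v dlambda is a positive functional on a space
   of functions containing the constants; it extends to all bounded functions on
   X x U, and the extension is represented on continuous functions by a measure,
   which is the required mu. *)

(** * Distances and Borel functions *)

(** Assembling [mu] from the discounted occupation measures of single trajectories would require a
    measurable choice of a trajectory for each initial point; extending a positive functional avoids
    that choice. Extending it to all bounded functions, and not only to continuous ones, gives a
    value to every indicator, from which the measure is built.

    For the upper bound the exit cost of the differential inclusion need not be continuous, let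
    alone C^1. Regularity is obtained at the level of Euler steps, where the cost is 1-Lipschitz
    with a lower bound near x0, both uniform in the step h. Averaging at scale eps then yields
    second-order remainders with a constant of order 1 / eps. Hence the order of the choices: eps
    from eta, then h small compared with eps, while c depends on neither. Using a rate B larger than
    beta costs nothing because v >= 0. *)

Section distance.
Variables (R : realType) (T : normedModType R).
Implicit Types (A : set T) (x y z : T).

Definition dist A x : R := inf [set `|x - z| | z in A].

Let dist_lb A x : has_lbound [set `|x - z| | z in A].
Proof. by exists 0 => _ [z _ <-]. Qed.

Lemma dist_le A x z : A z -> dist A x <= `|x - z|.
Proof. by move=> Az; apply: ge_inf => //; exists z. Qed.

Lemma dist_ge0 A x : A !=set0 -> 0 <= dist A x.
Proof. by move=> [a Aa]; apply: lb_le_inf;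
  [exists `|x - a|, a|move=> _ [z _ <-]]. Qed.

Lemma dist_lip A x y : A !=set0 -> `|dist A x - dist A y| <= `|x - y|.
Proof.
move=> A0; wlog: x y / dist A y <= dist A x.
  move=> h; have [/h//|/ltW/h] := leP (dist A y) (dist A x).
  by rewrite distrC (distrC x).
move=> yx; rewrite ger0_norm ?subr_ge0// lerBlDr addrC -lerBlDr.
apply: lb_le_inf; first by case: A0 => a Aa; exists `|y - a|, a.
move=> _ [z Az <-]; have := dist_le x Az; have := ler_distD y x z; lra.
Qed.

Lemma dist_mem0 A x : A x -> dist A x = 0.
Proof.
move=> Ax; apply: le_anti; rewrite dist_ge0 ?andbT; last by exists x.
by have := dist_le x Ax; rewrite subrr normr0.
Qed.

Lemma dist_near A x e : A !=set0 -> dist A x < e -> exists2 z, A z & `|x - z| < e.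
Proof.
move=> [a Aa] xe; have e0 : 0 < e - dist A x by rewrite subr_gt0.
have [|_ [z Az <-] h] := @inf_adherent R [set `|x - z| | z in A] _ e0.
  by split => //; exists `|x - a|, a.
by exists z => //; rewrite (lt_le_trans h)// addrC subrK.
Qed.

Lemma dist_closed0 A x : closed A -> A !=set0 -> dist A x <= 0 -> A x.
Proof.
move=> cA A0 d0; apply/cA => V /nbhs_ballP[e /= e0 xeV].
have [|z Az xz] := @dist_near A x e A0; first exact: le_lt_trans e0.
by exists z; split => //; apply: xeV; rewrite -ball_normE.
Qed.

End distance.

Lemma lipschitz1_continuous (R : realType) (T : normedModType R) (g : T -> R) C :
  (forall x y, `|g x - g y| <= C * `|x - y|) -> continuous g.
Proof.
move=> gC x; apply/cvgrPdist_lt => e e0; near=> y.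
rewrite (le_lt_trans (gC _ _))//.
have C1 : 0 < `|C| + 1 by rewrite ltr_wpDl.
rewrite (@le_lt_trans _ _ ((`|C| + 1) * `|x - y|))//.
  by rewrite ler_wpM2r// (le_trans (ler_norm _))// lerDl.
rewrite mulrC -ltr_pdivlMr//.
by near: y; apply: cvgr_dist_lt => //; rewrite divr_gt0.
Unshelve. all: by end_near. Qed.

Lemma dist_continuous (R : realType) (T : normedModType R) (A : set T) :
  A !=set0 -> continuous (dist A).
Proof.
by move=> A0; apply: (@lipschitz1_continuous _ _ _ 1) => x y;
  rewrite mul1r dist_lip.
Qed.

Section borel.
Variables (R : realType) (T : ptopologicalType).

Lemma open_borel (A : set T) : open A -> measurable (A : set (borel T)).
Proof. by move=> oA; apply: sub_sigma_algebra. Qed.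

Lemma closed_borel (A : set T) : closed A -> measurable (A : set (borel T)).
Proof.
by move=> cA; rewrite -[A]setCK; apply: measurableC; apply: open_borel;
  exact: closed_openC.
Qed.

Lemma within_continuous_borel (D : set T) (g : T -> R) :
  measurable (D : set (borel T)) -> {within D, continuous g} ->
  measurable_fun (D : set (borel T)) (g : borel T -> R).
Proof.
move=> mD /continuousP cg.
apply: (measurability _ (measurable_realfun.RGenOpens.measurableE R)) => _ [_
  [a [b ->] <-]].
have : open (g @^-1` `]a, b[%classic : set (subspace D)).
  exact/cg/interval_open.
move=> /open_subspaceP[V oV]; rewrite setIC [_ `&` D]setIC => <-.
by apply: measurableI => //; exact: open_borel.
Qed.

Lemma bounded_integrable (mu : {measure set (borel T) -> \bar R}) (D : set T)
    (g : T -> R) C :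
  (mu D < +oo)%E -> measurable (D : set (borel T)) ->
  measurable_fun (D : set (borel T)) (g : borel T -> R) ->
  (forall x, D x -> `|g x| <= C) -> mu.-integrable D (EFin \o g).
Proof.
move=> muD mD mg gC; apply: measurable_bounded_integrable => //.
exists C; split; first exact: num_real.
by move=> r Cr x Dx /=; rewrite (le_trans (gC _ Dx))// ltW.
Qed.

Lemma compact_bounded_fun (D : set T) (g : T -> R) :
  compact D -> {within D, continuous g} -> exists C, forall x, D x -> `|g x| <= C.
Proof.
move=> cD cg; have := compact_bounded (continuous_compact cg cD).
move=> [C [_ hC]]; exists (C + 1) => x Dx; apply: (hC (C + 1)).
  by rewrite ltrDl.
by exists x.
Qed.

Lemma within_continuous_integrable (mu : {measure set (borel T) -> \bar R})
    (D : set T) (g : T -> R) :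
  (mu D < +oo)%E -> closed D -> compact D -> {within D, continuous g} ->
  mu.-integrable (D : set (borel T)) (EFin \o g).
Proof.
move=> fmu cD kD cg; have [C gC] := compact_bounded_fun kD cg.
apply: bounded_integrable gC => //; first exact: closed_borel.
by apply: within_continuous_borel => //; exact: closed_borel.
Qed.

End borel.

Lemma continuous_sum (R : realType) (T : topologicalType) (I : Type) (r : seq I)
    (F : I -> T -> R) :
  (forall i, continuous (F i)) -> continuous (fun x => \sum_(i <- r) F i x).
Proof.
move=> cF; elim: r => [|i r IH] x.
  by under eq_fun do rewrite big_nil; exact: cvg_cst.
under eq_fun do rewrite big_cons.
by apply: cvgD; [exact: cF|exact: IH].
Qed.

(** * Positive extension and the Riesz representation *)

(** Partial functionals are kept as graphs ordered by inclusion, so that the union of a chain is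
    again one. Single-valuedness is not imposed, since positivity implies it. *)
Definition linear_graph (R : realType) (T : Type) (G : set ((T -> R) * R)) :=
  forall a g r g' r', G (g, r) -> G (g', r') ->
    G (fun x => a * g x + g' x, a * r + r').

Definition positive_graph (R : realType) (T : Type) (K : set T)
    (G : set ((T -> R) * R)) :=
  forall g r, G (g, r) -> (forall x, K x -> 0 <= g x) -> 0 <= r.

Definition bounded_on (R : realType) (T : Type) (K : set T) (g : T -> R) :=
  exists C, forall x, K x -> `|g x| <= C.

Section positive_extension.
Variables (R : realType) (T : Type) (K : set T).
Implicit Types (G : set ((T -> R) * R)) (g : T -> R).

Lemma linear_graphZ G a g r : linear_graph G -> G (fun=> 0, 0) ->
  G (g, r) -> G (fun x => a * g x, a * r).
Proof.
move=> lG G0 Gg; have := lG a _ _ _ _ Gg G0; rewrite addr0.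
by under eq_fun do rewrite addr0.
Qed.

Lemma linear_graphB G g r g' r' : linear_graph G ->
  G (g, r) -> G (g', r') -> G (fun x => g x - g' x, r - r').
Proof.
move=> lG Gg Gg'; have := lG (-1) _ _ _ _ Gg' Gg.
rewrite mulN1r addrC; congr (G (_, _)); apply/funext => x; lra.
Qed.

Lemma positive_graph_le G g r g' r' : linear_graph G -> positive_graph K G ->
  G (g, r) -> G (g', r') -> (forall x, K x -> g x <= g' x) -> r <= r'.
Proof.
move=> lG pG Gg Gg' gg'; rewrite -subr_ge0.
apply: pG (linear_graphB lG Gg' Gg) _ => x Kx; rewrite subr_ge0; exact: gg'.
Qed.

(** The value given to [g] is the supremum [s] of the values of the elements of the domain that lie
    below [g] on [K]; the constants make it finite. *)
Lemma positive_extension_step G g : linear_graph G -> positive_graph K G ->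
  G (fun=> 0, 0) -> (exists c, G (fun=> 1, c)) -> bounded_on K g ->
  exists G', [/\ linear_graph G', positive_graph K G', G `<=` G' &
    exists r, G' (g, r)].
Proof.
move=> lG pG G0 [c G1] [C gC].
pose A := [set a | exists e, G (e, a) /\ forall x, K x -> e x <= g x].
have GC : G (fun=> C, C * c).
  by have := linear_graphZ C lG G0 G1; under eq_fun do rewrite mulr1.
have GNC : G (fun=> - C, - C * c).
  by have := linear_graphZ (- C) lG G0 G1; under eq_fun do rewrite mulr1.
have supA : has_sup A.
  split; first (exists (- C * c), (fun=> - C); split => // x Kx;
    by have := gC x Kx; rewrite ler_norml => /andP[]).
  exists (C * c) => a [e [Ge eg]].
  apply: (positive_graph_le lG pG Ge GC) => x Kx; apply: (le_trans (eg x Kx)).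
  by have := gC x Kx; rewrite ler_norml => /andP[].
pose s := sup A.
pose G' := [set p : (T -> R) * R | exists e a t, G (e, a) /\
  p = (fun x => e x + t * g x, a + t * s)].
exists G'; split.
- move=> b f r f' r' [e [a [t [Ge [-> ->]]]]] [e' [a' [t' [Ge' [-> ->]]]]].
  exists (fun x => b * e x + e' x), (b * a + a'), (b * t + t').
  split; first exact: lG.
  by congr pair; [apply/funext => x|]; ring.
- move=> f r [e [a [t [Ge [-> ->]]]]] ef.
  (* For t < 0 the hypothesis says g <= - e / t on [K], so every competitor in [A] lies below - e /
     t; for t > 0 it says - e / t <= g, so - e / t is itself a competitor. *)
  have [t0|t0|t0] := ltgtP t 0.
  + have le_s : s <= - (a / t).
      apply: ge_sup; first exact: supA.1.
      move=> b [e' [Ge' e'g]].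
      have := linear_graphZ (- t^-1) lG G0 Ge.
      rewrite mulNr mulrC => Gz.
      apply: (positive_graph_le lG pG Ge' Gz) => x Kx.
      apply: (le_trans (e'g x Kx)).
      have: 0 <= - t^-1 * (e x + t * g x).
        apply: mulr_ge0; last exact: ef.
        by rewrite oppr_ge0 invr_le0 ltW.
      rewrite mulrDr mulrA [X in _ <= _ + X * _]mulNr mulVf ?lt_eqF// mulN1r;
        lra.
    have : t * - (a / t) <= t * s by rewrite ler_nM2l.
    by rewrite mulrN mulrCA divff ?lt_eqF// mulr1; lra.
  + have le_s : - (a / t) <= s.
      apply: (ub_le_sup supA.2).
      exists (fun x => - t^-1 * e x); split.
        by have := linear_graphZ (- t^-1) lG G0 Ge; rewrite mulNr mulrC.
      move=> x Kx; have h := ef x Kx.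
      have: 0 <= t^-1 * (e x + t * g x) by rewrite mulr_ge0// invr_ge0 ltW.
      rewrite mulrDr mulrA mulVf ?gt_eqF// mul1r; lra.
    have : t * - (a / t) <= t * s by rewrite ler_pM2l.
    by rewrite mulrN mulrCA divff ?gt_eqF// mulr1; lra.
  + rewrite t0 mul0r addr0; apply: pG Ge _ => x Kx.
    by have := ef x Kx; rewrite t0 mul0r addr0.
- move=> [e a] Ge; exists e, a, 0; split => //.
  by congr pair; [apply/funext => x|]; ring.
- exists s, (fun=> 0), 0, 1; split => //.
  by congr pair; [apply/funext => x|]; ring.
Qed.

(** Zorn's lemma: a maximal graph is defined at every bounded function, since otherwise the one-step
    extension would enlarge it. *)
Lemma positive_extension G0 : linear_graph G0 -> positive_graph K G0 ->
  (exists c, G0 (fun=> 1, c)) ->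
  exists L : (T -> R) -> R, [/\
    forall g r, G0 (g, r) -> L g = r,
    forall a g g', bounded_on K g -> bounded_on K g' ->
      L (fun x => a * g x + g' x) = a * L g + L g' &
    forall g, bounded_on K g -> (forall x, K x -> 0 <= g x) -> 0 <= L g].
Proof.
move=> lG0 pG0 [c G1].
pose P := [set G | [/\ linear_graph G, positive_graph K G & G0 `<=` G] \/ G = set0].
have [F FP Ftot|G [PG maxG]] := @Zorn_bigcup _ P.
  have [[G [FG Gn0]]|Fn] := pselect (exists G, F G /\ G != set0); last first.
    right; apply/seteqP; split => // p [G FG Gp].
    by apply: Fn; exists G; split => //; apply/set0P; exists p.
  left; split.
  - move=> a g r g' r' [G1' FG1 Gg] [G2 FG2 Gg'].
    have [h|h] := Ftot _ _ FG1 FG2.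
      exists G2 => //; have [[lG _ _]|G20] := FP _ FG2;
        last by rewrite G20 in Gg'.
      by apply: lG => //; exact: h.
    exists G1' => //; have [[lG _ _]|G20] := FP _ FG1;
      last by rewrite G20 in Gg.
    by apply: lG => //; exact: h.
  - move=> g r [G1' FG1 Gg].
    have [[_ pG _]|G20] := FP _ FG1; last by rewrite G20 in Gg.
    exact: pG.
  - move=> p G0p; exists G => //.
    have [[_ _ h]|G20] := FP _ FG; first exact: h.
    by rewrite G20 eqxx in Gn0.
have [lG pG G0G] : [/\ linear_graph G, positive_graph K G & G0 `<=` G].
  case: PG => // G00; exfalso; apply: (maxG G0); last (by left; split).
  rewrite G00; split; first exact: sub0set.
  by move/(_ _ G1).
have Gz : G (fun=> 0, 0).
  have := linear_graphB lG (G0G _ G1) (G0G _ G1).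
  by rewrite !subrr.
have dom g : bounded_on K g -> exists r, G (g, r).
  move=> bg; have [G' [lG' pG' GG' [r G'r]]] :=
    positive_extension_step lG pG Gz (ex_intro _ c (G0G _ G1)) bg.
  exists r; apply: contrapT => nGr; apply: (maxG G').
    by split => // /(_ _ G'r).
  by left; split => //; exact: subset_trans GG'.
have uniq g r r' : G (g, r) -> G (g, r') -> r = r'.
  move=> h h'; apply: le_anti.
  by apply/andP; split; [apply: (positive_graph_le lG pG h h')|
    apply: (positive_graph_le lG pG h' h)].
pose L g := xget 0 [set r | G (g, r)].
have GL g r : G (g, r) -> L g = r.
  by move=> h; rewrite /L; case: xgetP => [y _ /= h'|/(_ _ h)//];
    exact: uniq h' h.
have LG g : bounded_on K g -> G (g, L g) by move/dom => [r h];
  rewrite (GL _ _ h).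
exists L; split.
- by move=> g r /G0G/GL.
- by move=> a g g' /LG h /LG h'; apply: GL; exact: lG.
- by move=> g /LG h; exact: pG h.
Qed.

End positive_extension.

(** * Riesz-Markov representation on a compact set *)

Section riesz_markov.
Variables (R : realType) (T : normedModType R) (K : set T).
Variable L : (T -> R) -> R.
Hypothesis cK : compact K.
Hypothesis Llin : forall a g g', bounded_on K g -> bounded_on K g' ->
  L (fun x => a * g x + g' x) = a * L g + L g'.
Hypothesis Lpos : forall g, bounded_on K g -> (forall x, K x -> 0 <= g x) -> 0 <= L g.
Implicit Types (g : T -> R) (A B C : set T).

Let bounded_onD a g g' : bounded_on K g -> bounded_on K g' ->
  bounded_on K (fun x => a * g x + g' x).
Proof.
move=> [C gC] [C' gC']; exists (`|a| * C + C') => x Kx.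
rewrite (le_trans (ler_normD _ _))// normrM lerD ?gC'//.
by rewrite ler_wpM2l// gC.
Qed.

Let bounded_on_cst (c : R) : bounded_on K (fun=> c).
Proof. by exists `|c|. Qed.

Let L_le g g' : bounded_on K g -> bounded_on K g' ->
  (forall x, K x -> g x <= g' x) -> L g <= L g'.
Proof.
move=> bg bg' gg'; have := @Lpos (fun x => -1 * g x + g' x).
rewrite Llin// mulN1r addrC subr_ge0; apply; first exact: bounded_onD.
by move=> x Kx; rewrite mulN1r addrC subr_ge0 gg'.
Qed.

Let L0 : L (fun=> 0) = 0.
Proof.
have := @Llin (-1) (fun=> 0) (fun=> 0) (bounded_on_cst 0) (bounded_on_cst 0).
by rewrite mulr0 addr0 mulN1r addNr.
Qed.

Let bounded_on_indic A : bounded_on K (\1_A : T -> R).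
Proof.
by exists 1 => x _; rewrite indicE; case: (_ \in _); rewrite ?normr1 ?normr0.
Qed.

(* L is defined on all bounded functions, which makes this finitely additive on
   all subsets. *)
Definition riesz_content A : R := L (\1_A).
Notation m := riesz_content.

Let m0 : m set0 = 0.
Proof. by rewrite /m indic0 L0. Qed.

Let m_ge0 A : 0 <= m A.
Proof. by apply: Lpos => // x _; rewrite indicE. Qed.

Let mU A B : A `&` B = set0 -> m (A `|` B) = m A + m B.
Proof.
move=> AB; rewrite /m -[X in X + _]mul1r -Llin//; congr L; apply/funext => x.
rewrite mul1r !indicE in_setU.
have [xA|] := boolP (x \in A); have [xB|] := boolP (x \in B) => //=;
  rewrite ?addr0 ?add0r//.
have : (A `&` B) x by split; exact/set_mem.
by rewrite AB.
Qed.

Let le_m A B : A `&` K `<=` B -> m A <= m B.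
Proof.
move=> AB; apply: L_le => // x Kx; rewrite !indicE ler_nat.
have [xA|//] := boolP (x \in A); rewrite mem_set//.
by apply: AB; split => //; exact: set_mem.
Qed.

Let mD A B : B `<=` A -> m (A `\` B) = m A - m B.
Proof.
move=> BA; have : m (B `|` (A `\` B)) = m B + m (A `\` B).
  by rewrite mU// setIDA setDE setIC setIA setICl set0I.
by rewrite setDUK// => ->; rewrite addrC addKr.
Qed.

Let m_sub A B : m (A `|` B) <= m A + m B.
Proof.
have -> : A `|` B = B `|` (A `\` B).
  apply/seteqP; split => x; last by case => [|[]]; [right|left].
  by have [|] := pselect (B x); [left|move=> nB [Ax|//]; right].
rewrite mU; last by rewrite setIDA setDE setIC setIA setICl set0I.
by rewrite addrC lerD2r le_m// => x [[]].
Qed.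

Local Open Scope ereal_scope.

(* Non-open sets get infinite weight, so that [mu_ext] only sees covers by open sets. *)
Definition riesz_open_content (A : set (borel T)) : \bar R :=
  if `[< open (A : set T) >] then (m A)%:E else +oo.
Notation mo := riesz_open_content.

Let mo0 : mo (set0 : set (borel T)) = 0.
Proof. by rewrite /mo asboolT ?m0//; exact: open0. Qed.

Let mo_ge0 (A : set (borel T)) : 0 <= mo A.
Proof. by rewrite /mo; case: ifP => // _; rewrite lee_fin m_ge0. Qed.

Definition riesz_outer : set (borel T) -> \bar R := mu_ext mo.
Notation ms := riesz_outer.

HB.instance Definition _ := isOuterMeasure.Build R (borel T) ms
  (mu_ext0 mo0 mo_ge0) (mu_ext_ge0 mo_ge0) (le_mu_ext mo)
  (mu_ext_sigma_subadditive mo_ge0).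

Let ms_open (V : set T) : open V -> ms V <= (m V)%:E.
Proof.
move=> oV; apply: ereal_inf_lbound;
  exists (fun k => if k is 0%N then V else set0).
  split; first by case => [|k]; [exact: open_borel|exact: measurable0].
  by move=> x Vx; exists 0%N.
rewrite nneseries_recl// eseries0 ?adde0//; first by rewrite /mo asboolT.
by case.
Qed.

(** A cover with a non-open member has infinite sum. An open one has a finite part covering [K], and
    [m] ignores what lies outside [K], so finite subadditivity suffices: compactness stands in for
    countable additivity of [m]. *)
Let ms_setT : ms setT = (m setT)%:E.
Proof.
apply/eqP; rewrite eq_le ms_open ?andTb; last exact: openT.
apply: le_ereal_inf_tmp => _ [A [mA TA] <-].
have [oA|/existsNP[k nAk]] := pselect (forall k, open (A k : set T));
  last first.
  rewrite (eseries_pinfty (k := k)) ?leey//.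
  - by move=> i _; rewrite gt_eqF// (lt_le_trans _ (mo_ge0 _)).
  - by rewrite /mo asboolF.
have /(_ nat setT A) [] : cover_compact K by rewrite -compact_cover.
- by move=> i _; exact: oA.
- by move=> x _; have [i _ ?] := TA x I; exists i.
move=> D _ KD.
have [N hN] : exists N, forall i, i \in D -> (i < N)%N.
  exists (\max_(i <- D) i).+1 => i iD; rewrite ltnS.
  exact: (leq_bigmax_seq (F := id)).
apply: le_trans (nneseries_lim_ge N (fun _ _ _ => mo_ge0 _)).
have moA i : mo (A i) = (m (A i))%:E by rewrite /mo asboolT.
under eq_bigr do rewrite moA.
rewrite sumEFin lee_fin.
apply: (@le_trans _ _ (m (\big[setU/set0]_(0 <= i < N) A i))).
  apply: le_m => x [_ /KD[i /= iD Aix]].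
  rewrite -bigcup_seq; exists i => //=.
  by rewrite mem_index_iota hN.
elim: N {hN} => [|N IH]; first by rewrite !big_nil m0.
rewrite !big_nat_recr//= (le_trans (m_sub _ _))//.
by rewrite lerD2r.
Qed.

(** [m] need not be continuous along increasing unions, so the bound is on [ms W] rather than on
    [m W]: the part of [W] near its complement is covered by thin open shells whose [m]-masses
    telescope to a small total. *)
Let ms_inner (W : set T) (e : R) : open W -> (0 < e)%R ->
  exists C : set T, [/\ closed C, C `<=` W & ms W <= (m C + e)%:E].
Proof.
move=> oW e0; have [WT|WT] := pselect (W = setT).
  exists setT; rewrite WT; split => //.
  by rewrite ms_setT lee_fin lerDl ltW.
have W0 : ~` W !=set0.
  by apply/set0P/eqP => /(congr1 setC); rewrite setCK setC0.
pose r := dist (~` W).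
have rW x : W x <-> (0 < r x)%R.
  split => [Wx|rx].
    rewrite lt_neqAle dist_ge0// andbT; apply/negP => /eqP h.
    have : (~` W) x by apply: dist_closed0 => //;
      [exact: open_closedC|rewrite -/(r x) -h].
    exact.
  by apply: contrapT => /(@dist_mem0 _ _ (~` W)) h; rewrite /r h ltxx in rx.
have rc : continuous r by exact: dist_continuous.
pose t k : R := k.+1%:R^-1%R.
have tS k : (t k.+1 < t k)%R by rewrite /t ltf_pV2 ?posrE ?ltr0n// ltr_nat.
have t_gt0 k : (0 < t k)%R by rewrite invr_gt0.
have tN i j : (i <= j)%N -> (t j <= t i)%R.
  by move=> ij; rewrite lef_pV2 ?posrE ?ltr0n// ler_nat.
have oO s : open [set x | (s < r x)%R].
  by move/continuousP: rc => /(_ [set y | (s < y)%R]); apply; exact: open_gt.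
have oI s s' : open [set x | (s < r x < s')%R].
  rewrite (_ : mkset _ = [set x | (s < r x)%R] `&` [set x | (r x < s')%R]).
    apply: openI => //; move/continuousP: rc => /(_ [set y | (y < s')%R]);
      apply.
    exact: open_lt.
  by apply/seteqP; split => x /=; [move/andP|move=> [-> ->]].
pose a k := m [set x | (t k < r x)%R].
have a_le k : (a k <= m setT)%R by apply: le_m.
have andr i j : (i <= j)%N -> (a i <= a j)%R.
  by move=> ij; apply: le_m => x [/= h _]; exact: le_lt_trans (tN _ _ ij) h.
have supa : has_sup (range a).
  by split; [exists (a 0%N), 0%N|exists (m setT) => _ [k _ <-]].
have e30 : (0 < e / 3)%R by rewrite divr_gt0.
(* Beyond this [k], refining the level adds less than e / 3 to the mass. *)
have [_ [k _ <-] kP] := sup_adherent e30 supa.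
have {}kP j : (a j < a k + e / 3)%R.
  have aj : (a j <= sup (range a))%R by apply: (ub_le_sup supa.2); exists j.
  by move: kP aj; lra.
exists [set x | (t k <= r x)%R]; split.
- move/continuous_closedP: rc => /(_ [set y | (t k <= y)%R]); apply.
  exact: closed_ge.
- by move=> x /= h; apply/rW; exact: lt_le_trans h.
(* The overlap of consecutive shells lets them be open and still cover [W]; a point lies in at most
   two of them. *)
pose U j : set T := if j is j'.+1 then [set x | (t (k + j').+2 < r x < t (k + j')%N)%R]
  else [set x | (t k.+1 < r x)%R].
have oU j : open (U j) by case: j => [|j]; [exact: oO|exact: oI].
have moU j : mo (U j) = (m (U j))%:E by rewrite /mo asboolT.
apply: (@le_trans _ _ (\sum_(0 <= j <oo) mo (U j))).
  apply: ereal_inf_lbound; exists U => //; split; first by move=> j;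
    exact: open_borel.
  move=> x /rW rx.
  have [N tNx] : exists N, (t N < r x)%R.
    by have [N _ /(_ _ (leqnn N))] := near_infty_natSinv_lt (PosNum rx);
      exists N.
  have exi : exists i, (t (k + i)%N < r x)%R.
    by exists N; rewrite (le_lt_trans _ tNx)// tN// leq_addl.
  case: (ex_minnP exi) => -[|[|i]] ti mini.
  - by exists 0%N => //=; rewrite addn0 in ti; exact: lt_trans (tS k) ti.
  - by exists 0%N => //=; rewrite -addn1.
  - exists i.+1 => //=; rewrite -!addnS ti/=.
    have : ~~ (t (k + i.+1)%N < r x)%R by apply/negP => /mini; rewrite ltnn.
    by rewrite -leNgt => /le_lt_trans; apply; rewrite addnS.
apply: lime_le.
  by apply: is_cvg_nneseries => ? _ _; exact: mo_ge0.
apply: nearW => N; under eq_bigr do rewrite moU.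
rewrite sumEFin lee_fin.
apply: (@le_trans _ _ (\sum_(0 <= j < N.+1) m (U j))%R).
  by rewrite big_nat_recr//= lerDl m_ge0.
rewrite big_nat_recl//=.
have mU' j : (m (U j.+1) <= a (k + j).+2 - a (k + j)%N)%R.
  rewrite lerBrDl -mU.
    apply: le_m => x [/= [h|/andP[]//] _]; apply: le_lt_trans h.
    by apply: tN; rewrite -addn2 leq_addr.
  apply/seteqP; split => // x /= [h /andP[_ h']].
  by have := lt_trans h h'; rewrite ltxx.
(* The overlap makes two interleaved telescoping sums, hence four boundary terms. *)
have tel : (\sum_(0 <= j < N) m (U j.+1) <=
    a (k + N).+1 + a (k + N)%N - a k.+1 - a k)%R.
  elim: N => [|N IH]; first by rewrite big_nil addn0; lra.
  rewrite big_nat_recr//=; have := mU' N; rewrite addnS; lra.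
have ak : (a k <= m [set x | (t k <= r x)%R])%R.
  by apply: le_m => x [/= /ltW].
move: tel ak (kP (k + N).+1) (kP (k + N)%N) (kP k.+1) (andr _ _ (leqnSn k)).
rewrite /a; lra.
Qed.

(** Removing from [G] a closed set [C] that nearly exhausts the intersection leaves an open set,
    where [ms] is at most [m]; the finite additivity of [m] concludes. *)
Let ms_split (G W : set T) : open G -> open W ->
  ms (G `&` W) + ms (G `&` ~` W) <= (m G)%:E.
Proof.
move=> oG oW; apply/lee_addgt0Pr => e e0.
have [C [cC CGW hC]] := ms_inner (openI oG oW) e0.
have : ms (G `&` ~` W) <= (m (G `\` C))%:E.
  apply: (@le_trans _ _ (ms (G `\` C))).
    by apply: le_mu_ext => x [Gx nWx]; split => // /CGW[].
  by apply: ms_open; rewrite setDE; apply: openI => //; exact: closed_openC.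
move=> /(leeD hC)/le_trans; apply.
rewrite mD; last by move=> x /CGW[].
by rewrite -EFinD -EFinD lee_fin; lra.
Qed.

(** An arbitrary set is tested through its countable open covers, each member of which is split
    separately. *)
Let open_caratheodory (W : set T) : open W -> ms.-caratheodory W.
Proof.
move=> oW; apply: le_caratheodory_measurable => X.
apply: le_ereal_inf_tmp => _ [A [mA XA] <-].
apply: (@le_trans _ _ (\sum_(0 <= k <oo) (ms (A k `&` W) + ms (A k `&` ~` W)))).
  rewrite nneseriesD; try by move=> *; exact: mu_ext_ge0.
  by apply: leeD; apply: le_trans (outer_measure_sigma_subadditive ms _);
    apply: le_mu_ext; rewrite -setI_bigcupl; exact: setSI.
apply: lee_nneseries; first by move=> *; apply: adde_ge0; exact: mu_ext_ge0.
move=> k _; rewrite /mo; case: asboolP => [oA|_]; last by rewrite leey.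
exact: ms_split.
Qed.

Let borel_caratheodory (A : set (borel T)) : measurable A -> ms.-caratheodory A.
Proof.
apply: smallest_sub; last exact: open_caratheodory.
split.
- exact: caratheodory_measurable_set0.
- by move=> B mB; rewrite setTD; exact: caratheodory_measurable_setC.
- by move=> B mB; exact: caratheodory_measurable_bigcup.
Qed.

Definition riesz_measure : set (borel T) -> \bar R := ms.

Let ms_sigma_additive : semi_sigma_additive riesz_measure.
Proof.
move=> A mA tA mUA.
by apply: (caratheodory_measure_sigma_additive (mu := ms)) => // [i|];
  exact: borel_caratheodory.
Qed.

HB.instance Definition _ := isMeasure.Build _ _ _ riesz_measure
  (mu_ext0 mo0 mo_ge0) (mu_ext_ge0 mo_ge0) ms_sigma_additive.

Lemma riesz_measure_fin : fin_num_fun riesz_measure.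
Proof.
move=> A mA; rewrite ge0_fin_numE; last exact: mu_ext_ge0.
rewrite (@le_lt_trans _ _ (ms setT))//; first exact: le_mu_ext.
by rewrite ms_setT ltry.
Qed.

Let riesz_measure_lty : riesz_measure (K : set (borel T)) < +oo.
Proof.
by rewrite ltey_eq riesz_measure_fin//; apply: closed_borel;
  exact: compact_closed.
Qed.

(** Passing to complements reverses [ms_open], because the total masses agree. *)
Let closed_ge_m C : closed C -> (m C)%:E <= riesz_measure C.
Proof.
move=> cC; have : riesz_measure (~` C) <= (m (~` C))%:E.
  by apply: ms_open; exact: closed_openC.
have mC : measurable (C : set (borel T)) by exact: closed_borel.
have : riesz_measure setT = riesz_measure C + riesz_measure (~` C).
  by rewrite -measureU ?setICr ?setUCr//; exact: measurableC.
have /fineK <- := riesz_measure_fin mC.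
have /fineK <- := riesz_measure_fin (measurableC mC).
rewrite -EFinD [riesz_measure setT]ms_setT !lee_fin => -[h] h'.
have := mD (@subsetT _ C); rewrite setTD; lra.
Qed.

Lemma riesz_measureC0 : riesz_measure (~` K) = 0.
Proof.
apply/eqP; rewrite eq_le measure_ge0 andbT.
have -> : 0 = (m (~` K))%:E.
  by congr EFin; apply/esym/le_anti; rewrite m_ge0 andbT -m0;
    apply: le_m => x [].
apply: ms_open; apply: closed_openC; exact: compact_closed.
Qed.

Local Close Scope ereal_scope.

(** Counting the integers up to [s] from 1, as here, or from 0, as in [sum_steps_ge], brackets [s].
    A nonnegative function is thus compared with sums of indicators of its superlevel sets. *)
Let sum_steps_le N (s : R) : 0 <= s -> \sum_(j < N) ((j.+1%:R <= s)%R%:R : R) <= s.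
Proof.
elim: N s => [|N IH] s s0; first by rewrite big_ord0.
rewrite big_ord_recl; have [s1|s1] := leP 1%:R s; last first.
  rewrite add0r big1// => j _; rewrite leNgt (lt_le_trans s1)// ler_nat.
  by rewrite /= /bump.
have := IH (s - 1); rewrite subr_ge0 => /(_ s1).
under eq_bigr => j _ do rewrite lerBrDr natr1.
by rewrite lerBrDr addrC.
Qed.

Let sum_steps_ge N (s : R) : 0 <= s <= N%:R -> s <= \sum_(j < N) ((j%:R <= s)%R%:R : R).
Proof.
elim: N s => [|N IH] s /andP[s0 sN]; first by rewrite big_ord0.
rewrite big_ord_recl/= s0; have [s1|/ltW s1] := leP 1 s; last first.
  by rewrite (le_trans s1)// lerDl sumr_ge0.
have := IH (s - 1); rewrite subr_ge0 s1 lerBlDr natr1 sN => /(_ isT).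
rewrite lerBlDr addrC => /le_trans; apply; rewrite lerD2l;
  apply: ler_sum => j _.
by rewrite lerBrDr natr1.
Qed.

Let L_sum N (A : nat -> set T) :
  L (fun x => \sum_(j < N) \1_(A j) x) = \sum_(j < N) m (A j) /\
  bounded_on K (fun x => \sum_(j < N) \1_(A j) x : R).
Proof.
elim: N => [|N [IH bN]].
  rewrite big_ord0; under eq_fun do rewrite big_ord0.
  by split; [exact: L0|exact: bounded_on_cst].
under eq_fun do rewrite big_ord_recr/= -[X in X + _]mul1r.
split; last exact: bounded_onD.
by rewrite Llin// IH mul1r big_ord_recr.
Qed.

Let kK : closed K. Proof. exact: compact_closed. Qed.

Let muI (A : set T) : measurable (A : set (borel T)) ->
  riesz_measure A = riesz_measure (A `&` K).
Proof.
move=> mA; have mK : measurable (K : set (borel T)) by exact: closed_borel.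
rewrite [LHS](measureDI _ mA mK) -[RHS]add0e; congr (_ + _)%E.
apply/eqP; rewrite eq_le measure_ge0 andbT -riesz_measureC0.
by apply: le_mu_ext => x [].
Qed.

(** Layer-cake argument: the superlevel sets of [g] are closed, and closed sets are those on which
    [m] is bounded by the measure. *)
Let int_ge01 g : continuous g -> (forall x, K x -> 0 <= g x <= 1) ->
  L g <= \int[riesz_measure]_(x in K) g x.
Proof.
move=> cg g01.
have mK : measurable (K : set (borel T)) by exact: closed_borel.
have bg : bounded_on K g.
  by exists 1 => x /g01/andP[g0 g1]; rewrite ger0_norm.
have ig c : riesz_measure.-integrable (K : set (borel T)) (EFin \o (fun x => c
  * g x)).
  apply: (within_continuous_integrable riesz_measure_lty) => //.
  by apply: continuous_subspaceT => x; apply: cvgM; [exact: cvg_cst|exact: cg].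
set c := fine (riesz_measure (K : set (borel T))).
(* The level j = 0 is in excess and costs the total mass [c], which disappears after division by N +
   1. *)
suff h N : N.+1%:R * L g <= N.+1%:R * (\int[riesz_measure]_(x in K) g x) + c.
  apply/ler_addgt0Pr => e e0.
  have [N hN] : exists N, c / N.+1%:R < e.
    have [c0|c0] := leP c 0.
      by exists 0%N; rewrite (le_lt_trans _ e0)// divr1.
    have ce : 0 < e / c by rewrite divr_gt0.
    have [N _ /(_ _ (leqnn N))/=] := near_infty_natSinv_lt (PosNum ce).
    by exists N; rewrite mulrC -ltr_pdivlMr.
  have N0 : 0 < N.+1%:R :> R by [].
  have := h N; rewrite -ler_pdivlMl// mulrDr mulKf ?gt_eqF// => /le_trans;
    apply.
  by rewrite lerD2l mulrC ltW.
pose A j := [set x | (j%:R : R) <= N.+1%:R * g x].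
have cA j : closed (A j).
  have : continuous (fun x => N.+1%:R * g x).
    by move=> x; apply: cvgM; [exact: cvg_cst|exact: cg].
  by move/continuous_closedP => /(_ [set y | (j%:R : R) <= y]); apply;
    exact: closed_ge.
have mA j : measurable (A j : set (borel T)) by exact: closed_borel.
have AE j x : \1_(A j) x = (j%:R <= N.+1%:R * g x)%R%:R :> R.
  by rewrite indicE; congr (_ (nat_of_bool _)); apply/idP/idP; rewrite inE.
have step1 : N.+1%:R * L g <= \sum_(j < N.+1) m (A j).
  have := L_sum N.+1 A; move=> [<- bA].
  have -> : N.+1%:R * L g = L (fun x => N.+1%:R * g x + 0).
    by rewrite Llin// L0 addr0.
  apply: L_le => //; first exact: bounded_onD.
  move=> x Kx; rewrite addr0 (le_trans (@sum_steps_ge N.+1 _ _))//.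
    have /andP[g0 g1] := g01 x Kx.
    by rewrite mulr_ge0//= ler_piMr.
  by apply: ler_sum => j _; rewrite AE.
apply: (le_trans step1).
have step2 j : m (A j) <= fine (riesz_measure (A j `&` K : set (borel T))).
  rewrite -lee_fin fineK -?muI//; last exact: riesz_measure_fin.
  exact: closed_ge_m.
have step3 : \sum_(j < N) fine (riesz_measure (A j.+1 `&` K : set (borel T))) <=
    N.+1%:R * \int[riesz_measure]_(x in K) g x.
  rewrite -RintegralZl//; last first.
    by have := ig 1; under eq_fun do rewrite mul1r.
  rewrite -lee_fin -sumEFin /Rintegral fineK; last first.
    exact: integrable_fin_num (ig _).
  apply: (@le_trans _ _ (\sum_(j < N) \int[riesz_measure]_(x in K) (\1_(A j.+1) x)%:E)%E).
    apply: lee_sum => j _; rewrite integral_indic// fineK//.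
    by apply: riesz_measure_fin; exact: measurableI.
  rewrite -ge0_integral_sum//; last first.
    by move=> j; apply/measurable_realfun.measurable_EFinP;
      exact: measurable_indic.
  apply: ge0_le_integral => //.
  - by move=> x Kx; rewrite sume_ge0// => j _; rewrite lee_fin.
  - by apply: emeasurable_sum => j; apply/measurable_realfun.measurable_EFinP;
      exact: measurable_indic.
  - by have /integrableP[] := ig N.+1%:R.
  - move=> x Kx; rewrite sumEFin lee_fin.
    have /andP[g0 g1] := g01 x Kx.
    under eq_bigr do rewrite AE.
    by apply: sum_steps_le; rewrite mulr_ge0.
apply: (@le_trans _ _ (\sum_(j < N.+1) fine (riesz_measure (A j `&` K : set (borel T))))).
  exact: ler_sum.
rewrite big_ord_recl addrC lerD//=.
rewrite fine_le// ?riesz_measure_fin//; first exact: measurableI.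
by apply: le_mu_ext => x [].
Qed.

(** Affine rescaling into [0, 1]; the added constant is harmless because the measure of [K] is
    [m setT]. *)
Let int_ge g : continuous g -> L g <= \int[riesz_measure]_(x in K) g x.
Proof.
move=> cg.
have mK : measurable (K : set (borel T)) by exact: closed_borel.
have [C gC] : exists C : R, forall x, K x -> `|g x| <= C.
  by apply: compact_bounded_fun => //; exact: continuous_subspaceT.
have bg : bounded_on K g by exists C.
pose D := `|C| + 1; have D0 : 0 < D by rewrite ltr_wpDl.
have gD x : K x -> `|g x| <= D.
  move=> Kx; rewrite (le_trans (gC _ Kx))// (le_trans (ler_norm _))// lerDl//.
have ig h : continuous h -> riesz_measure.-integrable (K : set (borel T)) (EFin \o h).
  move=> ch; apply: (within_continuous_integrable riesz_measure_lty) => //.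
  exact: continuous_subspaceT.
have c' : continuous (fun x => (2 * D)^-1 * g x).
  by move=> x; apply: cvgM; [exact: cvg_cst|exact: cg].
have := @int_ge01 (fun x => (2 * D)^-1 * g x + 2^-1).
have LE : L (fun=> 2^-1) = 2^-1 * fine (riesz_measure (K : set (borel T))).
  rewrite -[K in fine (_ K)]setTI -muI//.
  rewrite [riesz_measure _]ms_setT/= /m indicT.
  have := @Llin 2^-1 (fun=> 1) (fun=> 0) (bounded_on_cst _) (bounded_on_cst _).
  by rewrite mulr1 !addr0 L0 addr0.
rewrite Llin// RintegralD//; [|exact: ig|by apply: ig => x; exact: cvg_cst].
rewrite Rintegral_cst// LE RintegralZl//; last exact: ig.
rewrite lerD2r ler_pM2l ?invr_gt0 ?mulr_gt0//; apply.
  by move=> x; apply: cvgD; [exact: c'|exact: cvg_cst].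
move=> x /gD; rewrite ler_norml => /andP[h1 h2].
have D20 : 0 < 2 * D by rewrite mulr_gt0.
have E : (2 * D)^-1 * g x + 2^-1 = (g x + D) / (2 * D) by field; rewrite gt_eqF.
apply/andP; split.
  by rewrite E; apply: divr_ge0; [lra|exact: ltW].
by rewrite E ler_pdivrMr//; lra.
Qed.

Lemma riesz_measureE g : continuous g -> \int[riesz_measure]_(x in K) g x = L g.
Proof.
move=> cg; apply: le_anti; rewrite int_ge// andbT.
have cN : continuous (fun x => -1 * g x).
  by move=> x; apply: cvgM; [exact: cvg_cst|exact: cg].
have [C gC] : exists C : R, forall x, K x -> `|g x| <= C.
  by apply: compact_bounded_fun => //; exact: continuous_subspaceT.
have := int_ge cN; rewrite RintegralZl//; [|exact: closed_borel|]; last first.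
  by apply: (within_continuous_integrable riesz_measure_lty) => //;
    exact: continuous_subspaceT.
have -> : (fun x => -1 * g x) = (fun x => -1 * g x + 0).
  by apply/funext => x; rewrite addr0.
rewrite Llin; [|by exists C|exact: bounded_on_cst].
by rewrite L0 addr0 !mulN1r lerN2.
Qed.

Lemma riesz_markov : exists mu : {measure set (borel T) -> \bar R},
  [/\ fin_num_fun mu, msupport mu `<=` K &
    forall g, continuous g -> \int[mu]_(x in K) g x = L g].
Proof.
exists riesz_measure; split; [exact: riesz_measure_fin| |exact: riesz_measureE].
move=> z hz; apply: contrapT => nKz.
have := hz _ (closed_openC kK) nKz.
by rewrite [X in (_ < X)%E]riesz_measureC0 ltxx.
Qed.

End riesz_markov.

(** * Absolutely continuous and Lipschitz functions *)

Section absolute_continuity.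
Variable R : realType.
Implicit Types (phi : R -> R) (a b t e : R).

Definition ac_real a b phi := forall e, 0 < e -> exists2 d : R, 0 < d &
  forall (k : nat) (s t : 'I_k -> R),
    (forall i, [/\ a <= s i, s i <= t i & t i <= b]) ->
    trivIset setT (fun i => `]s i, t i[%classic) ->
    \sum_i (t i - s i) < d -> \sum_i `|phi (t i) - phi (s i)| < e.

(** An upper bound on the derivative that makes sense without derivability; having it for every e >
    0 replaces phi'(t) <= 0. *)
Definition slope_le phi t e := \forall r \near t,
  (t <= r -> phi r - phi t <= e * (r - t)) /\
  (r <= t -> phi t - phi r <= e * (t - r)).

Lemma ac_real_comp n a b (x : R -> 'rV[R]_n) phi C : 0 <= C ->
  abs_continuous a b x ->
  (forall s t, a <= s -> s <= t -> t <= b ->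
     `|phi t - phi s| <= C * (t - s + `|x t - x s|)) ->
  ac_real a b phi.
Proof.
move=> C0 acx hphi e e0; pose D := C + 1.
have D0 : 0 < D by rewrite ltr_wpDl.
have eD : 0 < e / (2 * D) by rewrite divr_gt0// mulr_gt0.
have [d d0 hd] := acx _ eD.
exists (Num.min d (e / (2 * D))); first by rewrite lt_min d0.
move=> k s t hst triv; rewrite lt_min => /andP[/(hd k s t hst triv) h1 h2].
apply: (@le_lt_trans _ _ (\sum_i D * (t i - s i + `|x (t i) - x (s i)|))).
  apply: ler_sum => i _; have [h3 h4 h5] := hst i.
  apply: (le_trans (hphi _ _ h3 h4 h5)); rewrite ler_wpM2r ?lerDl//.
  by rewrite addr_ge0// subr_ge0.
rewrite -mulr_sumr big_split/= mulrC -ltr_pdivlMr//.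
have -> : e / D = e / (2 * D) + e / (2 * D) by field; rewrite gt_eqF.
exact: ltrD.
Qed.

(** The property propagated from [a] to [b]: increments over the listed intervals are left to
    absolute continuity, the rest is paid by the slope bound. Ordered sequences over [nat] make it
    easy to append an interval and give disjointness at the end. *)
Let chain phi a G t e := exists k (s r : nat -> R),
  [/\ forall i, (i < k)%N -> [/\ a <= s i, s i <= r i & r i <= t],
      forall i j, (i < j)%N -> (j < k)%N -> r i <= s j,
      forall i, (i < k)%N -> `]s i, r i[%classic `<=` G &
      phi t - phi a <= e * (t - a) + \sum_(i < k) `|phi (r i) - phi (s i)|].

Let chain_slope phi a G t t' e : t <= t' -> chain phi a G t e ->
  phi t' - phi t <= e * (t' - t) -> chain phi a G t' e.
Proof.
move=> tt' [k [s [r [h1 h2 h3 h4]]]] h; exists k, s, r; split => //.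
  by move=> i /h1[? ? ?]; split => //; exact: le_trans tt'.
by move: h h4; rewrite !mulrBr; lra.
Qed.

Let chain_open phi a G t t' e : 0 <= e -> a <= t -> t <= t' -> chain phi a G t e ->
  `]t, t'[%classic `<=` G -> chain phi a G t' e.
Proof.
move=> e0 at_ tt' [k [s [r [h1 h2 h3 h4]]]] tG.
exists k.+1, (fun i => if (i < k)%N then s i else t),
  (fun i => if (i < k)%N then r i else t'); split.
- move=> i; rewrite ltnS leq_eqVlt => /orP[/eqP ->|ik].
    by rewrite ltnn; split.
  by rewrite ik; have [? ? ?] := h1 i ik; split => //; exact: le_trans tt'.
- move=> i j ij; rewrite ltnS leq_eqVlt => /orP[/eqP jk|jk].
    by rewrite jk in ij *; rewrite ij ltnn; have [] := h1 i ij.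
  by rewrite (ltn_trans ij jk) jk; exact: h2.
- move=> i; rewrite ltnS leq_eqVlt => /orP[/eqP ->|ik]; first by rewrite ltnn.
  by rewrite ik; exact: h3.
- rewrite big_ord_recr/= ltnn.
  under eq_bigr => i _ do rewrite ltn_ord.
  have : e * (t - a) <= e * (t' - a) by rewrite ler_wpM2l// lerB.
  have := ler_norm (phi t' - phi t); lra.
Qed.

(** Ordered intervals are disjoint, so their total length is at most the measure of the set [G] that
    contains them. *)
Let chain_length G d : open G ->
  (lebesgue_measure G < d%:E)%E -> forall k (s r : nat -> R),
  (forall i, (i < k)%N -> s i <= r i) ->
  (forall i j, (i < j)%N -> (j < k)%N -> r i <= s j) ->
  (forall i, (i < k)%N -> `]s i, r i[%classic `<=` G) ->
  trivIset setT (fun i : 'I_k => `]s i, r i[%classic) /\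
  \sum_(i < k) (r i - s i) < d.
Proof.
move=> oG Gd k s r h1 h2 h3.
pose F i := if (i < k)%N then `]s i, r i[%classic else set0.
have tF : trivIset setT F.
  apply/trivIsetP => i j _ _; rewrite /F.
  wlog: i j / (i < j)%N.
    move=> h; rewrite neq_lt => /orP[ij|ij]; first by apply: h; rewrite ?lt_eqF.
    by rewrite setIC; apply: h; rewrite ?lt_eqF.
  move=> ij _; have [jk|jk] := ltnP j k; last by rewrite setI0.
  rewrite (ltn_trans ij jk); apply/seteqP; split => // x [] /=.
  rewrite !in_itv/= => /andP[_ xr] /andP[sx _].
  by have := lt_trans xr (le_lt_trans (h2 _ _ ij jk) sx); rewrite ltxx.
split.
  apply/trivIsetP => i j _ _ ij; move/trivIsetP: tF => /(_ i j I I).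
  by rewrite /F !ltn_ord; apply; apply: contra ij => /eqP /ord_inj ->.
have mF i : measurable (F i).
  by rewrite /F; case: ifP => // _; exact: measurable_itv.
rewrite -lte_fin; apply: le_lt_trans Gd.
rewrite -sumEFin.
have -> : (\sum_(i < k) (r i - s i)%:E = \sum_(i < k) lebesgue_measure (F i))%E.
  apply: eq_bigr => i _; rewrite /F ltn_ord lebesgue_measure_itv/= lte_fin.
  case: ltP => // h; have := h1 i (ltn_ord i) => h'.
  by rewrite (@le_anti _ _ (r i) (s i)) ?subrr// h h'.
have mU : measurable (\big[setU/set0]_(i < k) F i).
  by apply: bigsetU_measurable.
rewrite -measure_semi_additive// le_measure ?inE//.
  exact: open_measurable.
rewrite -bigcup_mkord => x [i /= ik]; rewrite /F ik; exact: h3.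
Qed.

(* Cousin-type argument: points outside the exceptional null set propagate the
   slope bound, the others are absorbed by intervals of a small open set. *)
Lemma ac_nonincreasing a b phi : a <= b -> ac_real a b phi ->
  {ae @lebesgue_measure R, forall t, a <= t <= b -> forall e, 0 < e ->
    slope_le phi t e} ->
  phi b <= phi a.
Proof.
move=> ab acphi [N [mN N0 hN]].
apply/ler_addgt0Pr => e' e'0.
(* The slope part will cost e (b - a) and the absolutely continuous part less than e, together
   e'. *)
pose e := e' / (b - a + 1).
have ba1 : 0 < b - a + 1 by rewrite ltr_wpDl// subr_ge0.
have e0 : 0 < e by rewrite divr_gt0.
have [d d0 hd] := acphi _ e0.
have Noo : (lebesgue_measure N < +oo)%E by rewrite [X in (X < _)%E]N0 ltry.
have [G [oG NG Gd]] := lebesgue_regularity_outer mN Noo d0.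
have {}Gd : (lebesgue_measure G < d%:E)%E.
  rewrite (_ : lebesgue_measure G = lebesgue_measure (G `\` N))//.
  rewrite (measureDI (@lebesgue_measure R) (open_measurable oG) mN).
  rewrite [X in (_ + X)%E](_ : _ = 0%E) ?adde0//.
  apply/eqP; rewrite eq_le measure_ge0 andbT -N0 le_measure ?inE//.
  by apply: measurableI => //; exact: open_measurable.
have slope t : a <= t <= b -> ~ G t -> slope_le phi t e.
  move=> tab nGt; have : ~ (~` [set x | a <= x <= b -> forall e, 0 < e ->
    slope_le phi x e]) t by move/hN/NG.
  by move/contrapT; apply.
suff [k [s [r [h1 h2 h3 h4]]]] : chain phi a G b e.
  have [i|tr sd] := chain_length oG Gd _ h2 h3; first by case/h1.
  have := hd k (fun i => s i) (fun i => r i) (fun i => h1 i (ltn_ord i)) tr sd.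
  have : e * (b - a + 1) = e' by rewrite /e divfK// gt_eqF.
  move: h4; lra.
have c_a : chain phi a G a e.
  by exists 0%N, (fun=> a), (fun=> a); split => //;
    rewrite !subrr mulr0 big_ord0 addr0.
pose S := [set t | a <= t <= b /\ chain phi a G t e].
have supS : has_sup S.
  by split; [exists a; split => //; rewrite lexx ab|exists b => t [/andP[]]].
pose c := sup S.
have ac : a <= c by apply: (ub_le_sup supS.2); split => //; rewrite lexx ab.
have cb : c <= b by apply: ge_sup; [exact: supS.1|move=> t [/andP[]]].
have cab : a <= c <= b by rewrite ac cb.
(* Local propagation around the supremum [c]: by an interval of [G] if [c] lies in [G], by the slope
   bound at [c] otherwise. From the left it brings the chain to [c]; from [c] it carries the chain
   further, unless c = b. *)
have [eta eta0 heta] : exists2 eta, 0 < eta & forall t, a <= t -> `|t - c| < eta ->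
    (t <= c -> chain phi a G t e -> chain phi a G c e) /\
    (c <= t -> chain phi a G c e -> chain phi a G t e).
  have [Gc|nGc] := pselect (G c).
    have /nbhs_ballP[eta /= eta0 etaG] : nbhs c G by exact: open_nbhs_nbhs.
    exists eta => // t at_ tc; split => [tlec|clet] ch.
      apply: chain_open ch _ => //; first exact: ltW.
      move=> x /=; rewrite in_itv/= => /andP[tx xc]; apply: etaG.
      by rewrite /ball/= gtr0_norm ?subr_gt0//; move: tc; rewrite ler0_norm;
        lra.
    apply: chain_open ch _ => //; first exact: ltW.
    move=> x /=; rewrite in_itv/= => /andP[tx xc]; apply: etaG.
    by rewrite /ball/= ltr0_norm ?subr_lt0//; move: tc; rewrite ger0_norm; lra.
  have /nbhs_ballP[eta /= eta0 etaG] := slope c cab nGc.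
  exists eta => // t at_ tc; have [] := etaG t; first by rewrite /ball/= distrC.
  move=> sl1 sl2; split => [tlec|clet] ch.
    by exact: chain_slope tlec ch (sl2 tlec).
  by exact: chain_slope clet ch (sl1 clet).
have chc : chain phi a G c e.
  have [t [/andP[at_ tb] cht] ct] := sup_adherent eta0 supS.
  have tc : t <= c by apply: (ub_le_sup supS.2); split => //; rewrite at_ tb.
  have [] := heta t at_; last by move=> /(_ tc cht).
  by rewrite ler0_norm ?subr_le0//; move: ct; rewrite -/c; lra.
have [bc|cltb] := leP b c.
  by rewrite (@le_anti _ _ b c) ?bc ?cb.
pose t := Num.min b (c + eta / 2).
have ct : c < t by rewrite lt_min cltb/= ltrDl divr_gt0.
have : S t.
  split; first by rewrite (le_trans ac (ltW ct))/= ge_min lexx.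
  have [||_ h] := heta t; first exact: le_trans (ltW ct).
    rewrite gtr0_norm ?subr_gt0//.
    have : t <= c + eta / 2 by rewrite ge_min lexx orbT.
    lra.
  exact: h (ltW ct) chc.
move=> /(ub_le_sup supS.2); rewrite -/c => /(lt_le_trans ct).
by rewrite ltxx.
Qed.

End absolute_continuity.

(** * Almost everywhere derivability of Lipschitz functions *)

Section lipschitz_half.
Variables (R : realType) (g : R -> R).
Hypothesis gl : forall s t, `|g t - g s| <= `|t - s|.

(* Both are nondecreasing and add up to the identity, so that their Stieltjes
   measures are dominated by the Lebesgue measure. *)
Definition half_sum (t : R) : R := (t + g t) / 2.
Definition half_diff (t : R) : R := (t - g t) / 2.

Let glip s t : s <= t -> - (t - s) <= g t - g s <= t - s.
Proof.
by move=> st; have := gl s t;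
  rewrite (ger0_norm (_ : 0 <= t - s)) ?subr_ge0// ler_norml.
Qed.

Let half_sum_nd : {homo half_sum : s t / s <= t}.
Proof. by move=> s t /glip /andP[h1 h2]; rewrite /half_sum; lra. Qed.

Let half_diff_nd : {homo half_diff : s t / s <= t}.
Proof. by move=> s t /glip /andP[h1 h2]; rewrite /half_diff; lra. Qed.

Let half_sum_c : continuous half_sum.
Proof.
apply: (@lipschitz1_continuous _ _ _ 1) => s t; rewrite mul1r /half_sum.
have h : `|s - t + (g s - g t)| <= `|s - t| + `|s - t|.
  by rewrite (le_trans (ler_normD _ _))// lerD2l gl.
rewrite -mulrBl normrM (ger0_norm (_ : 0 <= 2^-1))// ler_pdivrMr//.
have -> : s + g s - (t + g t) = s - t + (g s - g t) by ring.
lra.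
Qed.

Let half_diff_c : continuous half_diff.
Proof.
apply: (@lipschitz1_continuous _ _ _ 1) => s t; rewrite mul1r /half_diff.
have h : `|s - t + (g t - g s)| <= `|s - t| + `|s - t|.
  by rewrite (le_trans (ler_normD _ _))// lerD2l (distrC s) gl.
rewrite -mulrBl normrM (ger0_norm (_ : 0 <= 2^-1))// ler_pdivrMr//.
have -> : s - g s - (t - g t) = s - t + (g t - g s) by ring.
lra.
Qed.

Let half_sum_rc : right_continuous half_sum.
Proof. by move=> x; apply: cvg_within_filter; exact: half_sum_c. Qed.

Let half_diff_rc : right_continuous half_diff.
Proof. by move=> x; apply: cvg_within_filter; exact: half_diff_c. Qed.

HB.instance Definition _ := isCumulative.Build R _ R half_sum half_sum_nd half_sum_rc.
HB.instance Definition _ := isCumulative.Build R _ R half_diff half_diff_nd half_diff_rc.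

Let nu := lebesgue_stieltjes_measure half_sum.
Let nu' := lebesgue_stieltjes_measure half_diff.

Let nuE a b : a <= b -> nu `]a, b]%classic = (half_sum b - half_sum a)%:E.
Proof.
move=> ab; rewrite /nu /lebesgue_stieltjes_measure /measure_extension.
by rewrite measurable_mu_extE/=; [rewrite wlength_itv_bnd|exact: is_ocitv].
Qed.

Let nu'E a b : a <= b -> nu' `]a, b]%classic = (half_diff b - half_diff a)%:E.
Proof.
move=> ab; rewrite /nu' /lebesgue_stieltjes_measure /measure_extension.
by rewrite measurable_mu_extE/=; [rewrite wlength_itv_bnd|exact: is_ocitv].
Qed.

Let nu_le (A : set (measurableTypeR R)) : measurable A -> (nu A <=
  lebesgue_measure A)%E.
Proof.
move=> mA; suff E X : ocitv X -> lebesgue_measure X = measure_add nu nu' X.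
  rewrite (lebesgue_measure_unique E mA).
  apply: (@le_trans _ _ (nu A + nu' A)%E); first exact: leeDl.
  by rewrite -(measure_addE nu nu').
move: X.
move=> _ [[a b] _ <-]; rewrite measure_addE/=.
have [ab|ba] := leP a b; last by rewrite set_itv_ge ?measure0 ?adde0// -leNgt bnd_simp ltW.
rewrite -/nu -/nu' nuE// nu'E// lebesgue_measure_itv/= lte_fin -EFinD /half_sum /half_diff.
case: ltP => // [_|ba]; first by congr EFin; field.
have -> : a = b by apply: le_anti; rewrite ab ba.
by congr EFin; ring.
Qed.

(** On a bounded interval the Stieltjes measure has a Radon-Nikodym density, so [half_sum] is an
    indefinite integral there, derivable at each Lebesgue point of the density. *)
Let derivable_half_sum (k : nat) :
  {ae @lebesgue_measure R, forall t, - k%:R < t < k%:R -> derivable half_sum t 1}.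
Proof.
pose K : R := k%:R; have K0 : 0 <= K by [].
pose D : set (measurableTypeR R) := `]- K, K]%classic.
have mD : measurable D by exact: measurable_itv.
have Doo : (nu D < +oo)%E by rewrite nuE ?ltry//; lra.
pose n1 := mfrestr mD Doo.
have n1E (A : set (measurableTypeR R)) : n1 A = nu (A `&` D) by [].
have dom : n1 `<< @lebesgue_measure R.
  apply/null_content_dominatesP => A mA A0.
  apply/eqP; rewrite eq_le measure_ge0 andbT -A0 n1E.
  apply: (@le_trans _ _ (nu A)); last exact: nu_le.
  by apply: le_measure; rewrite ?inE//; exact: measurableI.
have [f [f0 ffin fint fE]] := radon_nikodym_sigma_finite dom.
pose h := fine \o f.
have hE : EFin \o h = f by apply/funext => x /=; rewrite fineK.
have hint : lebesgue_measure.-integrable setT (EFin \o h) by rewrite hE.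
have hloc := open_integrable_locally openT hint.
have [N [mN N0 hN]] := lebesgue_differentiation hloc.
exists N; split => //; apply: subset_trans hN => t.
apply: contra_not => /= tpt /andP[Kt tK].
have hint' : lebesgue_measure.-integrable
    [set` Interval (BRight (- K)) (BRight K)] (EFin \o h).
  by apply: integrableS hint => //; exact: measurable_itv.
have Kt' : (BRight (- K) < BRight t)%O by rewrite bnd_simp.
have [der _] := FTC1_lebesgue_pt tK hint' Kt' tpt.
have eqn : \forall y \near t, half_sum y - half_sum (- K) =
    \int[lebesgue_measure]_(s in [set` Interval (BRight (- K)) (BRight y)]) h s.
  have : nbhs t `]- K, K[%classic by apply: open_nbhs_nbhs; split;
    [exact: interval_open|rewrite /= in_itv/= Kt tK].
  apply: filterS => y /=; rewrite in_itv/= => /andP[Ky yK].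
  rewrite /Rintegral.
  under eq_integral => z _ do rewrite -[(h z)%:E]/((EFin \o h) z) hE.
  rewrite -fE; last exact: measurable_itv.
  rewrite -[RHS]/(fine (nu (`]- K, y]%classic `&` D))) (_ : _ `&` _ = `]- K,
    y]%classic) ?nuE ?ltW//.
  apply/seteqP; split => z; first by case.
  rewrite /D /= !in_itv/= => /andP[h1 h2].
  by rewrite h1 h2 (le_trans h2 (ltW yK)).
have der' : derivable (fun y => half_sum y - half_sum (- K)) t 1.
  apply: near_eq_derivable der.
  by apply: filterS eqn => y ->.
have -> : half_sum = (fun y => half_sum y - half_sum (- K)) \+ cst (half_sum (- K)).
  by apply/funext => y /=; rewrite subrK.
by apply: derivableD.
Qed.

Lemma lipschitz1_derivable : {ae @lebesgue_measure R, forall t, derivable g t 1}.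
Proof.
have [N [mN N0 hN]] := ae_foralln derivable_half_sum.
exists N; split => //; apply: subset_trans hN => t; apply: contra_not => /= h.
have [k kt] : exists k : nat, - k%:R < t < k%:R.
  exists (Num.bound `|t|); have := archi_boundP (normr_ge0 t).
  by rewrite ltr_norml.
have -> : g = (fun s => 2 * half_sum s) \- id.
  by apply/funext => s /=; rewrite /half_sum; field.
apply: derivableB; last exact: derivable_id.
by apply: derivableM => //; exact: h kt.
Qed.

End lipschitz_half.

Lemma lipschitz_derivable (R : realType) (g : R -> R) C :
  (forall s t, `|g t - g s| <= C * `|t - s|) ->
  {ae @lebesgue_measure R, forall t, derivable g t 1}.
Proof.
move=> gC; pose D := `|C| + 1; have D0 : 0 < D by rewrite ltr_wpDl.
have := @lipschitz1_derivable R (fun s => D^-1 * g s).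
case=> [s t|N [mN N0 hN]].
  rewrite -mulrBr normrM gtr0_norm ?invr_gt0// ler_pdivrMl//.
  rewrite (le_trans (gC s t))// ler_wpM2r// (le_trans (ler_norm _))//.
  by rewrite lerDl.
exists N; split => //; apply: subset_trans hN => t; apply: contra_not => /= h.
have -> : g = (fun s => D * (D^-1 * g s)).
  by apply/funext => s; rewrite mulVKf// gt_eqF.
exact: derivableM.
Qed.

(** * Convex hulls *)

Section convex_sets.
Variables (R : realType) (n : nat).
Implicit Types (A : set 'rV[R]_n) (x y z d p : 'rV[R]_n).

Lemma convex_setP A : convex_set A <->
  forall x y (l : R), 0 <= l <= 1 -> A x -> A y -> A (l *: x + (1 - l) *: y).
Proof.
split=> [cA x y l /andP[l0 l1] Ax Ay|cA x y l /set_mem Ax /set_mem Ay].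
  have := cA x y (Itv01 l0 l1) (mem_set Ax) (mem_set Ay).
  by move/set_mem.
apply/mem_set; apply: cA => //; exact/andP.
Qed.

Lemma conv_hull_convex A : convex_set (conv_hull A).
Proof.
apply/convex_setP => x y l l01 hx hy B [cB AB].
move/convex_setP: (cB); apply => //; [exact: hx|exact: hy].
Qed.

Lemma sub_conv_hull A : A `<=` conv_hull A.
Proof. by move=> x Ax B [_]; apply. Qed.

Lemma conv_hull_sub A B : convex_set B -> A `<=` B -> conv_hull A `<=` B.
Proof. by move=> cB AB x; apply. Qed.

(** These are the convex combinations of k + 1 points of [A], written so that compactness is
    inherited from [A] through continuous images. For k = n they exhaust the convex hull. *)
Fixpoint joins A k : set 'rV[R]_n := if k is k'.+1 then
  [set q.1.1 *: q.1.2 + (1 - q.1.1) *: q.2 | q in (`[0%R, 1%R] `*` joins A k') `*` A] else A.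

Lemma joins_compact A k : compact A -> compact (joins A k).
Proof.
move=> cA; elim: k => //= k IH.
apply: continuous_compact; last first.
  by apply: compact_setX => //; apply: compact_setX => //;
    exact: segment_compact.
apply: continuous_subspaceT => q.
apply: cvgD; apply: cvgZ.
- by apply: cvg_comp; [exact: cvg_fst|exact: cvg_fst].
- by apply: cvg_comp; [exact: cvg_fst|exact: cvg_snd].
- apply: cvgB; first exact: cvg_cst.
  by apply: cvg_comp; [exact: cvg_fst|exact: cvg_fst].
- exact: cvg_snd.
Qed.

Lemma joins_sub_hull A k : joins A k `<=` conv_hull A.
Proof.
elim: k => [|k IH]; first exact: sub_conv_hull.
move=> _ [[[l x] z] [[/= l01 jx] Az] <-];
  have /convex_setP := @conv_hull_convex A.
apply; [by move: l01; rewrite in_itv|exact: IH|exact: sub_conv_hull].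
Qed.

Lemma joins_mem A k x : A x -> joins A k x.
Proof.
move=> Ax; elim: k => //= k IH; exists ((1, x), x) => /=.
  by split => //=; split => //=; rewrite in_itv/= lexx ler01.
by rewrite subrr scale0r addr0 scale1r.
Qed.

(** Points are the rows of a matrix, so that an affine dependency among them is a kernel vector. *)
Definition combination A k d := exists (a : 'rV[R]_k) (Z : 'M[R]_(k, n)),
  [/\ forall i, 0 <= a 0 i, \sum_i a 0 i = 1, forall i, A (row i Z) & d = a *m Z].

Lemma joins_combination A k : joins A k `<=` combination A k.+1.
Proof.
elim: k => [|k IH] d /=.
  move=> Ad; exists (const_mx 1), d; split.
  - by move=> i; rewrite mxE.
  - by rewrite big_ord1 mxE.
  - by move=> i; rewrite ord1 row_id.
  - by rewrite (_ : const_mx 1 = 1%:M) ?mul1mx//; apply/matrixP => i j;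
      rewrite !ord1 !mxE.
move=> [[[l x] z] [[/=]]];
  rewrite in_itv/= => /andP[l0 l1] /IH[a [Z [a0 a1 AZ ->]]] Az <-.
rewrite -[k.+2]addn1.
exists (row_mx (l *: a) (const_mx (1 - l) : 'rV_1)), (col_mx Z z); split.
- move=> i; rewrite -[i]splitK; case: (fintype.split i) => j /=.
    by rewrite row_mxEl mxE mulr_ge0.
  by rewrite row_mxEr mxE subr_ge0.
- rewrite big_split_ord/= (eq_bigr (fun i => l * a 0 i)).
    by rewrite -mulr_sumr a1 mulr1 big_ord1 row_mxEr mxE; ring.
  by move=> i _; rewrite row_mxEl mxE.
- move=> i; rewrite -[i]splitK; case: (fintype.split i) => j /=.
    by rewrite rowKu.
  by rewrite rowKd ord1 row_id.
- rewrite mul_row_col -scalemxAl; congr (_ + _).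
  by rewrite (_ : const_mx _ = (1 - l)%:M) ?mul_scalar_mx//;
    apply/matrixP => i j; rewrite !ord1 !mxE.
Qed.

Lemma combination_joins A k : combination A k.+1 `<=` joins A k.
Proof.
elim: k => [|k IH] d [a [Z [a0 a1 AZ ->]]].
  move: a1; rewrite big_ord1 => a1.
  have -> : a = 1%:M by apply/matrixP => i j; rewrite !ord1 mxE a1.
  by have := AZ 0; rewrite mul1mx row_id.
move: a Z a0 a1 AZ; rewrite -[k.+2]addn1 => a Z a0.
rewrite -[a]hsubmxK -[Z]vsubmxK; set b := lsubmx a; set c := rsubmx a.
set Y := usubmx Z; set z := dsubmx Z => a1 AZ; rewrite mul_row_col.
have b0 i : 0 <= b 0 i by rewrite mxE.
have c0 : 0 <= c 0 0 by rewrite mxE.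
have bc : \sum_i b 0 i + c 0 0 = 1.
  move: a1; rewrite big_split_ord/= big_ord1.
  by under eq_bigr do rewrite row_mxEl; rewrite row_mxEr.
have AY i : A (row i Y) by have := AZ (lshift 1 i); rewrite rowKu.
have Az : A z by have := AZ (rshift _ 0); rewrite rowKd row_id.
have cz : c *m z = c 0 0 *: z.
  by rewrite [c in LHS]mx11_scalar mul_scalar_mx.
have sb : \sum_i b 0 i = 1 - c 0 0 by rewrite -bc addrK.
have sb0 : 0 <= \sum_i b 0 i by apply: sumr_ge0.
(* If the last point has all the weight, the others cannot be renormalised; any one of them then
   stands in with weight 0. *)
have [c1|c1] := eqVneq (c 0 0) 1.
  have b00 i : b 0 i = 0.
    have /eqP : \sum_i b 0 i = 0 by rewrite sb c1 subrr.
    by rewrite psumr_eq0// => /allP/(_ i (mem_index_enum i))/eqP.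
  exists ((0, row 0 Y), z) => /=.
    split => //=; split; first by rewrite /= in_itv/= lexx ler01.
    exact/joins_mem/AY.
  rewrite scale0r add0r subr0 cz c1 [b](_ : _ = 0) ?mul0mx ?add0r//.
  by apply/rowP => i; rewrite b00 mxE.
have sbn0 : \sum_i b 0 i != 0 by rewrite sb subr_eq0 eq_sym.
exists ((\sum_i b 0 i, ((\sum_i b 0 i)^-1 *: b) *m Y), z) => /=.
  split => //=; split; first by rewrite /= in_itv/= sb0 sb gerBl.
  apply: IH; exists ((\sum_i b 0 i)^-1 *: b), Y; split => //.
    by move=> i; rewrite mxE mulr_ge0// invr_ge0.
  by under eq_bigr do rewrite mxE; rewrite -mulr_sumr mulVf.
by rewrite -scalemxAl scalerA divff// scale1r cz sb subKr.
Qed.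

(* Caratheodory: move along an affine dependency until a weight vanishes. *)
Lemma combination_reduce A k : (n < k)%N -> combination A k.+1 `<=` combination A k.
Proof.
move=> nk d [a [Z [a0 a1 AZ ->]]].
(* The column of ones forces the entries of a kernel vector to sum to zero. The rank is at most n +
   1, less than the k + 1 rows, so the kernel is nonzero. *)
pose M := row_mx Z (const_mx 1 : 'cV_k.+1).
have : kermx M != 0.
  rewrite -mxrank_eq0 mxrank_ker subn_eq0 -ltnNge ltnS.
  by rewrite (leq_trans (rank_leq_col _))// addn1.
move=> /rowV0Pn[c /sub_kermxP cM cn0].
move: cM; rewrite mul_mx_row -[0]hsubmxK => /eq_row_mx[].
rewrite !linear0 => cZ cs.
have {}cs : \sum_i c 0 i = 0.
  move: cs => /matrixP/(_ 0 0); rewrite !mxE => h; rewrite -[RHS]h.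
  by apply: eq_bigr => i _; rewrite mxE mulr1.
have [i0 ci0] : exists i, 0 < c 0 i.
  apply: contrapT => /forallNP h; move/negP: cn0; apply; apply/eqP/rowP => i.
  rewrite mxE; have le0 j : c 0 j <= 0 by rewrite leNgt; apply/negP/h.
  have /eqP : \sum_i - c 0 i = 0 by rewrite sumrN cs oppr0.
  rewrite psumr_eq0; last by move=> j _; rewrite oppr_ge0.
  by move/allP => /(_ i (mem_index_enum i)); rewrite oppr_eq0 => /eqP.
(* The smallest ratio a_i / c_i with c_i > 0 is the first t at which a weight of a - t c reaches
   0. *)
case: (@arg_minP _ _ _ i0 (fun i => 0 < c 0 i) (fun i => a 0 i / c 0 i) ci0) => i ci mini.
pose t := a 0 i / c 0 i.
have t0 : 0 <= t by rewrite divr_ge0// ltW.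
pose b := a - t *: c.
have b0 j : 0 <= b 0 j.
  rewrite !mxE subr_ge0; have [cj|cj] := ltP 0 (c 0 j).
    by rewrite -ler_pdivlMr// mini.
  by rewrite (le_trans _ (a0 j))// mulr_ge0_le0.
have bi : b 0 i = 0 by rewrite !mxE /t divfK ?subrr// gt_eqF.
exists (col' i b), (row' i Z); split.
- by move=> j; rewrite mxE.
- under eq_bigr do rewrite mxE.
  have : \sum_j b 0 j = 1.
    under eq_bigr do rewrite !mxE.
    by rewrite big_split/= sumrN -mulr_sumr cs mulr0 subr0.
  by rewrite (bigD1_ord i)//= bi add0r.
- move=> j; have -> : row j (row' i Z) = row (lift i j) Z by apply/rowP => ?;
    rewrite !mxE.
  exact: AZ.
- have -> : a *m Z = b *m Z by rewrite mulmxBl -scalemxAl cZ scaler0 subr0.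
  apply/rowP => j; rewrite !mxE (bigD1_ord i)//= bi mul0r add0r.
  by apply: eq_bigr => l _; rewrite !mxE.
Qed.

(** A combination of two points of [joins A n] uses 2 (n + 1) points of [A], which
    [combination_reduce] brings back to n + 1. *)
Lemma joins_convex A : convex_set (joins A n).
Proof.
apply/convex_setP => x y l /andP[l0 l1] /joins_combination[a [Y [a0 a1 AY ->]]].
move=> /joins_combination[b [Z [b0 b1 AZ ->]]].
apply: combination_joins.
have red k : combination A (n.+1 + k) `<=` combination A n.+1.
  elim: k => [|k IH]; first by rewrite addn0.
  rewrite addnS; apply: subset_trans IH; apply: combination_reduce.
  by rewrite addSn ltnS leq_addr.
apply: (red n.+1).
exists (row_mx (l *: a) ((1 - l) *: b)), (col_mx Y Z); split.
- move=> i; rewrite -[i]splitK; case: (fintype.split i) => j /=.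
    by rewrite row_mxEl mxE mulr_ge0.
  by rewrite row_mxEr mxE mulr_ge0// subr_ge0.
- rewrite big_split_ord/= (eq_bigr (fun i => l * a 0 i)); last first.
    by move=> i _; rewrite row_mxEl mxE.
  rewrite [X in _ + X](eq_bigr (fun i => (1 - l) * b 0 i)); last first.
    by move=> i _; rewrite row_mxEr mxE.
  by rewrite -!mulr_sumr a1 b1; ring.
- move=> i; rewrite -[i]splitK; case: (fintype.split i) => j /=.
    by rewrite rowKu.
  by rewrite rowKd.
- by rewrite mul_row_col -!scalemxAl.
Qed.

End convex_sets.

(** * Separation and support functions *)

Section separation.
Variables (R : realType) (n : nat).
Implicit Types (A : set 'rV[R]_n) (x y z d p : 'rV[R]_n).

Lemma dotpC x y : dotp x y = dotp y x.
Proof. by apply: eq_bigr => i _; rewrite mulrC. Qed.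

Lemma dotpDr p x y : dotp p (x + y) = dotp p x + dotp p y.
Proof. by rewrite /dotp -big_split; apply: eq_bigr => i _;
  rewrite mxE mulrDr. Qed.

Lemma dotpZr p (c : R) x : dotp p (c *: x) = c * dotp p x.
Proof. by rewrite /dotp mulr_sumr; apply: eq_bigr => i _;
  rewrite mxE mulrCA. Qed.

Lemma dotpNr p x : dotp p (- x) = - dotp p x.
Proof. by rewrite -scaleN1r dotpZr mulN1r. Qed.

Lemma dotpBr p x y : dotp p (x - y) = dotp p x - dotp p y.
Proof. by rewrite dotpDr dotpNr. Qed.

Lemma dotpDl p x y : dotp (x + y) p = dotp x p + dotp y p.
Proof. by rewrite !(dotpC _ p) dotpDr. Qed.

Lemma dotpBl p x y : dotp (x - y) p = dotp x p - dotp y p.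
Proof. by rewrite !(dotpC _ p) dotpBr. Qed.

Lemma dotpZl p (c : R) x : dotp (c *: x) p = c * dotp x p.
Proof. by rewrite !(dotpC _ p) dotpZr. Qed.

Lemma dotp_eq0 x : dotp x x <= 0 -> x = 0.
Proof.
move=> x0; have h i : 0 <= x 0 i * x 0 i by rewrite -expr2 sqr_ge0.
have /eqP : dotp x x = 0 by apply: le_anti; rewrite x0 sumr_ge0.
rewrite psumr_eq0// => /allP/= e; apply/rowP => i; rewrite mxE.
by have := e i (mem_index_enum i); rewrite -expr2 sqrf_eq0 => /eqP.
Qed.

Lemma coord_le_norm x i : `|x 0 i| <= `|x|.
Proof.
rewrite [leRHS]/Num.Def.normr/= mx_normrE.
by apply: (le_trans _ (le_bigmax _ _ (0, i))).
Qed.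

Lemma norm_le_coord x (c : R) : 0 <= c -> (forall i, `|x 0 i| <= c) -> `|x| <= c.
Proof.
move=> c0 xc; rewrite [leLHS]/Num.Def.normr/= mx_normrE.
by apply: bigmax_le => // -[i j] _; rewrite ord1.
Qed.

Definition norm1 p : R := \sum_i `|p 0 i|.

Lemma norm1_ge0 p : 0 <= norm1 p.
Proof. by apply: sumr_ge0. Qed.

Lemma dotp_le p x : `|dotp p x| <= norm1 p * `|x|.
Proof.
rewrite /dotp (le_trans (ler_norm_sum _ _ _))// /norm1 mulr_suml ler_sum// => i _.
by rewrite normrM ler_wpM2l// coord_le_norm.
Qed.

Lemma dotp_continuous p : continuous (dotp p).
Proof.
apply: (@lipschitz1_continuous _ _ _ (norm1 p)) => x y.
by rewrite -dotpBr dotp_le.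
Qed.

(** Nearest-point argument. Row vectors carry the sup norm, so the Euclidean distance is expressed
    with [dotp]; the hypothesis is applied to the direction from the nearest point [z0] to [d]. *)
Lemma convex_separation A d : compact A -> convex_set A -> A !=set0 ->
  (forall p b, (forall z, A z -> dotp p z <= b) -> dotp p d <= b) -> A d.
Proof.
move=> cA /convex_setP vA A0 hd.
pose q z := dotp (d - z) (d - z).
have cq : {within A, continuous q}.
  apply: continuous_subspaceT; apply: continuous_sum => i z.
  under eq_fun do rewrite !mxE.
  have cc : {for z, continuous (fun y : 'rV[R]_n => d 0 i - y 0 i)}.
    apply: (@lipschitz1_continuous _ _ _ 1) => x y; rewrite mul1r distrC.
    have -> : d 0 i - y 0 i - (d 0 i - x 0 i) = (x - y) 0 i by rewrite !mxE;
      ring.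
    exact: coord_le_norm.
  exact: (continuousM cc cc).
have [z0 /set_mem Az0 minz0] := EVT_min_rV A0 cA cq.
suff -> : d = z0 by [].
apply/eqP; rewrite -subr_eq0; apply/eqP/dotp_eq0.
set p := d - z0.
suff h z : A z -> dotp p z <= dotp p z0.
  by have := hd p _ h; rewrite -subr_le0 -dotpBr.
move=> Az; rewrite leNgt; apply/negP => lt.
have e z' : q z' = dotp (d - z') (d - z') by [].
pose w := z - z0.
have pw : 0 < dotp p w by rewrite dotpBr subr_gt0.
(* With this step l^2 (w . w) is at most l (p . w), half of the first-order gain 2 l (p . w), so
   moving from [z0] towards [z] would come closer to [d]. *)
pose l := Num.min 1 (dotp p w / (dotp w w + 1)).
have ww : 0 <= dotp w w by apply: sumr_ge0 => i _; rewrite -expr2 sqr_ge0.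
have ww1 : 0 < dotp w w + 1 by rewrite ltr_wpDl.
have l0 : 0 < l by rewrite lt_min ltr01/= divr_gt0.
have l1 : l <= 1 by rewrite ge_min lexx.
have lw : l * (dotp w w + 1) <= dotp p w by rewrite -ler_pdivlMr// ge_min lexx orbT.
have := minz0 (l *: z + (1 - l) *: z0).
have -> : l *: z + (1 - l) *: z0 = z0 + l *: w.
  by rewrite /w; apply/rowP => i; rewrite !mxE; ring.
have Aw : A (z0 + l *: w).
  have -> : z0 + l *: w = l *: z + (1 - l) *: z0.
    by rewrite /w; apply/rowP => i; rewrite !mxE; ring.
  by apply: vA => //; rewrite (ltW l0).
rewrite mem_set// => /(_ isT).
have -> : q (z0 + l *: w) = dotp p p - 2 * l * dotp p w + l * l * dotp w w.
  rewrite /q (_ : d - (z0 + l *: w) = p - l *: w); last by rewrite opprD addrA.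
  have expand (a b : 'rV[R]_n) : dotp (a - l *: b) (a - l *: b) =
      dotp a a - 2 * l * dotp a b + l * l * dotp b b.
    by rewrite !dotpBl !dotpBr !dotpZl !dotpZr (dotpC b a); ring.
  exact: expand.
rewrite /q -/p => h.
have : l * l * (dotp w w + 1) <= l * dotp p w by rewrite -mulrA ler_wpM2l// ltW.
have : 0 < l * l by rewrite mulr_gt0.
have : 0 < l * dotp p w by rewrite mulr_gt0.
move: h; lra.
Qed.

(** Separation needs a compact set, and the hull is not known to be closed: [joins A n] takes its
    place. *)
Lemma conv_hull_support A d : compact A -> A !=set0 ->
  (forall p b, (forall z, A z -> dotp p z <= b) -> dotp p d <= b) -> conv_hull A d.
Proof.
move=> cA [z Az] hd; apply: (@joins_sub_hull _ _ _ n).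
apply: convex_separation.
- exact: joins_compact.
- exact: joins_convex.
- by exists z; exact: joins_mem.
- by move=> p b h; apply: hd => y Ay; apply: h; exact: joins_mem.
Qed.

End separation.

(** * Approximate and viable trajectories *)

Section derivative_estimates.
Variable R : realType.

Lemma derivable_approx (V : normedModType R) (y : R -> V) t :
  derivable y t 1 -> forall d, 0 < d -> exists2 e, 0 < e &
    forall r, `|r - t| < e -> `|y r - y t - (r - t) *: 'D_1 y t| <= d * `|r - t|.
Proof.
move=> dy d d0.
have : h^-1 *: ((y \o shift t) (h *: 1) - y t) @[h --> 0^'] --> 'D_1 y t by exact: dy.
move=> /cvgrPdist_lt/(_ d d0); rewrite near_withinE => /nbhs_ballP[e /= e0 he].
exists e => // r rt; have [->|rnt] := eqVneq r t.
  by rewrite !subrr scale0r subr0 !normr0 mulr0.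
have rt0 : r - t != 0 by rewrite subr_eq0.
have := he (r - t); rewrite /ball/= sub0r normrN => /(_ rt rt0).
rewrite [_ *: 1]mulr1 subrK => /ltW h.
have -> : y r - y t - (r - t) *: 'D_1 y t =
    - ((r - t) *: ('D_1 y t - (r - t)^-1 *: (y r - y t))).
  by rewrite scalerBr scalerA divff// scale1r opprB.
by rewrite normrN normrZ mulrC ler_wpM2r.
Qed.

Lemma derivable_rV n (y : R -> 'rV[R]_n) t :
  (forall i, derivable (fun s => y s 0 i) t 1) -> derivable y t 1.
Proof.
move=> dy; apply/cvg_ex; exists (\row_i 'D_1 (fun s => y s 0 i) t).
apply/cvgrPdist_le => e e0.
suff : \forall h \near 0^', forall i, `|'D_1 (fun s => y s 0 i) t -
    h^-1 *: (((fun s => y s 0 i) \o shift t) (h *: 1) - y t 0 i)| <= e.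
  apply: filterS => h hh; apply: norm_le_coord; first exact: ltW.
  by move=> i; have := hh i; rewrite !mxE.
apply: filter_forall => i.
have : h^-1 *: (((fun s => y s 0 i) \o shift t) (h *: 1) - y t 0 i)
    @[h --> 0^'] --> 'D_1 (fun s => y s 0 i) t by exact: dy.
by move/cvgrPdist_le => /(_ e e0).
Qed.

Lemma derivable_slope (phi : R -> R) t : derivable phi t 1 -> 'D_1 phi t <= 0 ->
  forall e, 0 < e -> slope_le phi t e.
Proof.
move=> dphi D0 e e0; have [d d0 hd] := derivable_approx dphi e0.
apply/nbhs_ballP; exists d => //= r; rewrite /ball/= distrC => rd.
pose D : R := 'D_1 phi t; have D0' : D <= 0 := D0.
have h : `|phi r - phi t - (r - t) * D| <= e * `|r - t| := hd r rd.
split => rt.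
  move: h; rewrite (ger0_norm (_ : 0 <= r - t)) ?subr_ge0// ler_norml => /andP[_ h].
  have : (r - t) * D <= 0 by rewrite mulr_ge0_le0// subr_ge0.
  lra.
move: h; rewrite (ler0_norm (_ : r - t <= 0)) ?subr_le0// ler_norml => /andP[h _].
have : 0 <= (r - t) * D by rewrite mulr_le0// subr_le0.
lra.
Qed.

Lemma ler_addscaleP (a b c : R) : 0 <= c ->
  (forall d, 0 < d -> d <= 1 -> a <= b + c * d) -> a <= b.
Proof.
move=> c0 h; apply/ler_addgt0Pr => e e0.
have c1 : 0 < c + 1 by rewrite ltr_wpDl.
pose d := Num.min 1 (e / (c + 1)).
have d0 : 0 < d by rewrite lt_min ltr01 divr_gt0.
have d1 : d <= 1 by rewrite ge_min lexx.
apply: (le_trans (h d d0 d1)); rewrite lerD2l.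
have : (c + 1) * d <= e by rewrite mulrC -ler_pdivlMr// ge_min lexx orbT.
apply: le_trans; rewrite ler_wpM2r ?lerDl//; exact: ltW.
Qed.

End derivative_estimates.

Section relaxed_dynamics.
Variables (R : realType) (n m : nat).
Variables (F : 'rV[R]_n -> 'rV[R]_m -> 'rV[R]_n) (U : set 'rV[R]_m).
Variables (X : set 'rV[R]_n) (L M : R).
Hypotheses (U0 : U !=set0) (L0 : 0 <= L) (M0 : 0 <= M).
Hypothesis FL : forall x y u, U u -> `|F x u - F y u| <= L * `|x - y|.
Hypothesis FM : forall x u, U u -> `|F x u| <= M.

Definition support_fun x p := sup [set dotp p (F x u) | u in U].
Notation H := support_fun.

Let H_has_sup x p : has_sup [set dotp p (F x u) | u in U].
Proof.
split; first by case: U0 => u Uu; exists (dotp p (F x u)), u.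
exists (norm1 p * M) => _ [u Uu <-]; rewrite (le_trans (ler_norm _))//.
by rewrite (le_trans (dotp_le _ _))// ler_wpM2l ?norm1_ge0// FM.
Qed.

Lemma support_fun_ge x p u : U u -> dotp p (F x u) <= H x p.
Proof. by move=> Uu; apply: (ub_le_sup (H_has_sup x p).2); exists u. Qed.

Lemma support_fun_le x p b : (forall u, U u -> dotp p (F x u) <= b) -> H x p <= b.
Proof. by move=> h; apply: ge_sup;
  [exact: (H_has_sup x p).1|move=> _ [u Uu <-]; exact: h]. Qed.

Lemma support_fun_lip x y p : H x p <= H y p + norm1 p * (L * `|x - y|).
Proof.
apply: support_fun_le => u Uu.
have -> : dotp p (F x u) = dotp p (F y u) + dotp p (F x u - F y u).
  by rewrite dotpBr addrC subrK.
apply: lerD; first exact: support_fun_ge.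
rewrite (le_trans (ler_norm _))// (le_trans (dotp_le _ _))//.
by rewrite ler_wpM2l ?norm1_ge0// FL.
Qed.

Lemma support_fun_bound x p : `|H x p| <= norm1 p * M.
Proof.
have B u : U u -> `|dotp p (F x u)| <= norm1 p * M.
  by move=> Uu; rewrite (le_trans (dotp_le _ _))// ler_wpM2l ?norm1_ge0// FM.
rewrite ler_norml; apply/andP; split.
  have [u Uu] := U0; apply: le_trans (support_fun_ge x p Uu).
  by have := B u Uu; rewrite ler_norml => /andP[].
by apply: support_fun_le => u /B; rewrite ler_norml => /andP[].
Qed.

(* The inclusion of the derivative in the convex hull is written with support
   functions, and the slack e accommodates the piecewise constant Euler paths:
   all the conditions pass to pointwise limits. *)
Definition approx_path (e : R) (x0 : 'rV[R]_n) (y : R -> 'rV[R]_n) := [/\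
  `|y 0 - x0| <= e,
  forall s t, 0 <= s -> s <= t -> `|y t - y s| <= M * (t - s) + e,
  forall t, 0 <= t -> t <= e^-1 -> dist X (y t) <= e &
  forall s t p, 0 <= s -> s <= t -> t <= e^-1 ->
    dotp p (y t - y s) <=
    (t - s) * (H (y s) p + norm1 p * (L * M * (t - s))) + norm1 p * e].

Lemma approx_path_mono e e' x0 y : 0 < e -> e <= e' ->
  approx_path e x0 y -> approx_path e' x0 y.
Proof.
move=> e0 ee' [h1 h2 h3 h4].
have ei : e'^-1 <= e^-1 by rewrite lef_pV2 ?posrE// (lt_le_trans e0).
split.
- exact: le_trans ee'.
- by move=> s t s0 st; rewrite (le_trans (h2 _ _ s0 st))// lerD2l.
- by move=> t t0 te; rewrite (le_trans (h3 _ t0 _))// (le_trans te).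
- move=> s t p s0 st te; rewrite (le_trans (h4 _ _ _ s0 st _))//.
    exact: le_trans te ei.
  by rewrite lerD2l ler_wpM2l// norm1_ge0.
Qed.

(** Tychonoff's theorem for pointwise convergence. Each condition of [approx_path] involves at most
    two times, so a cluster point approximated at two times at once is enough. Negative times, which
    the conditions leave free, are frozen at the value at 0 to stay in compact sets. *)
Lemma approx_path_cluster x0 : (forall e, 0 < e -> exists y, approx_path e x0 y) ->
  exists y : R -> 'rV[R]_n, (forall t, y t = y (Num.max 0 t)) /\
    forall s t d, 0 < d -> exists z e, [/\ 0 < e, e <= d, approx_path e x0 z,
      0 <= s -> `|z s - y s| <= d & 0 <= t -> `|z t - y t| <= d].
Proof.
move=> hap; pose B (t : R) : R := `|x0| + 2 + M * `|t|.
pose K (t : R) := [set z : 'rV[R]_n | `|z| <= B t].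
have cK t : compact (K t).
  apply: bounded_closed_compact.
    exists (B t); split; first exact: num_real.
    by move=> r Br z /= /le_trans; apply; exact: ltW.
  have := @norm_continuous _ 'rV[R]_n.
  by move/continuous_closedP => /(_ [set r | r <= B t]); apply;
    exact: closed_le.
pose E k := [set z : R -> 'rV[R]_n | [/\ forall t, K t (z t),
  forall t, z t = z (Num.max 0 t) & approx_path k.+1%:R^-1 x0 z]].
have E0 k : E k !=set0.
  have [e [k0 k1 eE]] : exists e : R, [/\ 0 < e, e <= 1 & e = k.+1%:R^-1].
    by exists k.+1%:R^-1; split => //; rewrite invf_le1// ler1n.
  rewrite /E -eE.
  have [y ay] := hap _ k0; exists (fun t => y (Num.max 0 t)); split.
  - move=> t; rewrite /K /= /B; case: ay => h1 h2 _ _.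
    have t0 : 0 <= Num.max 0 t by rewrite le_max lexx.
    have := h2 _ _ (lexx 0) t0; rewrite subr0.
    have tt : Num.max 0 t <= `|t| by rewrite ge_max normr_ge0 ler_norm.
    have := ler_wpM2l M0 tt.
    have := ler_normD (y (Num.max 0 t) - y 0) (y 0); rewrite subrK.
    have := ler_normD (y 0 - x0) x0; rewrite subrK.
    by move: h1 k1; lra.
  - by move=> t; rewrite maxA maxxx.
  - have mx s : 0 <= s -> Num.max 0 s = s by move=> s0; apply/max_idPr.
    case: ay => h1 h2 h3 h4; split.
    + by rewrite mx.
    + by move=> s t s0 st; rewrite !mx//; [exact: h2|exact: le_trans st].
    + by move=> t t0 te; rewrite mx//; exact: h3.
    + by move=> s t p s0 st te; rewrite !mx//; [exact: h4|exact: le_trans st].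
have Emono i j : (i <= j)%N -> E j `<=` E i.
  move=> ij z [h1 h2 h3]; split => //; apply: approx_path_mono h3 => //.
  by rewrite lef_pV2 ?posrE ?ltr0n// ler_nat.
pose P : R -> topologicalType := fun=> 'rV[R]_n.
(* The sets [E k] are nonempty and decreasing, hence a base of a proper filter on a product of
   compact sets. *)
pose G := filter_from setT (E : nat -> set (prod_topology P)).
have FG : ProperFilter G.
  apply: filter_from_proper; last by move=> k _; exact: E0.
  apply: filter_fromT_filter; first by exists 0%N.
  by move=> i j; exists (maxn i j) => z Ez; split; apply: Emono Ez;
    [exact: leq_maxl|exact: leq_maxr].
have GK : G [set z | forall t, K t (z t)] by exists 0%N => // z [].
have [y [Ky cly]] := @tychonoff R P K cK G FG GK.
have key s t d k : 0 < d -> exists2 z, E k z & `|z s - y s| < d /\ `|z t - y t| < d.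
  move=> d0.
  have nb r : nbhs (y : prod_topology P) [set z : prod_topology P | `|z r - y r| < d].
    have /(_ y) := @proj_continuous R P r.
    move=> /(_ [set v : 'rV[R]_n | `|v - y r| < d]); apply.
    apply/nbhs_ballP; exists d => // v /=; rewrite -ball_normE/= distrC.
    by [].
  have [|z [Ez [zs zt]]] := cly (E k) _ _ (filterI (nb s) (nb t));
    first by exists k.
  by exists z.
exists y; split => [t|s t d d0].
  apply/eqP; rewrite -subr_eq0 -normr_le0;
    apply: (@ler_addscaleP _ _ _ 2) => // d d0 _.
  have [z [_ hz _] [zt z0]] := key t (Num.max 0 t) d 0%N d0.
  have := ler_normD (y t - z t) (z t - y (Num.max 0 t)); rewrite addrA subrK.
  by rewrite -hz in z0; rewrite (distrC (y t) (z t)); move: zt z0; lra.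
have [k kd] : exists k, (k.+1%:R^-1 : R) < d.
  by have [k _ /(_ _ (leqnn k))] := near_infty_natSinv_lt (PosNum d0); exists k.
have [z [_ _ az] [zs zt]] := key s t d k d0.
by exists z, k.+1%:R^-1; split => // [|_|_]; exact: ltW.
Qed.

Lemma approx_path_limit x0 : closed X -> X !=set0 ->
  (forall e, 0 < e -> exists y, approx_path e x0 y) ->
  exists y : R -> 'rV[R]_n, [/\ y 0 = x0,
    forall s t, `|y t - y s| <= M * `|t - s|,
    forall t, 0 <= t -> X (y t) &
    forall s t p, 0 <= s -> s <= t -> dotp p (y t - y s) <=
      (t - s) * (H (y s) p + norm1 p * (L * M * (t - s)))].
Proof.
move=> cX X0 /approx_path_cluster[y [ymax key]].
have lip s t : 0 <= s -> s <= t -> `|y t - y s| <= M * (t - s).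
  move=> s0 st; apply: (@ler_addscaleP _ _ _ 3) => // d d0 _.
  have [z [e [e0 ed [_ h2 _ _] /(_ s0) zs]]] := key s t d d0.
  move=> /(_ (le_trans s0 st)) zt.
  have := h2 _ _ s0 st.
  have := ler_normD (y t - z t) (z t - z s).
  have := ler_normD (y t - z t + (z t - z s)) (z s - y s).
  have -> : y t - z t + (z t - z s) + (z s - y s) = y t - y s.
    by apply/rowP => i; rewrite !mxE; ring.
  by rewrite (distrC (y t) (z t)); lra.
exists y; split.
- apply/eqP; rewrite -subr_eq0 -normr_le0;
    apply: (@ler_addscaleP _ _ _ 2) => // d d0 _.
  have [z [e [e0 ed [h1 _ _ _] /(_ (lexx 0)) zs _]]] := key 0 0 d d0.
  have := ler_normD (y 0 - z 0) (z 0 - x0);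
    rewrite addrA subrK (distrC (y 0) (z 0)); lra.
- move=> s t; rewrite ymax (ymax s).
  have max0 (r : R) : 0 <= Num.max 0 r by rewrite le_max lexx.
  have mm (r r' : R) : r <= r' -> `|Num.max 0 r' - Num.max 0 r| <= `|r' - r|.
    move=> rr; rewrite ger0_norm ?subr_ge0;
      last by rewrite ge_max !le_max lexx rr/= orbT.
    by rewrite ger0_norm ?subr_ge0// !maxEle; case: (leP 0 r) => ?;
      case: (leP 0 r') => ?; lra.
  have [st|/ltW ts] := leP s t.
    apply: (le_trans (lip _ _ _ _)) => //.
      by rewrite ge_max !le_max lexx st/= orbT.
    rewrite ler_wpM2l//; apply: le_trans (mm _ _ st); exact: ler_norm.
  rewrite distrC (distrC t s); apply: (le_trans (lip _ _ _ _)) => //.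
    by rewrite ge_max !le_max lexx ts/= orbT.
  rewrite ler_wpM2l//; apply: le_trans (mm _ _ ts); exact: ler_norm.
- move=> t t0; apply: (@dist_closed0 _ _ X) => //.
  apply: (@ler_addscaleP _ _ _ 2) => // d d0 d1.
  (* A tolerance below 1 / (t + 1) makes the horizon [e^-1] of the approximating path reach [t]. *)
  pose d' := Num.min d (t + 1)^-1.
  have t1 : 0 < t + 1 by rewrite ltr_wpDl.
  have d'0 : 0 < d' by rewrite lt_min d0 invr_gt0.
  have [z [e [e0 ed [_ _ h3 _] /(_ t0) zt _]]] := key t t d' d'0.
  have d'd : d' <= d by rewrite ge_min lexx.
  have te : t <= e^-1.
    rewrite (@le_trans _ _ (t + 1))// ?lerDl//.
    rewrite -[t + 1]invrK lef_pV2 ?posrE ?invr_gt0//.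
    by rewrite (le_trans ed)// ge_min lexx orbT.
  have := h3 t t0 te; have := dist_lip (z t) (y t) X0.
  by rewrite ler_norml => /andP[h _]; move: h zt d'd ed; lra.
- move=> s t p s0 st; have t0 := le_trans s0 st.
  apply: (@ler_addscaleP _ _ _ (norm1 p * (3 + (t - s) * L))).
    by rewrite mulr_ge0 ?norm1_ge0// addr_ge0// mulr_ge0// subr_ge0.
  move=> d d0 d1.
  pose d' := Num.min d (t + 1)^-1.
  have t1 : 0 < t + 1 by rewrite ltr_wpDl.
  have d'0 : 0 < d' by rewrite lt_min d0 invr_gt0.
  have [z [e [e0 ed [_ _ _ h4] /(_ s0) zs /(_ t0) zt]]] := key s t d' d'0.
  have d'd : d' <= d by rewrite ge_min lexx.
  have te : t <= e^-1.
    rewrite (@le_trans _ _ (t + 1))// ?lerDl//.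
    rewrite -[t + 1]invrK lef_pV2 ?posrE ?invr_gt0//.
    by rewrite (le_trans ed)// ge_min lexx orbT.
  have N0 := norm1_ge0 p.
  have dp (a b : 'rV[R]_n) : `|a - b| <= d' -> `|dotp p a - dotp p b| <= norm1 p * d.
    move=> ab; rewrite -dotpBr (le_trans (dotp_le _ _))// ler_wpM2l//.
    exact: le_trans ab d'd.
  have := h4 s t p s0 st te; rewrite !dotpBr.
  have := dp _ _ zt; rewrite ler_norml => /andP[k1 _].
  have := dp _ _ zs; rewrite ler_norml => /andP[_ k2] k3.
  have Hs : H (z s) p <= H (y s) p + norm1 p * (L * d).
    apply: (le_trans (support_fun_lip _ (y s) _)); rewrite lerD2l ler_wpM2l//.
    by rewrite ler_wpM2l// (le_trans zs).
  have : (t - s) * H (z s) p <= (t - s) * (H (y s) p + norm1 p * (L * d)).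
    by rewrite ler_wpM2l// subr_ge0.
  have : norm1 p * e <= norm1 p * d by rewrite ler_wpM2l// (le_trans ed).
  move: k1 k2 k3; lra.
Qed.

End relaxed_dynamics.

(** * Gradients of C^1 functions *)

Section gradient.
Variables (R : realType) (n : nat).
Implicit Types (v : 'rV[R]_n -> R) (x y z w : 'rV[R]_n).

Lemma derive_grad v z w : differentiable v z -> 'D_w v z = dotp (grad v z) w.
Proof.
move=> dv; rewrite deriveE// {1}(row_sum_delta w) raddf_sum/=.
apply: eq_bigr => i _; rewrite linearZ/= mxE deriveE//.
by rewrite [_ *: _]mulrC.
Qed.

Lemma line_derivative v z w (s : R) : differentiable v (z + s *: w) ->
  is_derive s 1 (fun r => v (z + r *: w)) (dotp (grad v (z + s *: w)) w).
Proof.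
move=> dv.
have E : (fun h : R => h^-1 *: (((fun r => v (z + r *: w)) \o shift s) (h *: 1)
  -
    v (z + s *: w))) =
    (fun h : R => h^-1 *: ((v \o shift (z + s *: w)) (h *: w) - v (z + s *: w))).
  apply/funext => h /=; congr (_ *: (v _ - _)).
  by rewrite [h *: 1]mulr1 scalerDl addrCA.
have dvw : derivable v (z + s *: w) w by exact: diff_derivable.
split; first by rewrite /derivable E; exact: dvw.
by rewrite -derive_grad// /derive E.
Qed.

(** Mean value theorem on segments, the gradient being bounded on the compact ball; the factor n
    comes from comparing [norm1] with the sup norm. *)
Lemma C1_lipschitz v (r : R) : C1 v -> exists2 C, 0 <= C &
  forall x y, `|x| <= r -> `|y| <= r -> `|v x - v y| <= C * `|x - y|.
Proof.
move=> [dv cg].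
have cB : compact [set z : 'rV[R]_n | `|z| <= r].
  apply: bounded_closed_compact.
    exists r; split; first exact: num_real.
    by move=> r' rr' z /= /le_trans; apply; exact: ltW.
  have := @norm_continuous _ 'rV[R]_n.
  by move/continuous_closedP => /(_ [set s | s <= r]); apply; exact: closed_le.
have : compact [set grad v z | z in [set z : 'rV[R]_n | `|z| <= r]].
  by apply: continuous_compact => //; exact: continuous_subspaceT.
move=> /compact_bounded[B [_ /(_ (`|B| + 1))]].
have B1 : B < `|B| + 1 by rewrite (le_lt_trans (ler_norm _))// ltrDl.
move=> /(_ B1) hB; exists (n%:R * (`|B| + 1)); first by rewrite mulr_ge0.
move=> x y xr yr; pose g s := v (y + s *: (x - y)).
have dg (s : R) : is_derive s 1 g (dotp (grad v (y + s *: (x - y))) (x - y)).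
  exact: line_derivative.
have gc : {within `[0, 1], continuous g}.
  by apply: derivable_within_continuous => s _; have [] := dg s.
have [s] := @MVT_segment R g _ 0 1 ler01 (fun s _ => dg s) gc.
rewrite in_itv/= => /andP[s0 s1].
have -> : g 1 = v x by rewrite /g scale1r addrC subrK.
have -> : g 0 = v y by rewrite /g scale0r addr0.
rewrite subr0 mulr1 => ->.
rewrite (le_trans (dotp_le _ _))// ler_wpM2r//.
have zr : `|y + s *: (x - y)| <= r.
  have -> : y + s *: (x - y) = s *: x + (1 - s) *: y.
    by apply/rowP => i; rewrite !mxE; ring.
  rewrite (le_trans (ler_normD _ _))// !normrZ ger0_norm// ger0_norm ?subr_ge0//.
  have : s * `|x| <= s * r by rewrite ler_wpM2l.
  have : (1 - s) * `|y| <= (1 - s) * r by rewrite ler_wpM2l// subr_ge0.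
  lra.
have gB : `|grad v (y + s *: (x - y))| <= `|B| + 1 by apply: hB;
  exists (y + s *: (x - y)).
rewrite /norm1 (@le_trans _ _ (\sum_(i < n) (`|B| + 1)))//.
  by apply: ler_sum => i _; rewrite (le_trans (coord_le_norm _ _)).
by rewrite sumr_const card_ord mulr_natl.
Qed.

Lemma derivable_comp_C1 v (x : R -> 'rV[R]_n) t : C1 v -> derivable x t 1 ->
  derivable (fun s => v (x s)) t 1 /\
  'D_1 (fun s => v (x s)) t = dotp (grad v (x t)) ('D_1 x t).
Proof.
move=> [dv _] /derivable1_diffP dx.
have dvx : differentiable (v \o x) t by apply: differentiable_comp.
split; first exact: (diff_derivable dvx).
have -> : (fun s => v (x s)) = v \o x by [].
rewrite deriveE// diff_comp//= -derive_grad// deriveE//.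
by rewrite [in RHS]deriveE.
Qed.

End gradient.

(** * Trajectories that remain in the constraint set *)

Section viable_trajectories.
Variables (R : realType) (n m : nat) (f : 'I_n -> mpoly.mpoly (n + m) R).
Variables (F : 'rV[R]_n -> 'rV[R]_m -> 'rV[R]_n) (U : set 'rV[R]_m).
Variables (X : set 'rV[R]_n) (L M : R).
Hypotheses (U0 : U !=set0) (L0 : 0 <= L) (M0 : 0 <= M).
Hypothesis FL : forall x y u, U u -> `|F x u - F y u| <= L * `|x - y|.
Hypothesis FM : forall x u, U u -> `|F x u| <= M.
Hypothesis FE : forall x u, X x -> U u -> F x u = vfield f x u.
Hypothesis cF : forall x, compact [set vfield f x u | u in U].
Hypothesis cX : closed X.
Notation H := (support_fun F U).

(** The curve is derivable almost everywhere. Dividing the support inequality by t - s and letting t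
    tend to s bounds the derivative in every direction [p] by the support function, which places it
    in the hull. *)
Lemma lipschitz_MCI (y : R -> 'rV[R]_n) :
  (forall s t, `|y t - y s| <= M * `|t - s|) ->
  (forall t, 0 <= t -> X (y t)) ->
  (forall s t p, 0 <= s -> s <= t -> dotp p (y t - y s) <=
      (t - s) * (H (y s) p + norm1 p * (L * M * (t - s)))) ->
  MCI f X U (y 0).
Proof.
move=> ylip yX yH; split; first exact: yX.
exists y; split => //; split.
  move=> T T0 e e0; have M1 : 0 < M + 1 by rewrite ltr_wpDl.
  exists (e / (M + 1)); first by rewrite divr_gt0.
  move=> k s t hst _; rewrite ltr_pdivlMr// mulr_suml => h.
  apply: le_lt_trans h; apply: ler_sum => i _; have [_ st _] := hst i.
  apply: (le_trans (ylip _ _)); rewrite ger0_norm ?subr_ge0// mulrC.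
  by rewrite ler_wpM2l ?subr_ge0// lerDl.
(* [ae_foralln] ranges over [nat], so the bound on the coordinate index becomes a premise inside the
   almost-everywhere statement. *)
have hk (k : nat) : {ae @lebesgue_measure R, forall t, forall h : (k < n)%N,
    derivable (fun s => y s 0 (Ordinal h)) t 1}.
  have [h|h] := pselect (k < n)%N; last first.
    by exists set0; split => // t /=; apply => h'; case: (h h').
  have [|N [mN N0 hN]] := @lipschitz_derivable R (fun s => y s 0 (Ordinal h)) M.
    move=> s t; apply: le_trans (ylip s t).
    by have := coord_le_norm (y t - y s) (Ordinal h); rewrite !mxE.
  exists N; split => //; apply: subset_trans hN => t;
    apply: contra_not => /= d h'.
  by rewrite (bool_irrelevance h' h).
have [N [mN N0 hN]] := ae_foralln hk.
exists N; split => //; apply: subset_trans hN => t;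
  apply: contra_not => /= d t0.
have dy : derivable y t 1.
  apply: derivable_rV => i; have := d i (ltn_ord i).
  by have -> : Ordinal (ltn_ord i) = i by exact: val_inj.
split => //; apply: conv_hull_support => //.
  by case: U0 => u Uu; exists (vfield f (y t) u), u.
move=> p b pb.
have Hb : H (y t) p <= b.
  by apply: (support_fun_le U0 FM) => u Uu; rewrite FE//; [apply: pb;
    exists u|exact: yX].
apply: (le_trans _ Hb).
have N1 := norm1_ge0 p.
apply: (@ler_addscaleP _ _ _ (norm1 p * (L * M + 1))).
  by rewrite mulr_ge0// addr_ge0// mulr_ge0.
move=> c c0 c1; have [e e0 he] := derivable_approx dy c0.
pose r := Num.min c (e / 2).
have r0 : 0 < r by rewrite lt_min c0 divr_gt0.
have rc : r <= c by rewrite ge_min lexx.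
have re : r < e.
  have : r <= e / 2 by rewrite ge_min lexx orbT.
  lra.
have := he (t + r); rewrite addrAC subrr add0r gtr0_norm// => /(_ re) hr.
have := dotp_le p (y (t + r) - y t - r *: 'D_1 y t).
rewrite dotpBr dotpZr ler_norml => /andP[h1 _].
have h2 : norm1 p * `|y (t + r) - y t - r *: 'D_1 y t| <= norm1 p * (c * r).
  by rewrite ler_wpM2l.
have tr : t <= t + r by rewrite lerDl ltW.
have := yH t (t + r) p t0 tr; rewrite addrAC subrr add0r => h3.
have h4 : r * (norm1 p * (L * M * r)) <= r * (norm1 p * (L * M * c)).
  by rewrite ler_wpM2l ?(ltW r0)// ler_wpM2l// ler_wpM2l// mulr_ge0.
rewrite -(ler_pM2l r0).
move: h1 h2 h3 h4; lra.
Qed.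

Lemma approx_path_MCI x0 : X !=set0 ->
  (forall e, 0 < e -> exists y, approx_path F U X L M e x0 y) -> MCI f X U x0.
Proof.
move=> X0 h; have [y [y0 h1 h2 h3]] := approx_path_limit U0 L0 M0 FL FM cX X0 h.
by rewrite -y0; exact: lipschitz_MCI.
Qed.

Section viable.
Variable x : R -> 'rV[R]_n.
Hypothesis trx : trajectory f U x.
Hypothesis xX : forall t, 0 <= t -> X (x t).

Let ac s t : 0 <= s -> s <= t -> abs_continuous s t x.
Proof.
move=> s0 st e e0; have t1 : 0 < t + 1 by rewrite ltr_wpDl// (le_trans s0).
have [d d0 hd] := trx.1 _ t1 e e0; exists d => // k a b hab; apply: hd => i.
have [h1 h2 h3] := hab i; split => //; first exact: le_trans h1.
by rewrite (le_trans h3)// lerDl.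
Qed.

(** The half-space where [dotp p] is at most [c] is convex and contains the velocities, hence their
    hull; [ac_nonincreasing] then applies to [phi]. *)
Lemma viable_increment s t p (c : R) : 0 <= s -> s <= t ->
  (forall r u, s <= r -> r <= t -> U u -> dotp p (vfield f (x r) u) <= c) ->
  dotp p (x t - x s) <= c * (t - s).
Proof.
move=> s0 st hc; pose phi r := dotp p (x r) - c * r.
suff : phi t <= phi s by rewrite /phi dotpBr; lra.
apply: ac_nonincreasing => //.
  apply: (@ac_real_comp _ _ _ _ x _ (norm1 p + `|c|)) (ac s0 st) _.
    by rewrite addr_ge0// norm1_ge0.
  move=> a b sa ab bt; rewrite /phi.
  have -> : dotp p (x b) - c * b - (dotp p (x a) - c * a) =
    dotp p (x b - x a) - c * (b - a) by rewrite dotpBr; ring.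
  rewrite (le_trans (ler_normB _ _))// normrM (ger0_norm (_ : 0 <= b - a)) ?subr_ge0//.
  have := dotp_le p (x b - x a); have := norm1_ge0 p.
  have : 0 <= b - a by rewrite subr_ge0.
  have := normr_ge0 (x b - x a); have := normr_ge0 c; nra.
have [_ [N [mN N0 hN]]] := trx.
exists N; split => //; apply: subset_trans hN => r; apply: contra_not => /= h.
move=> /andP[sr rt]; have [dx Dx] := h (le_trans s0 sr).
have Dc : dotp p ('D_1 x r) <= c.
  apply: (@conv_hull_sub _ _ _ [set z | dotp p z <= c] _ _ _ Dx).
    apply/convex_setP => a b l /andP[l0 l1] /= h1 h2.
    rewrite dotpDr !dotpZr.
    have : l * dotp p a <= l * c by rewrite ler_wpM2l.
    have : (1 - l) * dotp p b <= (1 - l) * c by rewrite ler_wpM2l// subr_ge0.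
    lra.
  by move=> _ [u Uu <-]; exact: hc.
move=> e e0; have N1 : 0 < norm1 p + 1 by rewrite ltr_wpDl// norm1_ge0.
have d0 : 0 < e / (norm1 p + 1) by rewrite divr_gt0.
have [d d'0 hd] := derivable_approx dx d0.
apply/nbhs_ballP; exists d => //= q; rewrite /ball/= distrC => /hd.
set D := 'D_1 x r in Dc * => hq.
have hp : `|dotp p (x q - x r) - (q - r) * dotp p D| <= e * `|q - r|.
  rewrite -dotpZr -dotpBr (le_trans (dotp_le _ _))//.
  apply: (@le_trans _ _ (norm1 p * (e / (norm1 p + 1) * `|q - r|))).
    by rewrite ler_wpM2l// norm1_ge0.
  rewrite mulrA ler_wpM2r// mulrCA ler_piMr ?(ltW e0)// ler_pdivrMr//.
  by rewrite mul1r lerDl.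
rewrite dotpBr in hp; rewrite /phi; split => rq; move: hp.
  rewrite (ger0_norm (_ : 0 <= q - r)) ?subr_ge0// ler_norml => /andP[_ h1].
  have : (q - r) * dotp p D <= (q - r) * c by rewrite ler_wpM2l// subr_ge0.
  lra.
rewrite (ler0_norm (_ : q - r <= 0)) ?subr_le0// ler_norml => /andP[h1 _].
have : (r - q) * dotp p D <= (r - q) * c by rewrite ler_wpM2l// subr_ge0.
lra.
Qed.

(** Taking for [p] plus and minus each basis vector controls every coordinate, hence the sup
    norm. *)
Lemma viable_lip s t : 0 <= s -> s <= t -> `|x t - x s| <= M * (t - s).
Proof.
move=> s0 st; apply: norm_le_coord; first by rewrite mulr_ge0// subr_ge0.
have D p : dotp p (x t - x s) <= norm1 p * M * (t - s).
  apply: viable_increment => // r u sr rt Uu; rewrite -FE//; last first.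
    by apply: xX; exact: le_trans sr.
  rewrite (le_trans (ler_norm _))// (le_trans (dotp_le _ _))//.
  by rewrite ler_wpM2l ?norm1_ge0// FM.
have dd i (z : 'rV[R]_n) : dotp (delta_mx 0 i) z = z 0 i.
  rewrite /dotp (bigD1 i)//= mxE !eqxx mul1r big1 ?addr0// => j ji.
  by rewrite mxE (negbTE ji) mul0r.
have n1 i : norm1 (delta_mx 0 i : 'rV[R]_n) = 1.
  rewrite /norm1 (bigD1 i)//= mxE !eqxx normr1 big1 ?addr0// => j ji.
  by rewrite mxE (negbTE ji) normr0.
have n1N (p : 'rV[R]_n) : norm1 (- p) = norm1 p.
  by apply: eq_bigr => i _; rewrite mxE normrN.
move=> i; rewrite ler_norml.
have := D (delta_mx 0 i); have := D (- delta_mx 0 i).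
rewrite n1N n1 mul1r dotpC dotpNr dotpC dd => h1 h2.
by rewrite h2 andbT lerNl.
Qed.

(** Up to time [t] the state moves by at most M (t - s), and the support function by at most L times
    that, up to [norm1 p]; this is where the quadratic term of [approx_path] comes from. *)
Lemma viable_support s t p : 0 <= s -> s <= t ->
  dotp p (x t - x s) <= (t - s) * (H (x s) p + norm1 p * (L * M * (t - s))).
Proof.
move=> s0 st; rewrite [leRHS]mulrC; apply: viable_increment => // r u sr rt Uu.
rewrite -FE//; last by apply: xX; exact: le_trans sr.
apply: (le_trans (support_fun_ge U0 FM _ _ Uu)).
apply: (le_trans (support_fun_lip U0 FL FM _ (x s) _)).
rewrite lerD2l ler_wpM2l ?norm1_ge0// -mulrA ler_wpM2l//.
apply: (le_trans (viable_lip s0 sr)); rewrite ler_wpM2l//; lra.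
Qed.

Lemma viable_approx_path x0 e : 0 < e -> `|x 0 - x0| <= e ->
  approx_path F U X L M e x0 x.
Proof.
move=> e0 xe; split => //.
- by move=> s t s0 st; rewrite (le_trans (viable_lip s0 st))// lerDl ltW.
- by move=> t t0 _; rewrite dist_mem0 ?ltW//; exact: xX.
- move=> s t p s0 st _; rewrite (le_trans (viable_support _ s0 st))// lerDl.
  by rewrite mulr_ge0 ?norm1_ge0// ltW.
Qed.

(** exp(- beta t) v(x t) is nonincreasing, and it tends to 0 because v is bounded on [X]; its
    initial value is therefore nonnegative. *)
Lemma viable_C1_ge0 v (beta : R) : bounded_set X -> 0 < beta -> C1 v ->
  (forall z u, X z -> U u -> dotp (grad v z) (vfield f z u) <= beta * v z) -> 0 <= v (x 0).
Proof.
move=> [r [_ /(_ (`|r| + 1))]].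
have r1 : r < `|r| + 1 by rewrite (le_lt_trans (ler_norm _))// ltrDl.
move=> /(_ r1); set b := `|r| + 1 => Xb beta0 C1v hv.
have b0 : 0 <= b by rewrite addr_ge0.
have [C C0 vC] := C1_lipschitz b C1v.
pose B := `|v 0| + C * b; have B0 : 0 <= B by rewrite addr_ge0// mulr_ge0.
have vB z : X z -> `|v z| <= B.
  move=> Xz; have := vC z 0 (Xb _ Xz); rewrite normr0 subr0 => /(_ b0) h.
  have := ler_normD (v z - v 0) (v 0); rewrite subrK /B.
  have : C * `|z| <= C * b by rewrite ler_wpM2l//; exact: Xb.
  move: h; lra.
pose E (t : R) := expR (- beta * t).
have E0 t : 0 < E t by exact: expR_gt0.
have E1 t : 0 <= t -> E t <= 1 by move=> t0;
  rewrite /E -expR0 ler_expR mulr_le0_ge0// oppr_le0 ltW.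
have Elip s t : 0 <= s -> s <= t -> `|E t - E s| <= beta * (t - s).
  move=> s0 st; have -> : E t = E s * expR (- (beta * (t - s))).
    by rewrite /E -expRD; congr expR; ring.
  have ts : 0 <= beta * (t - s) by rewrite mulr_ge0 ?subr_ge0// ltW.
  have -> : E s * expR (- (beta * (t - s))) - E s = - (E s * (1 - expR (- (beta
    * (t - s))))).
    by ring.
  have e1 : expR (- (beta * (t - s))) <= 1 by rewrite -expR0 ler_expR oppr_le0.
  have e2 := expR_ge1Dx (- (beta * (t - s))).
  rewrite normrN ger0_norm; last by rewrite mulr_ge0 ?(ltW (E0 _))// subr_ge0.
  apply: (@le_trans _ _ (1 - expR (- (beta * (t - s))))); last by move: e2; lra.
  by rewrite ler_piMl ?E1// subr_ge0.
pose psi t := E t * v (x t).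
have psi_le T : 0 <= T -> psi T <= psi 0.
  move=> T0; apply: ac_nonincreasing => //.
    apply: (@ac_real_comp _ _ _ _ x _ (C + beta * B)) (ac (lexx 0) T0) _.
      by rewrite addr_ge0// mulr_ge0// ltW.
    move=> s t s0 st tT; rewrite /psi.
    have t0 := le_trans s0 st.
    have -> : E t * v (x t) - E s * v (x s) =
      E t * (v (x t) - v (x s)) + (E t - E s) * v (x s) by ring.
    rewrite (le_trans (ler_normD _ _))// !normrM.
    have h1 : `|v (x t) - v (x s)| <= C * `|x t - x s|.
      by apply: vC; apply: Xb; exact: xX.
    have h2 : `|E t| * `|v (x t) - v (x s)| <= C * `|x t - x s|.
      apply: le_trans h1; rewrite ler_piMl// ger0_norm ?E1//; exact: ltW.
    have h3 : `|E t - E s| * `|v (x s)| <= beta * (t - s) * B.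
      by apply: ler_pM => //; [exact: Elip|apply: vB; exact: xX].
    apply: (le_trans (lerD h2 h3)).
    have : 0 <= C * (t - s) by rewrite mulr_ge0// subr_ge0.
    have : 0 <= beta * B * `|x t - x s| by rewrite !mulr_ge0// ltW.
    lra.
  have [_ [N [mN N0 hN]]] := trx.
  exists N; split => //; apply: subset_trans hN => t; apply: contra_not => /= h.
  move=> /andP[t0 tT]; have [dx Dx] := h t0.
  have [dvx Dvx] := derivable_comp_C1 C1v dx.
  have dE : is_derive t 1 E (E t * - beta).
    have -> : E = expR \o (fun s => - beta * s) by [].
    have dl : is_derive t 1 (fun s : R => - beta * s) (- beta).
      by apply: is_derive_eq; rewrite [LHS]mulr1.
    exact: is_derive1_comp.
  have [dE1 dE2] := dE.
  apply: derivable_slope; first exact: derivableM.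
  have -> : 'D_1 psi t = E t * (dotp (grad v (x t)) ('D_1 x t) - beta * v (x t)).
    have dM : 'D_1 psi t = E t * 'D_1 (fun s => v (x s)) t + v (x t) * 'D_1 E t.
      exact: deriveM dE1 dvx.
    by rewrite dM Dvx dE2; ring.
  rewrite pmulr_rle0// subr_le0.
  apply: (@conv_hull_sub _ _ _ [set z | dotp (grad v (x t)) z <= beta * v (x t)] _ _ _ Dx).
    apply/convex_setP => a c l /andP[l0 l1] /= h1 h2.
    rewrite dotpDr !dotpZr.
    have := ler_wpM2l l0 h1.
    have := @ler_wpM2l _ (1 - l) _ _ _ h2; rewrite subr_ge0 => /(_ l1).
    lra.
  by move=> _ [u Uu <-]; apply: hv => //; exact: xX.
rewrite -oppr_le0; apply: (@ler_addscaleP _ _ _ B) => // d d0 d1.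
have d0' : 0 < d^-1 by rewrite invr_gt0.
(* At time 1 / (beta d) the discount is exp(- 1 / d), at most d since exp y >= 1 + y. *)
have T0 : 0 <= d^-1 / beta by rewrite divr_ge0// ltW.
have := psi_le _ T0; rewrite /psi {2}/E mulr0 expR0 mul1r.
have Ed : E (d^-1 / beta) <= d.
  rewrite /E mulNr mulrCA divff ?gt_eqF// mulr1 expRN.
  rewrite -[leRHS]invrK lef_pV2 ?posrE ?expR_gt0//.
  by rewrite (le_trans _ (expR_ge1Dx _))// lerDr.
have := vB _ (xX T0); rewrite ler_norml => /andP[h _].
have := ler_wpM2l (ltW (E0 (d^-1 / beta))) h.
have := ler_wpM2r B0 Ed.
lra.
Qed.

End viable.

(** A viable trajectory issued from a point close to [x0] is an approximate path for [x0]. *)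
Lemma MCI_closed : X !=set0 -> closed (MCI f X U).
Proof.
move=> X0 x0 clx; apply: approx_path_MCI => // e e0.
have [|x1 [[_ [x [x1E trx xX]]] x0x1]] := clx (ball x0 e);
  first exact: nbhsx_ballx.
exists x; apply: viable_approx_path => //; rewrite x1E distrC ltW//.
by move: x0x1; rewrite -ball_normE.
Qed.

End viable_trajectories.

(** * Euler paths and the exit cost *)

Section euler_scheme.
Variables (R : realType) (n m : nat).
Variables (F : 'rV[R]_n -> 'rV[R]_m -> 'rV[R]_n) (U : set 'rV[R]_m).
Variables (X : set 'rV[R]_n) (L M : R).
Hypotheses (U0 : U !=set0) (L0 : 0 <= L) (M0 : 0 <= M).
Hypothesis FL : forall x y u, U u -> `|F x u - F y u| <= L * `|x - y|.
Hypothesis FM : forall x u, U u -> `|F x u| <= M.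
Notation H := (support_fun F U).
Implicit Types (x y z p : 'rV[R]_n) (u : nat -> 'rV[R]_m).

Section fixed_step.
Variable h : R.
Hypothesis h0 : 0 < h.

(** The recursion consumes the first control: prefixing a control is by definition one step followed
    by the path of the tail, as dynamic programming requires. *)
Fixpoint euler x u k : 'rV[R]_n :=
  if k is k'.+1 then euler (x + h *: F x (u 0%N)) (fun i => u i.+1) k' else x.

Lemma eulerS x u k : euler x u k.+1 = euler x u k + h *: F (euler x u k) (u k).
Proof. by elim: k x u => // k IH x u; exact: (IH (x + h *: F x (u 0%N))). Qed.

Lemma euler_step x u i l : (forall k, U (u k)) ->
  `|euler x u (i + l)%N - euler x u i| <= M * (h * l%:R).
Proof.
move=> Uu; elim: l => [|l IH]; first by rewrite addn0 subrr normr0 !mulr0.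
rewrite addnS eulerS addrAC (le_trans (ler_normD _ _))// normrZ gtr0_norm//.
rewrite -natr1.
have := ler_wpM2l (ltW h0) (FM (euler x u (i + l)) (Uu (i + l)%N)).
move: IH; lra.
Qed.

Lemma euler_support x u i l p : (forall k, U (u k)) ->
  dotp p (euler x u (i + l)%N - euler x u i) <=
  h * l%:R * (H (euler x u i) p + norm1 p * (L * M * (h * l%:R))).
Proof.
move=> Uu; have N0 := norm1_ge0 p; elim: l => [|l IH].
  by rewrite addn0 subrr mulr0 !mul0r /dotp big1// => j _; rewrite mxE mulr0.
rewrite addnS eulerS addrAC dotpDr dotpZr.
set z := euler x u (i + l) in IH *; set z0 := euler x u i in IH *.
have h1 : dotp p (F z (u (i + l)%N)) <= H z0 p + norm1 p * (L * (M * (h * l%:R))).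
  apply: (le_trans (support_fun_ge U0 FM _ _ (Uu _))).
  apply: (le_trans (support_fun_lip U0 FL FM _ z0 _)).
  by rewrite lerD2l ler_wpM2l// ler_wpM2l// euler_step.
have := ler_wpM2l (ltW h0) h1.
have : 0 <= norm1 p * (L * M) * (h * h) * (l%:R + 1).
  by rewrite !mulr_ge0// ?ltW.
rewrite -natr1; move: IH; lra.
Qed.

Lemma euler_lip x y u k : (forall k, U (u k)) ->
  `|euler x u k - euler y u k| <= (1 + h * L) ^+ k * `|x - y|.
Proof.
move=> Uu; elim: k => [|k IH]; first by rewrite expr0 mul1r.
rewrite !eulerS exprS.
set a := euler x u k in IH *; set b := euler y u k in IH *.
have -> : a + h *: F a (u k) - (b + h *: F b (u k)) =
    (a - b) + h *: (F a (u k) - F b (u k)).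
  by apply/rowP => i; rewrite !mxE; ring.
rewrite (le_trans (ler_normD _ _))// normrZ gtr0_norm//.
have hL : 0 <= 1 + h * L by rewrite addr_ge0// mulr_ge0// ltW.
have := ler_wpM2l hL IH; have := ler_wpM2l (ltW h0) (FL a b (Uu k)); lra.
Qed.

(** With the state held constant between grid times, the steps made between [s] and [t] last t - s
    up to an error h. The condition on [h] absorbs this error in the displacement, in the support
    term and in the squared duration. *)
Lemma euler_approx_path x0 x u (e : R) : 0 < e -> (forall k, U (u k)) ->
  h * (M + M + L * M * (2 * e^-1 + h)) <= e -> `|x - x0| <= e ->
  (forall k, k%:R * h <= e^-1 -> dist X (euler x u k) <= e) ->
  approx_path F U X L M e x0 (fun t => euler x u (Num.truncn (t / h))).
Proof.
move=> e0 Uu hh xe hX; pose k t := Num.truncn (t / h).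
have kP t : 0 <= t -> (k t)%:R * h <= t < (k t)%:R * h + h.
  move=> t0; have := truncn_itv (divr_ge0 t0 (ltW h0)).
  by rewrite -/(k t) ler_pdivlMr// ltr_pdivrMr// -natr1 mulrDl mul1r.
have kS s t : 0 <= s -> s <= t -> exists l, k t = (k s + l)%N /\
    t - s - h <= h * l%:R <= t - s + h.
  move=> s0 st; exists (k t - k s)%N.
  have kk : (k s <= k t)%N by apply: le_truncn;
    rewrite ler_wpM2r// invr_ge0 ltW.
  rewrite subnKC//; split => //; rewrite natrB//.
  have := kP t (le_trans s0 st); have := kP s s0; lra.
have e'0 : 0 < e^-1 by rewrite invr_gt0.
have LM0 : 0 <= L * M by rewrite mulr_ge0.
have hM : 0 <= h * M by rewrite mulr_ge0// ltW.
have hLM : 0 <= h * (L * M * (2 * e^-1 + h)).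
  by rewrite !mulr_ge0// ?ltW// addr_gt0// mulr_gt0.
split.
- by rewrite mul0r truncn0.
- move=> s t s0 st; rewrite -/(k t) -/(k s);
    have [l [-> /andP[_ hl]]] := kS s t s0 st.
  rewrite (le_trans (euler_step _ _ _ Uu))//.
  have := ler_wpM2l M0 hl; move: hh; lra.
- move=> t t0 te; apply: hX; have /andP[h1 _] := kP t t0; exact: le_trans te.
- move=> s t p s0 st te; rewrite -/(k t) -/(k s).
  have [l [-> /andP[hl1 hl2]]] := kS s t s0 st.
  apply: (le_trans (euler_support _ _ _ _ Uu)).
  set z := euler x u (k s); have N0 := norm1_ge0 p.
  have hl0 : 0 <= h * l%:R by rewrite mulr_ge0// ltW.
  set q := h * l%:R in hl0 hl1 hl2 *; set d := t - s.
  have d0 : 0 <= d by rewrite subr_ge0.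
  have dT : d <= e^-1 by rewrite /d; lra.
  have qH : (q - d) * H z p <= h * (norm1 p * M).
    rewrite (le_trans (ler_norm _))// normrM ler_pM//.
      by rewrite ler_norml /d; apply/andP; split; lra.
    exact: support_fun_bound.
  have qq : q * q <= d * d + h * (2 * e^-1 + h).
    have h1 : q * q <= (d + h) * (d + h) by apply: ler_pM => //; rewrite /d;
      lra.
    have h2 : h * d <= h * e^-1 by rewrite ler_wpM2l// ltW.
    move: h1 h2; lra.
  have h3 := ler_wpM2l (mulr_ge0 N0 LM0) qq.
  have h4 := ler_wpM2l N0 hh.
  have h5 : 0 <= norm1 p * (h * M) by rewrite mulr_ge0.
  move: qH h3 h4 h5; lra.
Qed.

End fixed_step.

Section value_function.
Variables (h B e : R) (x0 : 'rV[R]_n).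
Hypotheses (h0 : 0 < h) (LB : L <= B) (hB : h * B <= 2^-1) (e0 : 0 < e).
Hypothesis X0 : X !=set0.

Let theta := 1 - h * B.
Let B0 : 0 <= B. Proof. exact: le_trans LB. Qed.
Let hB0 : 0 <= h * B. Proof. by rewrite mulr_ge0// ltW. Qed.
Let theta0 : 0 < theta. Proof. by move: hB; rewrite /theta; lra. Qed.
Let theta1 : theta <= 1. Proof. by move: hB0; rewrite /theta; lra. Qed.

(** It vanishes up to distance e / 2 to leave room for the averaging around [X], and is capped at 1
    so that the cost is bounded. *)
Definition penalty x : R := Num.min 1 (Num.max 0 (dist X x - e / 2)).

Let penalty01 x : 0 <= penalty x <= 1.
Proof. by rewrite /penalty le_min ler01 le_max lexx/= ge_min lexx. Qed.

Let penalty_lip x y : penalty x <= penalty y + `|x - y|.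
Proof.
have := dist_lip x y X0; rewrite ler_norml /penalty => /andP[_].
move: (dist X x) (dist X y) (normr_ge0 (x - y)); move: `|x - y| => c a b c0 ab.
have [Q [QE Q0 Qb]] : exists Q, [/\ Num.max 0 (b - e / 2) = Q, 0 <= Q & b - e / 2 <= Q].
  by exists (Num.max 0 (b - e / 2)); rewrite !le_max !lexx orbT.
rewrite {}QE; have [Q1|Q1] := lerP 1 Q.
  by rewrite ge_min; apply/orP; left; rewrite lerDl.
rewrite ge_min; apply/orP; right; rewrite ge_max.
by apply/andP; split; move: Qb Q0; lra.
Qed.

Definition euler_cost x u : R := sup [set theta ^+ k * penalty (euler h x u k) | k in setT].

Definition controls : set (nat -> 'rV[R]_m) := [set u | forall k, U (u k)].

Let th01 k : 0 < theta ^+ k <= 1.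
Proof. by rewrite exprn_gt0//= exprn_ile1// ltW. Qed.

Let cost_has_sup x u : has_sup [set theta ^+ k * penalty (euler h x u k) | k in setT].
Proof.
split; first by exists (theta ^+ 0 * penalty (euler h x u 0)), 0%N.
exists 1 => _ [k _ <-]; have /andP[t0 t1] := th01 k;
  have /andP[p0 p1] := penalty01 (euler h x u k).
by rewrite mulr_ile1// ltW.
Qed.

Let cost_ge x u k : theta ^+ k * penalty (euler h x u k) <= euler_cost x u.
Proof. by apply: (ub_le_sup (cost_has_sup x u).2); exists k. Qed.

Let cost_le x u b : (forall k, theta ^+ k * penalty (euler h x u k) <= b) ->
  euler_cost x u <= b.
Proof. by move=> hb; apply: ge_sup;
  [exact: (cost_has_sup x u).1|move=> _ [k _ <-]]. Qed.

Let cost_ge0 x u : 0 <= euler_cost x u.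
Proof.
apply: le_trans (cost_ge x u 0); rewrite expr0 mul1r.
by have /andP[] := penalty01 (euler h x u 0).
Qed.

(** Under the same controls two paths separate by a factor at most 1 + h L per step, and theta (1 +
    h L) <= 1 because L <= B: the discount absorbs the expansion. *)
Let cost_lip x y u : controls u -> euler_cost x u <= euler_cost y u + `|x - y|.
Proof.
move=> Uu; apply: cost_le => k.
apply: (@le_trans _ _ (theta ^+ k * (penalty (euler h y u k) +
    (1 + h * L) ^+ k * `|x - y|))).
  have /andP[t0 t1] := th01 k; rewrite ler_pM2l//.
  by rewrite (le_trans (penalty_lip _ (euler h y u k)))// lerD2l euler_lip.
rewrite mulrDr lerD// mulrA -exprMn ler_piMl// exprn_ile1//.
  by rewrite mulr_ge0 ?ltW// ltr_wpDr// mulr_ge0// ltW.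
have hLB : h * L <= h * B by rewrite ler_wpM2l// ltW.
have : 0 <= h * B * (h * L) by rewrite mulr_ge0// mulr_ge0// ltW.
rewrite /theta; lra.
Qed.

Definition euler_value x : R := inf [set euler_cost x u | u in controls].

Let value_has_inf x : has_inf [set euler_cost x u | u in controls].
Proof.
split; last by exists 0 => _ [u _ <-].
by case: U0 => u Uu; exists (euler_cost x (fun=> u)), (fun=> u).
Qed.

Let value_le x u : controls u -> euler_value x <= euler_cost x u.
Proof. by move=> cu; apply: (ge_inf (value_has_inf x).2); exists u. Qed.

Let value_ge x b : (forall u, controls u -> b <= euler_cost x u) -> b <= euler_value x.
Proof. by move=> hb; apply: lb_le_inf;
  [exact: (value_has_inf x).1|move=> _ [u cu <-]; exact: hb]. Qed.

Lemma euler_value_ge0 x : 0 <= euler_value x.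
Proof. by apply: value_ge. Qed.

Lemma euler_value_lip x y : `|euler_value x - euler_value y| <= `|x - y|.
Proof.
have h1 a b : euler_value a <= euler_value b + `|a - b|.
  rewrite -lerBlDr; apply: value_ge => u cu; rewrite lerBlDr.
  exact: le_trans (value_le _ cu) (cost_lip _ _ cu).
have h2 := h1 y x; rewrite distrC in h2; move: (h1 x y) h2.
move: (euler_value x) (euler_value y) `|x - y| => a b c {}h1 h2.
by rewrite ler_norml; apply/andP; split; lra.
Qed.

(** Dynamic programming: a control for the next point is prefixed by [u]. The term k = 0 is zero
    this close to [X], and every later term has one more factor theta. *)
Lemma euler_value_step x (u : 'rV[R]_m) : U u -> dist X x <= e / 2 ->
  euler_value x <= theta * euler_value (x + h *: F x u).
Proof.
move=> Uu dx; rewrite mulrC -ler_pdivrMr//; apply: value_ge => u' cu'.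
rewrite ler_pdivrMr// mulrC.
pose u'' k := if k is k'.+1 then u' k' else u.
have cu'' : controls u'' by case.
apply: (le_trans (value_le x cu'')); apply: cost_le => -[|k].
  rewrite expr0 mul1r /= /penalty (max_idPl _) ?subr_le0//.
  by rewrite (min_idPr _)// mulr_ge0// ltW.
by rewrite exprS -mulrA ler_pM2l//= cost_ge.
Qed.

(** As 1 - y >= exp(- 2 y) for 0 <= y <= 1 / 2, the discount up to time [T] is at least exp(- 2 B
    T), whatever [h]. *)
Lemma euler_value_lower x (T : R) : 0 <= T ->
  (forall u, controls u -> exists k, k%:R * h <= T /\ e < dist X (euler h x u k)) ->
  expR (- (2 * B * T)) * Num.min 1 (e / 2) <= euler_value x.
Proof.
move=> T0 hk; apply: value_ge => u /hk[k [kT ke]].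
apply: le_trans (cost_ge x u k); apply: ler_pM.
- exact: expR_ge0.
- by rewrite le_min ler01/= divr_ge0// ltW.
- have y0 := hB0; set y := h * B in y0 *.
  have le1 : expR (- (2 * y)) <= theta.
    rewrite expRN; apply: (@le_trans _ _ (1 + 2 * y)^-1).
      rewrite lef_pV2 ?posrE ?expR_gt0 ?expR_ge1Dx//.
      by rewrite ltr_wpDr// mulr_ge0.
    rewrite -[leLHS]mul1r ler_pdivrMr; last by rewrite ltr_wpDr// mulr_ge0.
    have : y * y <= y * 2^-1 by rewrite ler_wpM2l.
    rewrite /theta -/y; lra.
  apply: (@le_trans _ _ (expR (- (2 * y)) ^+ k)); last first.
    by rewrite lerXn2r ?nnegrE ?expR_ge0// ltW.
  rewrite -expRM_natl ler_expR.
  have := ler_wpM2l B0 kT; rewrite /y; lra.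
- rewrite /penalty le_min ge_min lexx/= ge_min; apply/orP; right.
  by rewrite le_max; apply/orP; right; move: ke; lra.
Qed.

End value_function.

(** An Euler path from near [x0] that stayed within [e] of [X] up to time e^-1 would be an excluded
    approximate path; so all controls exit by that time, for every small [h]. *)
Lemma value_function x0 (e B : R) : X !=set0 -> 0 < e -> L <= B ->
  (forall y : R -> 'rV[R]_n, ~ approx_path F U X L M e x0 y) ->
  exists2 c, 0 < c & exists2 h1, 0 < h1 & forall h, 0 < h -> h <= h1 ->
  exists w : 'rV[R]_n -> R, [/\ forall x, 0 <= w x,
    forall x y, `|w x - w y| <= `|x - y|,
    forall x (u : 'rV[R]_m), U u -> dist X x <= e / 2 -> w x <= (1 - h * B) * w
      (x + h *: F x u) &
    forall x, `|x - x0| <= e -> c <= w x].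
Proof.
move=> X0 e0 LB nap; have B0 : 0 <= B by exact: le_trans LB.
have e'0 : 0 < e^-1 by rewrite invr_gt0.
exists (expR (- (2 * B * e^-1)) * Num.min 1 (e / 2)).
  by rewrite mulr_gt0 ?expR_gt0// lt_min ltr01 divr_gt0.
pose D := M + M + L * M * (2 * e^-1 + 1).
have D0 : 0 <= D.
  by rewrite !addr_ge0// mulr_ge0 ?addr_ge0 ?mulr_ge0// ltW.
have D1 : 0 < D + 1 by rewrite ltr_wpDl.
have B1 : 0 < 2 * B + 1 by rewrite ltr_wpDl// mulr_ge0.
(* The three bounds give h <= 1, used to bound the h inside the error by [D], then h D <= e and h B
   <= 1 / 2. *)
exists (Num.min 1 (Num.min (e / (D + 1)) (2 * B + 1)^-1)).
  by rewrite !lt_min ltr01 divr_gt0//= invr_gt0.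
move=> h h0; rewrite !le_min => /andP[h1 /andP[hD hB]].
have hD' : h * D <= e.
  move: hD; rewrite ler_pdivlMr//; apply: le_trans.
  by rewrite ler_wpM2l ?ltW// ltrDl.
have hB' : h * B <= 2^-1.
  have := ler_wpM2r (ltW B1) hB; rewrite mulVf ?gt_eqF//; have := h0; lra.
exists (euler_value h B e); split.
- by move=> x; exact: euler_value_ge0.
- by move=> x y; exact: euler_value_lip.
- by move=> x u; exact: euler_value_step.
- move=> x xx0; apply: euler_value_lower => //; first exact: ltW.
  move=> u cu; apply: contrapT => /forallNP hn;
    apply: (nap (fun t => euler h x u (Num.truncn (t / h)))).
  apply: euler_approx_path => //.
    apply: le_trans hD'; rewrite ler_wpM2l ?(ltW h0)// /D lerD2l.
    by rewrite ler_wpM2l ?mulr_ge0// lerD2l.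
  move=> k kh; rewrite leNgt; apply/negP => ke; apply: (hn k); split => //.
Qed.

End euler_scheme.

(** * Smoothing *)

Lemma quadratic_differentiable (R : realType) (n : nat) (v : 'rV[R]_n -> R)
    (x d : 'rV[R]_n) (C : R) : 0 <= C ->
  (forall y, `|y| < 1 -> `|v (x + y) - v x - dotp d y| <= C * `|y| ^+ 2) ->
  differentiable v x /\ grad v x = d.
Proof.
move=> C0 hv.
have dlin : linear (dotp d : 'rV[R]_n -> R).
  by move=> a y z; rewrite dotpDr dotpZr.
pose dL : {linear 'rV[R]_n -> R} := HB.pack (dotp d : 'rV[R]_n -> R)
  (GRing.isLinear.Build _ _ _ _ _ dlin).
have dc : continuous dL by exact: dotp_continuous.
have E : v \o shift x = cst (v x) + dL +o_ (0 : 'rV[R]_n) id.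
  have C1 : 0 < C + 1 by rewrite ltr_wpDl.
  apply/eqaddoP => _ /posnumP[e]; apply/nbhs_ballP.
  exists (Num.min 1 (e%:num / (C + 1))) => [|y] /=.
    by rewrite lt_min ltr01 divr_gt0.
  rewrite -ball_normE/= sub0r normrN lt_min => /andP[y1].
  rewrite ltr_pdivlMr// mulrC => yC.
  rewrite [X in `|X|](_ : _ = v (x + y) - v x - dotp d y); last first.
    by rewrite -[LHS]/(v (y + x) - (v x + dotp d y)) opprD addrA (addrC y).
  apply: (le_trans (hv _ y1));
    rewrite expr2 mulrA ler_wpM2r// (le_trans _ (ltW yC))//.
  by rewrite ler_wpM2r// lerDl.
have dE : 'd (v : 'rV[R]_n -> R) x = dL :> (_ -> _) by exact: diff_unique.
have dv : differentiable v x by apply/diff_locallyP; rewrite dE.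
split => //; apply/rowP => i; rewrite mxE deriveE// dE.
rewrite /= /dotp (bigD1 i)//= mxE !eqxx mulr1 big1 ?addr0// => j ji.
by rewrite mxE (negbTE ji) mulr0.
Qed.

(** * Averages of Lipschitz functions *)

Section average.
Variables (R : realType) (eps : R).
Hypothesis eps0 : 0 < eps.
Implicit Types (phi psi Phi Psi : R -> R).

Definition antiderivative phi Phi :=
  forall t, 0 <= t <= eps -> is_derive t 1 Phi (phi t).

(** The mean over [0, eps] is taken through antiderivatives, so that comparison and shift estimates
    reduce to the mean value theorem, which also makes it independent of the antiderivative. *)
Definition average phi : R := xget 0 [set a | exists Phi,
  antiderivative phi Phi /\ a = (Phi eps - Phi 0) / eps].

Lemma antiderivative_mono phi psi Phi Psi : antiderivative phi Phi ->
  antiderivative psi Psi -> (forall t, 0 <= t <= eps -> phi t <= psi t) ->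
  (Phi eps - Phi 0) / eps <= (Psi eps - Psi 0) / eps.
Proof.
move=> aP aQ hle; rewrite ler_pM2r ?invr_gt0//.
pose D := Psi \- Phi.
have dD t : 0 <= t <= eps -> is_derive t 1 D (psi t - phi t).
  by move=> ht; have := aP t ht; have := aQ t ht => *; exact: is_deriveB.
have [||c] := @MVT_segment R D (fun t => psi t - phi t) 0 eps (ltW eps0).
- by move=> t; rewrite in_itv/= => /andP[? ?]; apply: dD; rewrite !ltW.
- apply: derivable_within_continuous => t; rewrite in_itv/= => ht.
  by have [] := dD t ht.
rewrite in_itv/= subr0 => ht; rewrite /D/= => h.
have : 0 <= (psi c - phi c) * eps by rewrite mulr_ge0 ?subr_ge0 ?hle// ltW.
by move: h; lra.
Qed.

Lemma averageE phi Phi : antiderivative phi Phi -> average phi = (Phi eps - Phi 0) / eps.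
Proof.
move=> aP; rewrite /average;
  case: xgetP => [a _ [Psi [aQ ->]]|/(_ ((Phi eps - Phi 0) / eps))].
  by apply: le_anti; rewrite !(antiderivative_mono aP aQ, antiderivative_mono aQ aP).
by case; exists Phi.
Qed.

(** The base point -1 makes the derivative two-sided at 0 and leaves room for shifts by less than
    1. *)
Lemma continuous_antiderivative phi : continuous phi ->
  exists Phi, forall t : R, -1 < t -> is_derive t 1 Phi (phi t).
Proof.
move=> cphi; exists (fun x => \int[lebesgue_measure]_(t in [set` `[-1, x]]) (phi t)).
move=> t t1.
have fi : lebesgue_measure.-integrable `[-1, t + 1] (EFin \o phi).
  apply: continuous_compact_integrable; first exact: segment_compact.
  exact: continuous_subspaceT.
have tt1 : t < t + 1 by rewrite ltrDl.
have [d dE] := continuous_FTC1_closed tt1 fi t1 (cphi t).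
by split; [exact: d|rewrite -derive1E; exact: dE].
Qed.

Let cont_anti phi : continuous phi -> exists Phi, antiderivative phi Phi.
Proof.
move=> /continuous_antiderivative[Phi h]; exists Phi => t /andP[t0 _]; apply: h.
by apply: lt_le_trans t0; rewrite ltrN10.
Qed.

Lemma average_mono phi psi : continuous phi -> continuous psi ->
  (forall t, 0 <= t <= eps -> phi t <= psi t) -> average phi <= average psi.
Proof.
move=> /cont_anti[Phi aP] /cont_anti[Psi aQ] h.
by rewrite (averageE aP) (averageE aQ); exact: (antiderivative_mono aP aQ).
Qed.

Lemma average_lin phi psi c : continuous phi -> continuous psi ->
  average (fun t => phi t + c * psi t) = average phi + c * average psi.
Proof.
move=> /cont_anti[Phi aP] /cont_anti[Psi aQ].
have aR : antiderivative (fun t => phi t + c * psi t) (fun t => Phi t + c * Psi t).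
  move=> t ht; have h1 := aP t ht; have h2 := aQ t ht.
  by apply: is_deriveD.
by rewrite (averageE aP) (averageE aQ) (averageE aR); field; rewrite gt_eqF.
Qed.

Lemma average_cst c : average (fun=> c) = c.
Proof.
have aP : antiderivative (fun=> c) (fun t => c * t).
  by move=> t _; apply: is_derive_eq; rewrite [LHS]mulr1.
by rewrite (averageE aP) mulr0 subr0 mulfK// gt_eqF.
Qed.

(** A shift changes the integral only at the two ends of the window, by d phi(eps) - d phi(0) up to
    d^2 at each end: averaging makes a merely Lipschitz function derivable, with an explicit
    derivative. *)
Lemma average_shift phi d : (forall s t, `|phi s - phi t| <= `|s - t|) -> `|d| < 1 ->
  `|average (fun t => phi (t + d)) - average phi - d * ((phi eps - phi 0) / eps)| <=
  2 / eps * d ^+ 2.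
Proof.
move=> plip d1.
have cphi : continuous phi.
  by apply: (@lipschitz1_continuous _ _ _ 1) => s t; rewrite mul1r.
have [Phi hP] := continuous_antiderivative cphi.
have lt0 (t : R) : 0 <= t -> -1 < t by apply: lt_le_trans; rewrite ltrN10.
have aP : antiderivative phi Phi by move=> t /andP[t0 _]; exact/hP/lt0.
have aS : antiderivative (fun t => phi (t + d)) (fun t => Phi (t + d)).
  move=> t /andP[t0 _].
  have td : -1 < t + d by move: d1; rewrite ltr_norml => /andP[]; lra.
  have h1 := hP _ td.
  have h2 : is_derive t 1 (fun s : R => s + d) 1 by apply: is_derive_eq;
    rewrite addr0.
  by have := @is_derive1_comp R Phi (fun s => s + d) t _ _ h1 h2; rewrite mulr1.
have key t : 0 <= t -> `|Phi (t + d) - Phi t - d * phi t| <= d ^+ 2.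
  move=> t0.
  suff [c [cd ->]] : exists c, `|c - t| <= `|d| /\ Phi (t + d) - Phi t = phi c
    * d.
    have -> : phi c * d - d * phi t = (phi c - phi t) * d by ring.
    rewrite normrM -real_normK ?num_real// expr2 ler_wpM2r//.
    exact: le_trans (plip _ _) cd.
  have Pc a b : -1 < a -> {within `[a, b], continuous Phi}.
    move=> a1; apply: derivable_within_continuous => s;
      rewrite in_itv/= => /andP[as_ _].
    by have [] := hP s (lt_le_trans a1 as_).
  have [dle|dge] := leP 0 d.
    have [|||c] := @MVT_segment R Phi phi t (t + d); first by rewrite lerDl.
    - move=> s; rewrite in_itv/= => /andP[ts _]; apply/hP/lt0.
      by rewrite (le_trans t0)// ltW.
    - exact/Pc/lt0.
    rewrite in_itv/= => /andP[tc ctd] ->; exists c; split;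
      last by rewrite addrAC subrr add0r.
    rewrite !ger0_norm//; lra.
  have td : -1 < t + d by move: d1; rewrite ltr_norml => /andP[]; lra.
  have [|||c] := @MVT_segment R Phi phi (t + d) t; first by lra.
  - by move=> s; rewrite in_itv/= => /andP[ts _]; apply/hP; exact: lt_trans ts.
  - exact: Pc.
  rewrite in_itv/= => /andP[tc ctd] h; exists c; split; last by move: h; lra.
  rewrite ler0_norm ?ltr0_norm//; lra.
rewrite (averageE aP) (averageE aS).
have -> : (Phi (eps + d) - Phi (0 + d)) / eps - (Phi eps - Phi 0) / eps -
    d * ((phi eps - phi 0) / eps) =
    eps^-1 * ((Phi (eps + d) - Phi eps - d * phi eps) -
              (Phi (0 + d) - Phi 0 - d * phi 0)).
  by field; rewrite gt_eqF.
rewrite normrM gtr0_norm ?invr_gt0// -mulrA mulrCA ler_pM2l ?invr_gt0//.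
rewrite (le_trans (ler_normB _ _))//.
have := key 0 (lexx 0); have := key eps (ltW eps0); lra.
Qed.

End average.

Lemma lipschitz_rV_continuous (R : realType) (n k : nat) (g : 'rV[R]_n ->
  'rV[R]_k) (C : R) :
  (forall x y, `|g x - g y| <= C * `|x - y|) -> continuous g.
Proof.
move=> gC x A /nbhs_ballP[e /= e0 eA].
have C1 : 0 < `|C| + 1 by rewrite ltr_wpDl.
apply/nbhs_ballP; exists (e / (`|C| + 1)) => /=; first by rewrite divr_gt0.
move=> y; rewrite -ball_normE/= ltr_pdivlMr// mulrC => yx; apply: eA.
rewrite -ball_normE/=; apply: le_lt_trans yx.
apply: (le_trans (gC x y)); rewrite ler_wpM2r// (le_trans (ler_norm _))//.
by rewrite lerDl.
Qed.

Section smoothing.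
Variables (R : realType) (n : nat) (eps : R).
Hypothesis eps0 : 0 < eps.
Implicit Types (g w : 'rV[R]_n -> R) (x y z : 'rV[R]_n) (i j : 'I_n).

Let ev i : 'rV[R]_n := delta_mx 0 i.

Lemma norm_delta_mx i (s : R) : `|s *: (delta_mx 0 i : 'rV[R]_n)| <= `|s|.
Proof.
apply: norm_le_coord => // j; rewrite !mxE eqxx/= normrM.
by case: (j == i); rewrite ?normr1 ?normr0 ?mulr1 ?mulr0.
Qed.

Let norm_ev i (s : R) : `|s *: ev i| <= `|s|.
Proof. exact: norm_delta_mx. Qed.

(** Iterated over the axes, this averages over a cube without integrals in several variables. *)
Definition smooth i g x := average eps (fun s => g (x + s *: ev i)).

Let line_c i g C x : (forall x y, `|g x - g y| <= C * `|x - y|) ->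
  continuous (fun s : R => g (x + s *: ev i)).
Proof.
move=> gC; apply: (@lipschitz1_continuous _ _ _ `|C|) => s t.
apply: (le_trans (gC _ _));
  apply: (@le_trans _ _ (`|C| * `|x + s *: ev i - (x + t *: ev i)|)).
  by rewrite ler_wpM2r// ler_norm.
rewrite ler_wpM2l//.
have -> : x + s *: ev i - (x + t *: ev i) = (s - t) *: ev i.
  by apply/rowP => j; rewrite !mxE; ring.
exact: norm_ev.
Qed.

Let smooth_le i g C x (b : R) : (forall x y, `|g x - g y| <= C * `|x - y|) ->
  (forall s, 0 <= s <= eps -> g (x + s *: ev i) <= b) -> smooth i g x <= b.
Proof.
move=> gC h; rewrite -[leRHS](average_cst eps0); apply: average_mono => //.
- exact: line_c gC.
- by move=> s; exact: cvg_cst.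
Qed.

Let smooth_ge i g C x (b : R) : (forall x y, `|g x - g y| <= C * `|x - y|) ->
  (forall s, 0 <= s <= eps -> b <= g (x + s *: ev i)) -> b <= smooth i g x.
Proof.
move=> gC h; rewrite -[leLHS](average_cst eps0); apply: average_mono => //.
- by move=> s; exact: cvg_cst.
- exact: line_c gC.
Qed.

Let smooth_lin i g g' C C' x y (c : R) : (forall x y, `|g x - g y| <= C * `|x - y|) ->
  (forall x y, `|g' x - g' y| <= C' * `|x - y|) ->
  smooth i g x + c * smooth i g' y =
  average eps (fun s => g (x + s *: ev i) + c * g' (y + s *: ev i)).
Proof.
move=> gC gC'; rewrite average_lin//; [exact: line_c gC|exact: line_c gC'].
Qed.

Let avg_norm (phi : R -> R) (b : R) : continuous phi ->
  (forall s, 0 <= s <= eps -> `|phi s| <= b) -> `|average eps phi| <= b.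
Proof.
move=> cphi h; rewrite ler_norml; apply/andP; split.
  rewrite -[leLHS](average_cst eps0); apply: average_mono => //.
    by move=> s; exact: cvg_cst.
  by move=> s /h; rewrite ler_norml => /andP[].
rewrite -[leRHS](average_cst eps0); apply: average_mono => //.
  by move=> s; exact: cvg_cst.
by move=> s /h; rewrite ler_norml => /andP[].
Qed.

Let smooth_lip i g C : (forall x y, `|g x - g y| <= C * `|x - y|) ->
  forall x y, `|smooth i g x - smooth i g y| <= C * `|x - y|.
Proof.
move=> gC x y.
have -> : smooth i g x - smooth i g y = smooth i g x + (-1) * smooth i g y by ring.
rewrite (smooth_lin _ _ _ _ gC gC); apply: avg_norm.
  move=> s; apply: cvgD; first exact: line_c gC _.
  by apply: cvgM; [exact: cvg_cst|exact: line_c gC _].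
move=> s _; rewrite mulN1r; apply: (le_trans (gC _ _)).
by rewrite opprD addrACA subrr addr0.
Qed.

(** The invariant carried from axis to axis: [D i] is the partial derivative along an axis already
    treated, regular enough for a quadratic remainder. *)
Definition smoothed (I : seq 'I_n) g (D : 'I_n -> 'rV[R]_n -> R) := [/\
  forall x y, `|g x - g y| <= `|x - y|,
  forall i, i \in I -> forall x y, `|D i x - D i y| <= 2 / eps * `|x - y|,
  forall i, i \in I -> forall x, `|D i x| <= 1 &
  forall i, i \in I -> forall x (d : R), `|d| < 1 ->
    `|g (x + d *: ev i) - g x - d * D i x| <= 2 / eps * d ^+ 2].

(** Along [j] the derivative is a difference quotient of step eps, hence 2 / eps-Lipschitz; along
    the other axes, derivatives are averaged with the function. *)
Lemma smoothed_cons j I g D : smoothed I g D -> exists D',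
  smoothed (j :: I) (smooth j g) D'.
Proof.
move=> [g1 D1 D2 gD].
have g1' x y : `|g x - g y| <= 1 * `|x - y| by rewrite mul1r.
pose Dj x := (g (x + eps *: ev j) - g x) / eps.
exists (fun i => if i == j then Dj else smooth j (D i)); split.
- by move=> x y; have := @smooth_lip j g 1 g1' x y; rewrite mul1r.
- move=> i iI x y; case: eqP => [_|/eqP ij].
    rewrite /Dj -mulrBl normrM (gtr0_norm (_ : 0 < eps^-1)) ?invr_gt0//.
    rewrite mulrAC ler_pM2r ?invr_gt0//.
    have := g1 (x + eps *: ev j) (y + eps *: ev j).
    rewrite opprD addrACA subrr addr0 => h1.
    have -> : g (x + eps *: ev j) - g x - (g (y + eps *: ev j) - g y) =
      g (x + eps *: ev j) - g (y + eps *: ev j) - (g x - g y) by ring.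
    rewrite (le_trans (ler_normB _ _))//; have := g1 x y; move: h1; lra.
  by apply: smooth_lip; apply: D1; move: iI; rewrite inE (negbTE ij).
- move=> i iI x; case: eqP => [_|/eqP ij].
    rewrite /Dj normrM (gtr0_norm (_ : 0 < eps^-1)) ?invr_gt0// ler_pdivrMr// mul1r.
    apply: (le_trans (g1 _ _)); rewrite addrC addKr (le_trans (norm_ev _ _))//.
    by rewrite gtr0_norm.
  have iI' : i \in I by move: iI; rewrite inE (negbTE ij).
  apply: avg_norm; first exact: line_c (D1 i iI').
  by move=> s _; exact: D2.
- move=> i iI x d d1; case: eqP => [->|/eqP ij].
    have := @average_shift R eps eps0 (fun s => g (x + s *: ev j)) d.
    rewrite /smooth /Dj scale0r addr0.
    have -> : (fun t => g (x + (t + d) *: ev j)) =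
        (fun s => g (x + d *: ev j + s *: ev j)).
      by apply/funext => t; rewrite scalerDl addrA addrAC.
    apply => // s t; apply: (le_trans (g1 _ _)).
    have -> : x + s *: ev j - (x + t *: ev j) = (s - t) *: ev j.
      by apply/rowP => k; rewrite !mxE; ring.
    exact: norm_ev.
  have iI' : i \in I by move: iI; rewrite inE (negbTE ij).
  have cDi := D1 i iI'.
  have E : smooth j g (x + d *: ev i) - smooth j g x - d * smooth j (D i) x =
      average eps (fun s => (g (x + d *: ev i + s *: ev j) + (-1) * g (x + s *: ev j)) +
        (- d) * D i (x + s *: ev j)).
    rewrite average_lin//; last exact: line_c cDi.
      by rewrite -(smooth_lin _ _ _ _ g1' g1'); rewrite /smooth; ring.
    move=> s; apply: cvgD; first exact: line_c g1' _.
    by apply: cvgM; [exact: cvg_cst|exact: line_c g1' _].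
  rewrite E; apply: avg_norm.
    move=> s; apply: cvgD.
      apply: cvgD; first exact: line_c g1' _.
      by apply: cvgM; [exact: cvg_cst|exact: line_c g1' _].
    by apply: cvgM; [exact: cvg_cst|exact: line_c cDi _].
  move=> s _; have := gD i iI' (x + s *: ev j) d d1.
  have -> : x + d *: ev i + s *: ev j = x + s *: ev j + d *: ev i by rewrite addrAC.
  by rewrite mulN1r mulNr.
Qed.

Lemma smoothed_near j g x : (forall x y, `|g x - g y| <= `|x - y|) ->
  `|smooth j g x - g x| <= eps.
Proof.
move=> g1; have g1' y z : `|g y - g z| <= 1 * `|y - z| by rewrite mul1r.
have h s : 0 <= s <= eps -> `|g (x + s *: ev j) - g x| <= eps.
  move=> /andP[s0 se]; apply: (le_trans (g1 _ _)).
  by rewrite addrAC subrr add0r (le_trans (norm_ev _ _))// ger0_norm.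
rewrite ler_norml; apply/andP; split.
  rewrite lerBrDr; apply: (smooth_ge g1') => s /h.
  by rewrite ler_norml => /andP[h1 _]; move: h1; lra.
rewrite lerBlDr; apply: (smooth_le g1') => s /h.
by rewrite ler_norml => /andP[_ h1]; move: h1; lra.
Qed.

(** The coordinates are moved one at a time. Each move leaves its own quadratic remainder plus the
    variation of [D j] due to the other moves, and the pairs of axes account for the squared
    size. *)
Lemma smoothed_quadratic I g D : smoothed I g D -> forall x y, `|y| < 1 ->
  `|g (x + \sum_(i <- I) y 0 i *: ev i) - g x - \sum_(i <- I) y 0 i * D i x| <=
  (size I)%:R ^+ 2 * (2 / eps) * `|y| ^+ 2.
Proof.
move=> [g1 D1 D2 gD] x y y1.
have e2 : 0 < 2 / eps by rewrite divr_gt0.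
suff : forall J, {subset J <= I} ->
  `|g (x + \sum_(i <- J) y 0 i *: ev i) - g x - \sum_(i <- J) y 0 i * D i x| <=
  (size J)%:R ^+ 2 * (2 / eps) * `|y| ^+ 2 by apply.
elim => [_|j J IH JI].
  rewrite !big_nil addr0 subrr subr0 normr0.
  by apply: mulr_ge0; [apply: mulr_ge0;
    [exact: exprn_ge0|exact: ltW]|exact: exprn_ge0].
have jI : j \in I by apply: JI; rewrite mem_head.
have {}IH := IH (fun k kJ => JI k (mem_behead (s := j :: J) kJ)).
rewrite !big_cons [size _]/=.
set z := \sum_(i <- J) _ in IH *; set S := \sum_(i <- J) _ * _ in IH *.
have -> : x + (y 0 j *: ev j + z) = (x + z) + y 0 j *: ev j.
  by rewrite [y 0 j *: _ + _]addrC addrA.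
have yj : `|y 0 j| <= `|y| by exact: coord_le_norm.
have h1 := gD j jI (x + z) (y 0 j) (le_lt_trans yj y1).
have h2 := D1 j jI (x + z) x; rewrite addrAC subrr add0r in h2.
have zy : `|z| <= (size J)%:R * `|y|.
  rewrite /z; elim: (J) => [|k J' IH']; first by rewrite big_nil normr0 mul0r.
  rewrite big_cons [size _]/= -natr1 mulrDl mul1r [leRHS]addrC.
  apply: (le_trans (ler_normD _ _)); apply: lerD; last exact: IH'.
  exact: le_trans (norm_ev _ _) (coord_le_norm _ _).
have h3 : `|y 0 j * (D j (x + z) - D j x)| <= `|y| * (2 / eps * ((size J)%:R * `|y|)).
  rewrite normrM ler_pM//; apply: (le_trans h2); rewrite ler_wpM2l// ltW//.
have h4 : 2 / eps * y 0 j ^+ 2 <= 2 / eps * `|y| ^+ 2.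
  by rewrite ler_pM2l// -[leLHS]real_normK ?num_real// lerXn2r ?nnegrE.
have -> : g (x + z + y 0 j *: ev j) - g x - (y 0 j * D j x + S) =
    (g (x + z + y 0 j *: ev j) - g (x + z) - y 0 j * D j (x + z)) +
    y 0 j * (D j (x + z) - D j x) + (g (x + z) - g x - S) by ring.
apply: (le_trans (ler_normD _ _)).
apply: (le_trans (lerD (le_trans (ler_normD _ _)
  (lerD (le_trans h1 h4) h3)) IH)).
have s0 : 0 <= (size J)%:R :> R by [].
have : 0 <= (size J)%:R * (2 / eps) * `|y| ^+ 2.
  by apply: mulr_ge0; [apply: mulr_ge0 => //; exact: ltW|exact: exprn_ge0].
rewrite -[(size J).+1%:R]natr1; move: (2 / eps) `|y| (size J)%:R => a b c; lra.
Qed.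

Lemma smooth_ge0 j g x : (forall x y, `|g x - g y| <= `|x - y|) ->
  (forall x, 0 <= g x) -> 0 <= smooth j g x.
Proof.
move=> g1 g0; have g1' y z : `|g y - g z| <= 1 * `|y - z| by rewrite mul1r.
by apply: (smooth_ge g1').
Qed.

Lemma smooth_step j g x z (th c : R) : (forall x y, `|g x - g y| <= `|x - y|) ->
  (forall s, 0 <= s <= eps ->
    g (x + s *: delta_mx 0 j) <= c + th * g (z + s *: delta_mx 0 j)) ->
  smooth j g x <= c + th * smooth j g z.
Proof.
move=> g1 h; have g1' y y' : `|g y - g y'| <= 1 * `|y - y'| by rewrite mul1r.
have cg y := @line_c j _ _ y g1'.
have cc : continuous (fun _ : R => c) by move=> s; exact: cvg_cst.
rewrite -[X in X + _](average_cst eps0) -average_lin//.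
apply: average_mono => // s; apply: cvgD; first exact: cvg_cst.
by apply: cvgM; [exact: cvg_cst|exact: cg].
Qed.

End smoothing.

(** * Smooth test functions *)

Section test_function.
Variables (R : realType) (n m : nat).
Variables (F : 'rV[R]_n -> 'rV[R]_m -> 'rV[R]_n) (U : set 'rV[R]_m).
Variables (X : set 'rV[R]_n) (L M : R).
Hypotheses (U0 : U !=set0) (L0 : 0 <= L) (M0 : 0 <= M).
Hypothesis FL : forall x y u, U u -> `|F x u - F y u| <= L * `|x - y|.
Hypothesis FM : forall x u, U u -> `|F x u| <= M.
Hypothesis X0 : X !=set0.
Implicit Types (x y z : 'rV[R]_n) (u : 'rV[R]_m).

(** Within the window [F] varies by at most L eps, which costs h L eps per axis. The inequality is
    used up to eps further from [X], whence the shrinking radius. *)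
Lemma smoothed_value (eps h th r : R) (w : 'rV[R]_n -> R) (I : seq 'I_n) :
  0 < eps -> 0 < h -> 0 <= th <= 1 -> (forall x, 0 <= w x) ->
  (forall x y, `|w x - w y| <= `|x - y|) ->
  (forall x u, U u -> dist X x <= r -> w x <= th * w (x + h *: F x u)) ->
  exists g D, [/\ smoothed eps I g D, forall x, 0 <= g x,
    forall x, `|g x - w x| <= (size I)%:R * eps &
    forall x u, U u -> dist X x <= r - (size I)%:R * eps ->
      g x <= h * ((size I)%:R * (L * eps)) + th * g (x + h *: F x u)].
Proof.
move=> eps0 h0 /andP[th0 th1] w0 w1 ws; elim: I => [|j I [g [D [gD g0 gw gs]]]].
  exists w, (fun _ _ => 0); split => //.
  - by move=> x; rewrite subrr normr0 mul0r.
  - by move=> x u Uu; rewrite !mul0r mulr0 subr0 add0r; exact: ws.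
have [D' gD'] := smoothed_cons eps0 j gD; exists (smooth eps j g), D'.
have [g1 _ _ _] := gD; split => //.
- by move=> x; exact: smooth_ge0.
- move=> x; rewrite [size _]/= -[(size I).+1%:R]natr1 mulrDl mul1r [leRHS]addrC.
  have -> : smooth eps j g x - w x = (smooth eps j g x - g x) + (g x - w x) by ring.
  by apply: (le_trans (ler_normD _ _)); apply: lerD => //; exact: smoothed_near.
- move=> x u Uu; rewrite [size _]/= -[(size I).+1%:R]natr1 mulrDl mul1r => dx.
  apply: smooth_step => // s /andP[s0 se].
  pose y := x + s *: (delta_mx 0 j : 'rV[R]_n).
  have ns : `|s *: (delta_mx 0 j : 'rV[R]_n)| <= eps.
    by rewrite (le_trans (norm_delta_mx _ _))// ger0_norm.
  have dy : dist X y <= r - (size I)%:R * eps.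
    have := dist_lip y x X0; rewrite ler_norml => /andP[_].
    by rewrite {2}/y addrAC subrr add0r; move: ns dx; lra.
  have hy := gs y u Uu dy.
  have Fy : `|F y u - F x u| <= L * eps.
    apply: (le_trans (FL _ _ Uu)); rewrite /y addrAC subrr add0r.
    by rewrite ler_wpM2l.
  have hg : g (y + h *: F y u) <= g (x + h *: F x u + s *: delta_mx 0 j) + h * (L * eps).
    have := g1 (y + h *: F y u) (x + h *: F x u + s *: delta_mx 0 j).
    have -> : y + h *: F y u - (x + h *: F x u + s *: delta_mx 0 j) = h *: (F y u - F x u).
      by rewrite /y; apply/rowP => k; rewrite !mxE; ring.
    rewrite normrZ gtr0_norm// ler_norml => /andP[_].
    by have := ler_wpM2l (ltW h0) Fy; lra.
  have := ler_wpM2l th0 hg.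
  have : th * (h * (L * eps)) <= h * (L * eps).
    by rewrite ler_piMl// !mulr_ge0// ltW.
  by rewrite mulrDl mul1r; move: hy; rewrite /y; lra.
Qed.

(** Expanding v(x + h F) to first order in the averaged one-step inequality and dividing by h gives
    the differential inequality. *)
Lemma test_function x0 (e B : R) : 0 < e -> L <= B ->
  (forall y : R -> 'rV[R]_n, ~ approx_path F U X L M e x0 y) ->
  exists2 c, 0 < c & forall eta, 0 < eta -> exists v : 'rV[R]_n -> R,
    [/\ C1 v, forall x, 0 <= v x,
      forall x u, X x -> U u -> B * v x <= dotp (grad v x) (F x u) + eta &
      forall x, `|x - x0| <= e -> c <= v x].
Proof.
move=> e0 LB nap; have B0 : 0 <= B by exact: le_trans LB.
have [c c0 [h1 h10 hw]] := value_function U0 L0 M0 FL FM X0 e0 LB nap.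
exists (c / 2); first by rewrite divr_gt0.
move=> eta eta0.
pose N : R := n%:R.
have N0 : 0 <= N by [].
have N1 : 0 < N + 1 by rewrite ltr_wpDl.
have NL : 0 < N * L + 1 by rewrite ltr_wpDl// mulr_ge0.
(* In turn: [X] stays where the averaged inequality holds, half of the lower bound [c] survives, and
   the averaging error takes half of eta. *)
pose eps := Num.min (e / 2 / (N + 1)) (Num.min (c / 2 / (N + 1)) (eta / 2 / (N
  * L + 1))).
have eps0 : 0 < eps by rewrite !lt_min !divr_gt0.
have [Ne Nc NLe] : [/\ N * eps <= e / 2, N * eps <= c / 2 & N * (L * eps) <= eta / 2].
  have : eps <= e / 2 / (N + 1) by rewrite ge_min lexx.
  have : eps <= c / 2 / (N + 1) by rewrite !ge_min lexx orbT.
  have : eps <= eta / 2 / (N * L + 1) by rewrite !ge_min lexx !orbT.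
  rewrite !ler_pdivlMr//; have := ltW eps0; move: (eps) => a *; split; lra.
pose C := N ^+ 2 * (2 / eps).
have C0 : 0 <= C by rewrite mulr_ge0 ?exprn_ge0// divr_ge0// ltW.
(* With h K <= 1 / 2 the Euler step is shorter than 1 and h B < 1; with h K <= eta / 2 the errors of
   order h^2, divided by h, take the other half of eta. *)
pose K := M + B + B * (N * M) + C * M ^+ 2.
have M2 : 0 <= M ^+ 2 by exact: exprn_ge0.
have BNM : 0 <= B * (N * M) by rewrite !mulr_ge0.
have CM2 : 0 <= C * M ^+ 2 := mulr_ge0 C0 M2.
have K0 : 0 <= K by rewrite /K; move: M0 B0 BNM CM2; lra.
have K1 : 0 < K + 1 by rewrite ltr_wpDl.
pose h := Num.min h1 (Num.min (2^-1 / (K + 1)) (eta / 2 / (K + 1))).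
have h0 : 0 < h by rewrite !lt_min h10 !divr_gt0.
have hh1 : h <= h1 by rewrite ge_min lexx.
have hK1 : h * K <= 2^-1.
  have : h <= 2^-1 / (K + 1) by rewrite !ge_min lexx orbT.
  by rewrite ler_pdivlMr//; move: h0; lra.
have hK2 : h * K <= eta / 2.
  have : h <= eta / 2 / (K + 1) by rewrite !ge_min lexx !orbT.
  by rewrite ler_pdivlMr//; move: h0; lra.
have hNM : 0 <= h * (B * (N * M)) := mulr_ge0 (ltW h0) BNM.
have hCM : 0 <= h * (C * M ^+ 2) := mulr_ge0 (ltW h0) CM2.
have hM : 0 <= h * M := mulr_ge0 (ltW h0) M0.
have hBB : 0 <= h * B := mulr_ge0 (ltW h0) B0.
have [w [w0 w1 ws wc]] := hw h h0 hh1.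
have th01 : 0 <= 1 - h * B <= 1 by apply/andP; split; move: hK1; rewrite /K;
  lra.
have [v [D [vD v0 vw vs]]] := smoothed_value (index_enum 'I_n) eps0 h0 th01 w0 w1 ws.
have sz : (size (index_enum 'I_n))%:R = N by rewrite /N -[n in RHS]card_ord cardE enumT.
rewrite sz in vw vs.
pose d x : 'rV[R]_n := \row_i D i x.
have [v1 D1 D2 _] := vD.
have quad x y : `|y| < 1 -> `|v (x + y) - v x - dotp (d x) y| <= C * `|y| ^+ 2.
  move=> y1; have := smoothed_quadratic eps0 vD x y1;
    rewrite sz -/C -row_sum_delta.
  suff -> : dotp (d x) y = \sum_i y 0 i * D i x by [].
  by apply: eq_bigr => i _; rewrite mxE mulrC.
have vdiff x := quadratic_differentiable C0 (quad x).
have gradE x : grad v x = d x by exact: (vdiff x).2.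
have n1d x : norm1 (d x) <= N.
  rewrite /norm1 (@le_trans _ _ (\sum_(i < n) 1))//.
    by apply: ler_sum => i _; rewrite mxE D2// mem_index_enum.
  by rewrite sumr_const card_ord.
exists v; split => //.
- split; first by move=> x; exact: (vdiff x).1.
  apply: (@lipschitz_rV_continuous _ _ _ _ (2 / eps)) => x y.
  rewrite !gradE; apply: norm_le_coord;
    first by rewrite mulr_ge0// divr_ge0// ltW.
  by move=> i; rewrite !mxE D1// mem_index_enum.
- move=> x u Xx Uu; rewrite gradE.
  have dx : dist X x <= e / 2 - N * eps by rewrite dist_mem0// subr_ge0.
  have := vs x u Uu dx.
  have Fu := FM x Uu.
  have hF : `|h *: F x u| <= h * M by rewrite normrZ gtr0_norm// ler_pM2l.
  have hF1 : `|h *: F x u| < 1.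
    by apply: (le_lt_trans hF); move: hK1 hBB hNM hCM; rewrite /K; lra.
  have := quad x _ hF1; rewrite dotpZr ler_norml => /andP[_ q1] q2.
  have q3 : C * `|h *: F x u| ^+ 2 <= C * (h * M) ^+ 2.
    by rewrite ler_wpM2l// lerXn2r ?nnegrE.
  have q4 : `|dotp (d x) (F x u)| <= N * M.
    by apply: (le_trans (dotp_le _ _)); apply: ler_pM => //; exact: norm1_ge0.
  move: q4; rewrite ler_norml => /andP[q4 _].
  have /andP[th0 th1] := th01.
  have q5 : v (x + h *: F x u) <= v x + h * dotp (d x) (F x u) + C * (h * M) ^+ 2.
    by move: q1 q3; lra.
  have q6 := ler_wpM2l th0 q5.
  have q7 : (1 - h * B) * (C * (h * M) ^+ 2) <= C * (h * M) ^+ 2.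
    by rewrite ler_piMl// mulr_ge0// exprn_ge0.
  have q8 : h * B * (- (N * M)) <= h * B * dotp (d x) (F x u) by rewrite ler_wpM2l.
  have q9 : h * (h * B * (- (N * M))) <= h * (h * B * dotp (d x) (F x u)).
    by rewrite ler_pM2l.
  have q10 := ler_wpM2l (ltW h0) NLe.
  have q11 := ler_wpM2l (ltW h0) hK2.
  have q12 : 0 <= h * (h * M) by rewrite mulr_ge0// ltW.
  have q13 : 0 <= h * (h * B) by rewrite mulr_ge0// ltW.
  rewrite -(ler_pM2l h0).
  move: (dotp (d x) (F x u)) q2 q6 q7 q9 q10 q11 q12 q13 => G; rewrite /K.
  move: (v x) (v (x + h *: F x u)) => a b; lra.
- move=> x xx0; have := wc x xx0; have := vw x; rewrite ler_norml => /andP[q _].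
  by move: q Nc; lra.
Qed.

End test_function.

(** * Polynomial vector fields *)

Section locally_lipschitz.
Variables (R : realType) (T : normedModType R).
Implicit Types (g : T -> R) (x y : T).

(** This class is closed under sums and products, unlike globally Lipschitz functions, and so
    contains the polynomials. *)
Definition lipschitz_on_balls g := forall r, exists2 C, 0 <= C &
  forall x y, `|x| <= r -> `|y| <= r -> `|g x - g y| <= C * `|x - y|.

Lemma lipschitz_on_balls_bounded g r : lipschitz_on_balls g ->
  exists2 C, 0 <= C & forall x, `|x| <= r -> `|g x| <= C.
Proof.
move=> /(_ `|r|)[C C0 gC]; exists (`|g 0| + C * `|r|).
  by rewrite addr_ge0// mulr_ge0.
move=> x xr; have xr' : `|x| <= `|r| := le_trans xr (ler_norm _).
have := gC x 0 xr'; rewrite normr0 subr0 => /(_ (normr_ge0 _)) h.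
have := ler_normD (g x - g 0) (g 0); rewrite subrK.
have := ler_wpM2l C0 xr'; move: h; lra.
Qed.

Lemma lipschitz_on_balls_continuous g : lipschitz_on_balls g -> continuous g.
Proof.
move=> lg x A /nbhs_ballP[e /= e0 eA].
have [C C0 gC] := lg (`|x| + 1).
have C1 : 0 < C + 1 by rewrite ltr_wpDl.
apply/nbhs_ballP; exists (Num.min 1 (e / (C + 1))) => /=.
  by rewrite lt_min ltr01 divr_gt0.
move=> y; rewrite -ball_normE/= lt_min => /andP[xy1 xy2]; apply: eA.
rewrite /ball/=; apply: (le_lt_trans (gC x y _ _)).
- by rewrite lerDl.
- by have := ler_normD x (y - x); rewrite addrC subrK distrC; move: xy1; lra.
move: xy2; rewrite ltr_pdivlMr// mulrC; apply: le_lt_trans.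
by rewrite ler_wpM2r// lerDl.
Qed.

Lemma lipschitz_on_balls_cst c : lipschitz_on_balls (fun=> c).
Proof. by move=> r; exists 0 => // x y _ _; rewrite subrr normr0 mul0r. Qed.

Lemma lipschitz_on_ballsD g h : lipschitz_on_balls g -> lipschitz_on_balls h ->
  lipschitz_on_balls (fun x => g x + h x).
Proof.
move=> lg lh r; have [C C0 gC] := lg r; have [D D0 hD] := lh r.
exists (C + D); first exact: addr_ge0.
move=> x y xr yr; rewrite opprD addrACA mulrDl (le_trans (ler_normD _ _))//.
by rewrite lerD// ?gC ?hD.
Qed.

Lemma lipschitz_on_ballsM g h : lipschitz_on_balls g -> lipschitz_on_balls h ->
  lipschitz_on_balls (fun x => g x * h x).
Proof.
move=> lg lh r; have [C C0 gC] := lg r; have [D D0 hD] := lh r.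
have [A A0 gA] := lipschitz_on_balls_bounded r lg.
have [B B0 hB] := lipschitz_on_balls_bounded r lh.
exists (A * D + B * C); first by rewrite addr_ge0// mulr_ge0.
move=> x y xr yr.
have -> : g x * h x - g y * h y = g x * (h x - h y) + h y * (g x - g y) by ring.
rewrite mulrDl (le_trans (ler_normD _ _))// !normrM -!mulrA.
by rewrite lerD// ler_pM// ?gA ?hB ?gC ?hD.
Qed.

Lemma lipschitz_on_balls_sum (I : Type) (s : seq I) (G : I -> T -> R) :
  (forall i, lipschitz_on_balls (G i)) ->
  lipschitz_on_balls (fun x => \sum_(i <- s) G i x).
Proof.
move=> lG; elim: s => [|i s IH].
  by under eq_fun do rewrite big_nil; exact: lipschitz_on_balls_cst.
by under eq_fun do rewrite big_cons; exact: lipschitz_on_ballsD.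
Qed.

Lemma lipschitz_on_balls_prod (I : Type) (s : seq I) (G : I -> T -> R) :
  (forall i, lipschitz_on_balls (G i)) ->
  lipschitz_on_balls (fun x => \prod_(i <- s) G i x).
Proof.
move=> lG; elim: s => [|i s IH].
  by under eq_fun do rewrite big_nil; exact: lipschitz_on_balls_cst.
by under eq_fun do rewrite big_cons; exact: lipschitz_on_ballsM.
Qed.

Lemma lipschitz_on_balls_meval k (c : 'I_k -> T -> R) (p : mpoly.mpoly k R) :
  (forall j, lipschitz_on_balls (c j)) ->
  lipschitz_on_balls (fun x => mpoly.meval (fun j => c j x) p).
Proof.
move=> lc; under eq_fun do rewrite mpoly.mevalE.
apply: lipschitz_on_balls_sum => a; apply: lipschitz_on_ballsM.
  exact: lipschitz_on_balls_cst.
apply: lipschitz_on_balls_prod => j;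
  elim: (mpoly.fun_of_multinom a j) => [|d IH].
  by under eq_fun do rewrite expr0; exact: lipschitz_on_balls_cst.
by under eq_fun do rewrite exprS; exact: lipschitz_on_ballsM.
Qed.

End locally_lipschitz.

Section polynomial_vector_field.
Variables (R : realType) (n m : nat) (f : 'I_n -> mpoly.mpoly (n + m) R).
Notation T := ('rV[R]_n * 'rV[R]_m)%type.

Lemma norm_fst (z : T) : `|z.1| <= `|z|.
Proof. by rewrite prod_normE le_max lexx. Qed.

Lemma norm_snd (z : T) : `|z.2| <= `|z|.
Proof. by rewrite prod_normE le_max lexx orbT. Qed.

Lemma vfield_coord_lipschitz i :
  lipschitz_on_balls (fun z : T => vfield f z.1 z.2 0 i).
Proof.
under eq_fun do rewrite mxE.
apply: (@lipschitz_on_balls_meval _ _ _ (fun j (z : T) => row_mx z.1 z.2 0 j)) => j r.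
exists 1 => // x y _ _; rewrite mul1r -[j]splitK.
case: (fintype.split j) => k /=.
  rewrite !row_mxEl; apply: le_trans (norm_fst (x - y)).
  by have := coord_le_norm (x.1 - y.1) k; rewrite !mxE.
rewrite !row_mxEr; apply: le_trans (norm_snd (x - y)).
by have := coord_le_norm (x.2 - y.2) k; rewrite !mxE.
Qed.

Lemma vfield_continuous (x : 'rV[R]_n) : continuous (vfield f x).
Proof.
move=> u A /nbhs_ballP[e /= e0 eA]; pose r := `|(x, u) : T| + 1.
have /choice[C hC] : forall i, exists C, 0 <= C /\ forall z z' : T, `|z| <= r ->
    `|z'| <= r -> `|vfield f z.1 z.2 0 i - vfield f z'.1 z'.2 0 i| <= C * `|z - z'|.
  by move=> i; have [C C0 h] := vfield_coord_lipschitz i r; exists C.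
pose D := \sum_i C i.
have D0 : 0 <= D by apply: sumr_ge0 => i _; exact: (hC i).1.
have D1 : 0 < D + 1 by rewrite ltr_wpDl.
apply/nbhs_ballP; exists (Num.min 1 (e / (D + 1))) => /=.
  by rewrite lt_min ltr01 divr_gt0.
move=> u'; rewrite -ball_normE/= lt_min => /andP[u1 u2]; apply: eA.
rewrite -ball_normE/=; move: u2; rewrite ltr_pdivlMr// mulrC;
  apply: le_lt_trans.
have dxu : `|(x, u) - (x, u') : T| = `|u - u'|.
  by rewrite prod_normE/= subrr normr0; apply/max_idPr.
have x'r : `|(x, u') : T| <= r.
  have := ler_normD ((x, u') - (x, u) : T) (x, u).
  rewrite subrK distrC dxu /r; move: u1; lra.
apply: norm_le_coord => [|i]; first by rewrite mulr_ge0// ltW.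
have xr : `|(x, u) : T| <= r by rewrite lerDl.
have := (hC i).2 (x, u) (x, u') xr x'r; rewrite /= dxu => h.
rewrite mxE [X in _ + X]mxE (le_trans h)// ler_wpM2r//.
rewrite (@le_trans _ _ D) ?lerDl// /D (bigD1 i)//= lerDl sumr_ge0// => j _.
exact: (hC j).1.
Qed.

Definition clamp (r : R) (x : 'rV[R]_n) : 'rV[R]_n :=
  \row_i Num.max (- r) (Num.min r (x 0 i)).

Lemma clamp_norm r x : 0 <= r -> `|clamp r x| <= r.
Proof.
move=> r0; apply: norm_le_coord => // i; rewrite mxE ler_norml le_max lexx/=.
by rewrite ge_max ge_min lexx/=; lra.
Qed.

Lemma clamp_id r x : `|x| <= r -> clamp r x = x.
Proof.
move=> xr; apply/rowP => i; rewrite mxE.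
have := le_trans (coord_le_norm x i) xr; rewrite ler_norml => /andP[h1 h2].
by rewrite (min_idPr h2) (max_idPr h1).
Qed.

Lemma clamp_lip r x y : 0 <= r -> `|clamp r x - clamp r y| <= `|x - y|.
Proof.
move=> r0; apply: norm_le_coord => // i; rewrite !mxE.
have := coord_le_norm (x - y) i; rewrite !mxE; apply: le_trans.
move: (x 0 i) (y 0 i) => a b; wlog ba : a b / b <= a => [h|].
  case/orP: (le_total b a) => [ba|ab]; first exact: h.
  by rewrite distrC [leRHS]distrC; exact: h.
rewrite [leRHS]ger0_norm ?subr_ge0//.
have mono : Num.max (- r) (Num.min r b) <= Num.max (- r) (Num.min r a).
  by rewrite ge_max !le_max lexx/= le_min !ge_min lexx ba/= !orbT.
rewrite ger0_norm ?subr_ge0// lerBlDr.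
have le1 : Num.min r b <= Num.max (- r) (Num.min r b) by rewrite le_max lexx orbT.
have le2 : - r <= Num.max (- r) (Num.min r b) by rewrite le_max lexx.
move: (Num.max (- r) (Num.min r b)) le1 le2 => q le1 le2.
rewrite ge_max; apply/andP; split; first lra.
rewrite ge_min; case/orP: (le_total r b) => [rb|br]; apply/orP; [left|right].
  by rewrite (min_idPl rb) in le1; lra.
by rewrite (min_idPr br) in le1; lra.
Qed.

(* Truncating the state makes the polynomial field bounded and globally
   Lipschitz without changing it on the relevant sets. *)
Lemma truncated_vfield (X : set 'rV[R]_n) (U : set 'rV[R]_m) :
  bounded_set X -> bounded_set U ->
  exists (F : 'rV[R]_n -> 'rV[R]_m -> 'rV[R]_n) L M, [/\ 0 <= L, 0 <= M,
    forall x y u, U u -> `|F x u - F y u| <= L * `|x - y|,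
    forall x u, U u -> `|F x u| <= M &
    forall x u, X x -> U u -> F x u = vfield f x u].
Proof.
move=> [rX [_ hX]] [rU [_ hU]]; pose r := `|rX| + `|rU| + 1.
have r0 : 0 <= r by rewrite !addr_ge0.
have Xr x : X x -> `|x| <= r.
  apply: hX; rewrite /r; have := ler_norm rX; have := normr_ge0 rU; lra.
have Ur u : U u -> `|u| <= r.
  apply: hU; rewrite /r; have := ler_norm rU; have := normr_ge0 rX; lra.
have zr x u : U u -> `|(clamp r x, u) : T| <= r.
  by move=> Uu; rewrite prod_normE ge_max clamp_norm//= Ur.
have /choice[C hC] : forall i, exists C, 0 <= C /\ forall z z' : T, `|z| <= r ->
    `|z'| <= r -> `|vfield f z.1 z.2 0 i - vfield f z'.1 z'.2 0 i| <= C * `|z - z'|.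
  by move=> i; have [C C0 h] := vfield_coord_lipschitz i r; exists C.
have /choice[D hD] : forall i, exists D, 0 <= D /\ forall z : T, `|z| <= r ->
    `|vfield f z.1 z.2 0 i| <= D.
  by move=> i; have [D D0 h] := lipschitz_on_balls_bounded r
    (vfield_coord_lipschitz i); exists D.
have le_sum (G : 'I_n -> R) i : (forall j, 0 <= G j) -> G i <= \sum_j G j.
  by move=> G0; rewrite (bigD1 i)//= lerDl sumr_ge0.
exists (fun x u => vfield f (clamp r x) u), (\sum_i C i), (\sum_i D i); split.
- by apply: sumr_ge0 => i _; exact: (hC i).1.
- by apply: sumr_ge0 => i _; exact: (hD i).1.
- move=> x y u Uu; apply: norm_le_coord.
    by rewrite mulr_ge0// sumr_ge0// => i _; exact: (hC i).1.
  move=> i; have := (hC i).2 (clamp r x, u) (clamp r y, u) (zr _ _ Uu) (zr _ _ Uu).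
  rewrite /= => h; rewrite mxE [X in _ + X]mxE; apply: (le_trans h).
  apply: ler_pM => //; first exact: (hC i).1.
    by apply: le_sum => j; exact: (hC j).1.
  rewrite prod_normE/= subrr normr0 ge_max normr_ge0 andbT; exact: clamp_lip.
- move=> x u Uu; apply: norm_le_coord.
    by apply: sumr_ge0 => i _; exact: (hD i).1.
  move=> i; apply: (le_trans ((hD i).2 (clamp r x, u) (zr _ _ Uu))).
  by apply: le_sum => j; exact: (hD j).1.
- by move=> x u Xx Uu; rewrite clamp_id// Xr.
Qed.

End polynomial_vector_field.

(** * The linear program *)

Section integrals.
Context (d : measure_display) (T : measurableType d) (R : realType).
Variable mu : {measure set T -> \bar R}.
Implicit Types (D E : set T) (g : T -> R).

Lemma Rintegral_subset D E g : measurable D -> measurable E -> D `<=` E ->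
  mu.-integrable E (EFin \o g) ->
  \int[mu]_(x in E) g x = \int[mu]_(x in D) g x + \int[mu]_(x in E `\` D) g x.
Proof.
move=> mD mE DE ig; rewrite -{1}(setDUK DE) Rintegral_setU//.
- exact: measurableD.
- by rewrite setDUK.
- by apply/disj_setPS => x [Dx []].
Qed.

Lemma Rintegral_ge_cst D E g c : measurable D -> measurable E -> D `<=` E ->
  (mu E < +oo)%E -> mu.-integrable E (EFin \o g) ->
  (forall x, E x -> 0 <= g x) -> (forall x, D x -> c <= g x) ->
  c * fine (mu D) <= \int[mu]_(x in E) g x.
Proof.
move=> mD mE DE Eoo ig g0 cg; rewrite (Rintegral_subset mD mE DE ig).
have h1 : 0 <= \int[mu]_(x in E `\` D) g x by apply: Rintegral_ge0 => x [/g0].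
have Doo : (mu D < +oo)%E.
  by apply: le_lt_trans Eoo; apply: le_measure; rewrite ?inE.
have h2 : c * fine (mu D) <= \int[mu]_(x in D) g x.
  rewrite -Rintegral_cst//; apply: le_Rintegral => //.
    apply: measurable_bounded_integrable => //.
    exists `|c|; split; first exact: num_real.
    by move=> r cr x _ /=; exact: ltW.
  exact: integrableS ig.
lra.
Qed.

Lemma Rintegral_le_measure D E g : measurable D -> measurable E -> D `<=` E ->
  (mu E < +oo)%E -> mu.-integrable E (EFin \o g) ->
  (forall x, D x -> g x <= 1) -> (forall x, E x -> ~ D x -> g x = 0) ->
  \int[mu]_(x in E) g x <= fine (mu D).
Proof.
move=> mD mE DE Eoo ig g1 g0; rewrite (Rintegral_subset mD mE DE ig).
have -> : \int[mu]_(x in E `\` D) g x = 0.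
  transitivity (\int[mu]_(x in E `\` D) (0 : R)).
    by apply: eq_Rintegral => x /set_mem[Ex Dx]; rewrite g0.
  by rewrite Rintegral_cst ?mul0r//; exact: measurableD.
have Doo : (mu D < +oo)%E.
  by apply: le_lt_trans Eoo; apply: le_measure; rewrite ?inE.
rewrite addr0 -[leRHS]mul1r -Rintegral_cst//; apply: le_Rintegral => //.
  exact: integrableS ig.
apply: measurable_bounded_integrable => //.
by exists 1; split; [exact: num_real|move=> r r1 x _ /=; rewrite normr1 ltW].
Qed.

Lemma Rintegral_mrestr D E g (mD : measurable D) : measurable E -> D `<=` E ->
  (mrestr mu mD).-integrable E (EFin \o g) ->
  \int[mrestr mu mD]_(x in E) g x = \int[mu]_(x in D) g x.
Proof.
move=> mE DE ig; rewrite /Rintegral; congr fine.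
have N0 : mrestr mu mD (E `\` D) = 0%E.
  by rewrite /mrestr setDKI measure0.
rewrite (negligible_integral (measurableD mE mD) mE ig N0).
have -> : E `\` (E `\` D) = D.
  by rewrite setDD; apply/setIidPr.
apply: eq_measure_integral => A mA AD.
by rewrite /mrestr; congr (mu _); apply/setIidPl.
Qed.

End integrals.

Lemma lebesgue_rV_bounded (R : realType) n (X : set 'rV[R]_n) :
  measurable (X : set (borel 'rV[R]_n)) -> bounded_set X ->
  (@lebesgue_rV R n X < +oo)%E.
Proof.
move=> mX [r [_ /(_ (`|r| + 1))]].
have r1 : r < `|r| + 1 by rewrite (le_lt_trans (ler_norm _))// ltrDl.
move=> /(_ r1); set b := `|r| + 1 => Xb.
have b0 : 0 <= b by rewrite addr_ge0.
pose lo : 'rV[R]_n := const_mx (- b); pose hi : 'rV[R]_n := const_mx b.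
have lohi i : lo 0 i <= hi 0 i by rewrite !mxE; lra.
pose box := [set x : 'rV[R]_n | forall i, x 0 i \in `[lo 0 i, hi 0 i]].
have mbox : measurable (box : set (borel 'rV[R]_n)).
  apply: closed_borel.
  have -> : box = \bigcap_(i in [set: 'I_n]) ((fun x : 'rV[R]_n => x 0 i) @^-1`
      `[lo 0 i, hi 0 i]%classic).
    by apply/seteqP; split => x hx i; [move=> _; exact: hx|exact: hx].
  apply: closed_bigI => i _.
  have := @coord_continuous R 1 n 0 i.
  by move/continuous_closedP; apply; exact: itv_closed.
apply: (@le_lt_trans _ _ (lebesgue_rV box)).
  apply: le_measure; rewrite ?inE// => x Xx i; rewrite in_itv/= !mxE.
  by rewrite -ler_norml (le_trans (coord_le_norm _ _))// Xb.
by rewrite lebesgue_rV_box// ltry.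
Qed.

Section C1_functions.
Variables (R : realType) (n : nat).
Implicit Types (v : 'rV[R]_n -> R).

Lemma C1_continuous v : C1 v -> continuous v.
Proof. by move=> [dv _] x; exact: differentiable_continuous. Qed.

Lemma C1_cst (c : R) : C1 (fun _ : 'rV[R]_n => c) /\
  forall x, grad (fun _ : 'rV[R]_n => c) x = 0.
Proof.
have g0 x : grad (fun _ : 'rV[R]_n => c) x = 0.
  by apply/rowP => i; rewrite mxE [RHS]mxE; exact: derive_cst.
split => //; split; first by move=> x; exact: differentiable_cst.
have -> : grad (fun _ : 'rV[R]_n => c) = cst 0 by apply/funext => x; rewrite g0.
exact: cst_continuous.
Qed.

Lemma C1_lin (a : R) v v' : C1 v -> C1 v' -> C1 (fun x => a * v x + v' x) /\
  forall x, grad (fun x => a * v x + v' x) x = a *: grad v x + grad v' x.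
Proof.
move=> [dv cv] [dv' cv'].
have E : (fun x => a * v x + v' x) = (a \*: v) + v' by [].
have g x : grad (fun x => a * v x + v' x) x = a *: grad v x + grad v' x.
  apply/rowP => i; rewrite !mxE E deriveD ?deriveZ//; try exact: diff_derivable.
  by apply: derivableZ; exact: diff_derivable.
split; [split|exact: g].
  by move=> x; rewrite E; apply: differentiableD => //; exact: differentiableZ.
have -> : grad (fun x => a * v x + v' x) = (fun x => a *: grad v x + grad v' x).
  by apply/funext => x; rewrite g.
move=> x; apply: (@continuousD _ _ _ (fun y => a *: grad v y) (grad v') x);
  last exact: cv'.
apply: (@continuous_comp _ _ _ (grad v) (fun w => a *: w) x); first exact: cv.
exact: scaler_continuous.
Qed.

End C1_functions.

(** * Feasible triples *)

Section control_problem.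
Variables (R : realType) (n m : nat) (f : 'I_n -> mpoly.mpoly (n + m) R).
Variables (X : set 'rV[R]_n) (U : set 'rV[R]_m) (beta : R).
Hypotheses (cX : compact X) (cU : compact U) (beta_gt0 : 0 < beta).
Notation T := ('rV[R]_n * 'rV[R]_m)%type.
Notation S := (MCI f X U).
Notation lambda := (@lebesgue_rV R n).

Let kX : closed X. Proof. exact: compact_closed. Qed.
Let mX : measurable (X : set (borel 'rV[R]_n)). Proof. exact: closed_borel. Qed.
Let cK : compact (X `*` U). Proof. exact: compact_setX. Qed.
Let kK : closed (X `*` U). Proof. exact: compact_closed. Qed.
Let mK : measurable (X `*` U : set (borel T)). Proof. exact: closed_borel. Qed.
Let bX : bounded_set X. Proof. exact: compact_bounded. Qed.
Let lX : (lambda X < +oo)%E. Proof. exact: lebesgue_rV_bounded. Qed.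

Let MCI_sub : S `<=` X. Proof. by move=> x []. Qed.

Let vfield_compact x : compact [set vfield f x u | u in U].
Proof.
apply: continuous_compact => //; apply: continuous_subspaceT;
  exact: vfield_continuous.
Qed.

Definition generator (v : 'rV[R]_n -> R) (z : T) : R :=
  beta * v z.1 - dotp (grad v z.1) (vfield f z.1 z.2).

Let fst_c (v : 'rV[R]_n -> R) : continuous v -> continuous (fun z : T => v z.1).
Proof. by move=> cv z; apply: continuous_comp; [exact: cvg_fst|exact: cv]. Qed.

Let dot_c v : C1 v -> continuous (fun z : T => dotp (grad v z.1) (vfield f z.1 z.2)).
Proof.
move=> [_ cv]; apply: continuous_sum => i z; apply: cvgM; last first.
  exact: lipschitz_on_balls_continuous (vfield_coord_lipschitz f i) z.
apply: (@continuous_comp _ _ _ fst (fun x => grad v x 0 i));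
  first exact: cvg_fst.
apply: (@continuous_comp _ _ _ (grad v) (fun w : 'rV[R]_n => w 0 i));
  first exact: cv.
exact: coord_continuous.
Qed.

Let generator_c v : C1 v -> continuous (generator v).
Proof.
move=> C1v z; apply: cvgB; last exact: dot_c.
by apply: cvgM; [exact: cvg_cst|exact: (fst_c (C1_continuous C1v))].
Qed.

Lemma generator_ge0 v x0 : C1 v -> S x0 ->
  (forall z, (X `*` U) z -> 0 <= generator v z) -> 0 <= v x0.
Proof.
move=> C1v [_ [x [<- trx xX]]] h.
apply: (viable_C1_ge0 trx xX bX beta_gt0 C1v) => z u Xz Uu.
by rewrite -subr_ge0; apply: (h (z, u)).
Qed.

(** Without controls the condition on the generator is vacuous, so any point of the set would make
    the constant -1 nonnegative. *)
Lemma MCI_set0 : U = set0 -> S = set0.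
Proof.
move=> U0; apply/seteqP; split => // x Sx.
have [C1v _] := C1_cst n (-1 : R).
have : 0 <= (-1 : R) by apply: (generator_ge0 C1v Sx) => z [_]; rewrite U0.
by rewrite ler0N1.
Qed.

Lemma MCI_is_closed : closed S.
Proof.
have [U0|/set0P U0] := eqVneq U set0; first by rewrite MCI_set0//;
  exact: closed0.
have [X0|/set0P X0] := eqVneq X set0.
  have -> : S = set0 by apply/seteqP; split => // x /MCI_sub; rewrite X0.
  exact: closed0.
have [F [L [M [L0 M0 FL FM FE]]]] := truncated_vfield f bX (compact_bounded cU).
exact: (MCI_closed U0 L0 M0 FL FM FE).
Qed.

Let Rintegral_generator (mu : {measure set (borel T) -> \bar R}) v :
  fin_num_fun mu -> C1 v ->
  \int[mu]_(z in X `*` U) generator v z =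
  beta * \int[mu]_(z in X `*` U) v z.1 -
  \int[mu]_(z in X `*` U) dotp (grad v z.1) (vfield f z.1 z.2).
Proof.
move=> fmu C1v.
have muoo : (mu (X `*` U) < +oo)%E by rewrite ltey_eq fmu.
have ig (g : T -> R) : continuous g ->
    mu.-integrable (X `*` U : set (borel T)) (EFin \o g).
  move=> cg; apply: (within_continuous_integrable muoo) => //.
  exact: continuous_subspaceT.
have iv := ig _ (fst_c (C1_continuous C1v)).
rewrite RintegralB//; last 2 first.
- apply: ig => z; apply: cvgM; first exact: cvg_cst.
  exact: (fst_c (C1_continuous C1v)).
- exact/ig/dot_c.
by rewrite RintegralZl.
Qed.

Lemma feasible_generator mu mu0 mu0' v : feasible f X U beta mu mu0 mu0' -> C1 v ->
  \int[mu]_(z in X `*` U) generator v z = \int[mu0]_(x in X) v x.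
Proof.
move=> [[fmu _] _ _ + _] C1v => /(_ v C1v) E.
by rewrite Rintegral_generator// E addrK.
Qed.

(** With v >= c on the ball [B] and generator at most eta, c times the mu0-mass of [B] in [X] is at
    most the integral of v, that is of its generator against mu, hence at most eta times the mass of
    mu. *)
Lemma feasible_null mu mu0 mu0' x0 : feasible f X U beta mu mu0 mu0' -> X x0 -> ~ S x0 ->
  exists2 V : set 'rV[R]_n, open V & V x0 /\ mu0 (V `&` X) = 0%E.
Proof.
move=> fe Xx0 nSx0; have X0 : X !=set0 by exists x0.
have [[fmu _] [fmu0 _] _ _ _] := fe.
have muoo : (mu (X `*` U) < +oo)%E by rewrite ltey_eq fmu.
have mu0oo : (mu0 X < +oo)%E by rewrite ltey_eq fmu0.
have ig0 (g : 'rV[R]_n -> R) : continuous g -> mu0.-integrable (X : set (borel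
  _)) (EFin \o g).
  by move=> cg; apply: (within_continuous_integrable mu0oo) => //;
    exact: continuous_subspaceT.
(* What is needed of the test functions is isolated here, so that an empty [U], for which v = 1
   serves, is treated together with the general case. *)
pose P := [set e : R | 0 < e /\ exists2 c : R, 0 < c & forall eta, 0 < eta ->
  exists v : 'rV[R]_n -> R, [/\ C1 v, forall x, 0 <= v x,
    forall z, (X `*` U) z -> generator v z <= eta &
    forall x, `|x - x0| <= e -> c <= v x]].
have [e [e0 [c c0 hv]]] : exists e, P e.
  have [U0|/set0P U0] := eqVneq U set0.
    exists 1; split => //; exists 1 => // eta eta0; exists (fun=> 1);
      split => //.
      by have [] := C1_cst n (1 : R).
    by move=> z [_]; rewrite U0.
  have [F [L [M [L0 M0 FL FM FE]]]] := truncated_vfield f bX (compact_bounded cU).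
  have [e [e0 nap]] : exists e, 0 < e /\
      forall y : R -> 'rV[R]_n, ~ approx_path F U X L M e x0 y.
    apply: contrapT => h; apply: nSx0.
    apply: (approx_path_MCI U0 L0 M0 FL FM FE) => // e e0.
    apply: contrapT => /forallNP ne; apply: h; by exists e.
  (* The rate L + beta is admissible for [test_function]; returning to beta drops the nonnegative
     term L v. *)
  have LB : L <= L + beta by rewrite lerDl ltW.
  have [c c0 hc] := test_function U0 L0 M0 FL FM X0 e0 LB nap.
  exists e; split => //; exists c => // eta eta0;
    have [v [C1v v0 vg vc]] := hc eta eta0.
  exists v; split => // -[x u] [/= Xx Uu]; rewrite /generator/=.
  have := vg x u Xx Uu; rewrite FE//.
  have := mulr_ge0 L0 (v0 x); lra.
pose B := [set x : 'rV[R]_n | `|x - x0| <= e].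
have kB : closed B.
  have : continuous (fun x : 'rV[R]_n => `|x - x0|).
    apply: (@lipschitz1_continuous _ _ _ 1) => x y; rewrite mul1r.
    by rewrite (le_trans (ler_dist_dist _ _))// opprB addrA subrK.
  by move/continuous_closedP => /(_ [set r | r <= e]); apply; exact: closed_le.
have mBX : measurable (B `&` X : set (borel 'rV[R]_n)).
  by apply: measurableI => //; exact: closed_borel.
have BX0 : mu0 (B `&` X) = 0%E.
  rewrite -[LHS]fineK ?fmu0//; congr EFin; apply: le_anti.
  rewrite fine_ge0 ?andbT//.
  rewrite -(ler_pM2l c0) mulr0.
  apply: (@ler_addscaleP _ _ _ (fine (mu (X `*` U)))).
    by rewrite fine_ge0.
  move=> eta eta0 _; have [v [C1v v0 vg vc]] := hv eta eta0.
  rewrite add0r.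
  apply: (@le_trans _ _ (\int[mu0]_(x in X) v x)).
    apply: Rintegral_ge_cst => //; [exact: ig0 (C1_continuous C1v)|].
    by move=> x [/vc].
  rewrite -(feasible_generator fe C1v) mulrC -Rintegral_cst//.
  apply: le_Rintegral => //.
    by apply: (within_continuous_integrable muoo) => //;
      apply: continuous_subspaceT; exact: generator_c.
  apply: (within_continuous_integrable muoo) => //; apply: continuous_subspaceT.
  by move=> z; exact: cvg_cst.
exists (ball x0 e); first exact: ball_open.
split; first exact: ballxx.
apply/eqP; rewrite eq_le measure_ge0 andbT -BX0; apply: le_measure;
  rewrite ?inE//.
  by apply: measurableI => //; apply: open_borel; exact: ball_open.
by move=> x []; rewrite -ball_normE/= distrC => /ltW.
Qed.

Lemma compact_null (mu : {measure set (borel 'rV[R]_n) -> \bar R}) (Q : set 'rV[R]_n) :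
  compact Q -> Q `<=` X ->
  (forall x, Q x -> exists2 V : set 'rV[R]_n, open V & V x /\ mu (V `&` X) = 0%E) ->
  mu Q = 0%E.
Proof.
move=> cQ QX hQ.
have : cover_compact Q by rewrite -compact_cover.
have /choice[V hV] : forall x, exists V : set 'rV[R]_n, open V /\ (Q x -> V x)
  /\ mu (V `&` X) = 0%E.
  move=> x; have [Qx|nQx] := pselect (Q x).
    by have [V oV [Vx V0]] := hQ x Qx; exists V.
  by exists set0; split; [exact: open0|split => //; rewrite set0I measure0].
move=> /(_ 'rV[R]_n setT V) [].
- by move=> x _; exact: (hV x).1.
- by move=> x Qx; exists x => //; exact: (hV x).2.1.
move=> D _ QD.
have mV x : measurable (V x `&` X : set (borel 'rV[R]_n)).
  by apply: measurableI => //; apply: open_borel; exact: (hV x).1.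
apply/eqP; rewrite eq_le measure_ge0 andbT.
have mU : measurable (\big[setU/set0]_(x <- D) (V x `&` X) : set (borel 'rV[R]_n)).
  by apply: bigsetU_measurable.
apply: (@le_trans _ _ (mu (\big[setU/set0]_(x <- D) (V x `&` X)))).
  apply: le_measure; rewrite ?inE//; first by apply: closed_borel;
    exact: compact_closed.
  move=> x Qx; have [y /= yD Vyx] := QD x Qx.
  by rewrite -bigcup_seq; exists y => //=; split => //; exact: QX.
have : forall s : seq 'rV[R]_n, measurable (\big[setU/set0]_(x <- s) (V x `&`
  X) : set (borel 'rV[R]_n)) /\
    mu (\big[setU/set0]_(x <- s) (V x `&` X)) = 0%E.
  elim => [|x s [ms s0]]; first by rewrite big_nil measure0.
  rewrite big_cons; split; first exact: measurableU.
  apply/eqP; rewrite eq_le measure_ge0 andbT.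
  rewrite -[leRHS]adde0 -{1}(hV x).2.2 -s0; exact: measureU2.
by move=> /(_ D)[_ ->].
Qed.

Let mS : measurable (S : set (borel 'rV[R]_n)).
Proof. by apply: closed_borel; exact: MCI_is_closed. Qed.

(** Local nullity passes to compact sets, and the complement in [X] of the closed set [S] is the
    countable union of the compact sets left by removing shrinking open neighbourhoods of [S]. *)
Lemma feasible_outside_null mu mu0 mu0' : feasible f X U beta mu mu0 mu0' ->
  mu0 (X `\` S) = 0%E.
Proof.
move=> fe; pose V k := \bigcup_(z in S) ball z (k.+1%:R^-1 : R).
have oV k : open (V k) by apply: bigcup_open => z _; exact: ball_open.
pose Q k := X `\` V k.
have kQ k : closed (Q k) by rewrite /Q setDE; apply: closedI => //;
  exact: open_closedC.
have cQ k : compact (Q k).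
  by rewrite /Q setDE; apply: compact_closedI => //; exact: open_closedC.
have E : X `\` S = \bigcup_k Q k.
  apply/seteqP; split => [x [Xx nSx]|x [k _ [Xx nV]]]; last first.
    by split => // Sx; apply: nV; exists x => //; exact: ballxx.
  have : nbhs x (~` S).
    by apply: open_nbhs_nbhs; split => //; exact: closed_openC MCI_is_closed.
  move=> /nbhs_ballP[e /= e0 eS].
  have [k _ /(_ _ (leqnn k)) ke] := near_infty_natSinv_lt (PosNum e0).
  exists k => //; split => // -[z Sz zx]; apply: (eS z) => //.
  by apply: (le_ball (ltW ke)); exact: ball_sym.
have Q0 k : mu0 (Q k) = 0%E.
  apply: compact_null => //; first by move=> x [].
  move=> x [Xx nVx]; apply: feasible_null fe Xx _ => Sx; apply: nVx.
  by exists x => //; exact: ballxx.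
have mQ k : measurable (Q k : set (borel 'rV[R]_n)) by exact: closed_borel.
apply/eqP; rewrite eq_le measure_ge0 andbT E.
apply: (le_trans (@measure_sigma_subadditive _ _ _ mu0 _ Q mQ _ _)) => //.
  exact: bigcup_measurable.
by rewrite eseries0// => k _ _; exact: Q0.
Qed.

(** The constraint compares measures through continuous functions only: [w k] equals 1 on [S] and
    vanishes on [X] off [A k], and the sets [A k] decrease to [S] because [S] is closed. *)
Lemma feasible_le_lebesgue mu mu0 mu0' : feasible f X U beta mu mu0 mu0' ->
  (mu0 S <= lambda S)%E.
Proof.
move=> fe; have [_ [fmu0 _] [fmu0' _] _ hw] := fe.
have mu0oo : (mu0 X < +oo)%E by rewrite ltey_eq fmu0.
have [S0|/set0P S0] := eqVneq S set0; first by rewrite S0 !measure0.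
pose w k x : R := Num.max 0 (1 - k.+1%:R * dist S x).
have cw k : continuous (w k).
  have mono (a b c : R) : 0 <= c -> a <= b + c -> Num.max 0 a <= Num.max 0 b + c.
    move=> c0 abc; rewrite ge_max addr_ge0 ?le_max ?lexx//=.
    by rewrite (le_trans abc)// lerD2r le_max lexx orbT.
  have wle x y : w k x <= w k y + k.+1%:R * `|x - y|.
    apply: mono; first by rewrite mulr_ge0.
    have := dist_lip x y S0; rewrite ler_norml => /andP[h _].
    have k0 : 0 <= k.+1%:R :> R by [].
    by have := ler_wpM2l k0 h;
      move: (k.+1%:R) `|x - y| (dist S x) (dist S y) => *; lra.
  apply: (@lipschitz1_continuous _ _ _ k.+1%:R) => x y.
  have := wle x y; have := wle y x; rewrite (distrC y).
  move: (w k x) (w k y) (k.+1%:R * `|x - y|) => a b c h1 h2.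
  by rewrite ler_norml; apply/andP; split; lra.
pose A k := X `&` [set x | dist S x <= k.+1%:R^-1].
have kA k : closed (A k).
  apply: closedI => //; have /continuous_closedP := dist_continuous S0.
  by move=> /(_ [set r | r <= k.+1%:R^-1]); apply; exact: closed_le.
have mA k : measurable (A k : set (borel 'rV[R]_n)) by exact: closed_borel.
have AX k : A k `<=` X by move=> x [].
have le_k k : (mu0 S <= lambda (A k))%E.
  have Aoo : lambda (A k) \is a fin_num.
    rewrite ge0_fin_numE ?measure_ge0//; apply: le_lt_trans lX.
    by apply: le_measure; rewrite ?inE.
  rewrite -(fineK Aoo) -[X in (X <= _)%E]fineK ?fmu0// lee_fin.
  have wX : {within X, continuous (w k)} by exact: continuous_subspaceT.
  have := hw (w k) wX => E.
  have w0 x : 0 <= w k x by rewrite le_max lexx.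
  have i1 : fine (mu0 S) <= \int[mu0]_(x in X) w k x.
    rewrite -[leLHS]mul1r; apply: Rintegral_ge_cst => //.
      by apply: (within_continuous_integrable mu0oo).
    by move=> x Sx; rewrite /w dist_mem0// mulr0 subr0 le_max lexx orbT.
  have i2 : 0 <= \int[mu0']_(x in X) w k x by apply: Rintegral_ge0 => x _.
  have i3 : \int[lambda]_(x in X) w k x <= fine (lambda (A k)).
    apply: Rintegral_le_measure => //.
    - by apply: (within_continuous_integrable lX).
    - by move=> x _; rewrite ge_max ler01 gerBl mulr_ge0// dist_ge0.
    - move=> x Xx nA; apply/max_idPl; rewrite subr_le0.
      have : ~~ (dist S x <= k.+1%:R^-1) by apply/negP => h; apply: nA.
      by rewrite -ltNge -[X in X < _]mul1r ltr_pdivrMr// mulrC => /ltW.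
  move: i1 i2 i3; rewrite -E; lra.
have AE : \bigcap_k A k = S.
  apply/seteqP; split => [x hx|x Sx k _]; last first.
    by split; [exact: MCI_sub|rewrite /= dist_mem0// invr_ge0].
  apply: (dist_closed0 MCI_is_closed S0); rewrite leNgt; apply/negP => d0.
  have [k _ /(_ _ (leqnn k))] := near_infty_natSinv_lt (PosNum d0).
  by rewrite ltNge (hx k I).2.
have cvgA : (lambda \o A) k @[k --> \oo] --> lambda (\bigcap_k A k).
  apply: nonincreasing_cvg_mu => //.
  - by apply: le_lt_trans lX; apply: le_measure; rewrite ?inE.
  - by rewrite AE.
  - move=> i j ij; apply/subsetPset => x [Xx dx]; split => //=.
    by rewrite (le_trans dx)// lef_pV2 ?posrE ?ltr0n// ler_nat.
rewrite AE in cvgA.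
rewrite -(cvg_lim _ cvgA)//; apply: lime_ge; first by apply/cvg_ex;
  exists (lambda S).
by apply: nearW => k; exact: le_k.
Qed.

Lemma feasible_le mu mu0 mu0' : feasible f X U beta mu mu0 mu0' ->
  (mu0 X <= lambda S)%E.
Proof.
move=> fe; apply: (le_trans _ (feasible_le_lebesgue fe)).
rewrite -{1}(setDUK MCI_sub) -[leRHS]adde0 -(feasible_outside_null fe).
by apply: measureU2 => //; exact: measurableD.
Qed.

(** As a relation, [G] spares the proof that v is determined by its generator. The extension is
    arbitrary off [G], but generators are continuous, so the measure represents it on them. *)
Lemma occupation_measure : exists mu : {measure set (borel T) -> \bar R},
  [/\ fin_num_fun mu, msupport mu `<=` X `*` U &
    forall v, C1 v -> \int[mu]_(z in X `*` U) generator v z = \int[lambda]_(x in S) v x].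
Proof.
pose G : set ((T -> R) * R) := [set p | exists v, [/\ C1 v, p.1 = generator v &
  p.2 = \int[lambda]_(x in S) v x]].
have SX : (lambda S < +oo)%E.
  by apply: le_lt_trans lX; apply: le_measure; rewrite ?inE//; exact: MCI_sub.
have iS v : C1 v -> lambda.-integrable (S : set (borel 'rV[R]_n)) (EFin \o v).
  move=> C1v; apply: (integrableS mX mS MCI_sub).
  apply: (within_continuous_integrable lX) => //; apply: continuous_subspaceT.
  exact: C1_continuous.
have lG : linear_graph G.
  move=> a _ _ _ _ [v [C1v /= -> ->]] [v' [C1v' /= -> ->]].
  have [C1l gl] := C1_lin a C1v C1v'.
  exists (fun x => a * v x + v' x); split => //=.
    by apply/funext => z; rewrite /generator gl dotpDl dotpZl; ring.
  have [C1z _] := C1_cst n (0 : R); have [C1a _] := C1_lin a C1v C1z.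
  have iav : lambda.-integrable (S : set (borel 'rV[R]_n)) (EFin \o (fun x => a
    * v x)).
    by have := iS _ C1a; under [X in EFin \o X]eq_fun do rewrite addr0.
  by rewrite RintegralD// ?RintegralZl//; exact: iS.
have pG : positive_graph (X `*` U) G.
  move=> _ _ [v [C1v /= -> ->]] h; apply: Rintegral_ge0 => x Sx.
  exact: generator_ge0 C1v Sx h.
(* The generator of the constant 1 / beta is 1. *)
have G1 : exists c, G (fun=> 1, c).
  have [C1v gv] := C1_cst n (beta^-1); exists (\int[lambda]_(x in S) beta^-1).
  exists (fun=> beta^-1); split => //=; apply/funext => z.
  rewrite /generator gv divff ?gt_eqF// /dotp big1 ?subr0// => i _.
  by rewrite mxE mul0r.
have [L [LG Llin Lpos]] := positive_extension lG pG G1.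
have [mu [fmu smu muE]] := riesz_markov cK Llin Lpos.
exists mu; split => // v C1v; rewrite muE; last exact: generator_c.
by apply: LG; exists v.
Qed.

Lemma mrestr_Mplus (A : set 'rV[R]_n) (mA : measurable (A : set (borel 'rV[R]_n))) :
  A `<=` X -> Mplus X (mrestr lambda mA).
Proof.
move=> AX; split.
  move=> B mB; rewrite ge0_fin_numE; last exact: measure_ge0.
  apply: le_lt_trans lX; apply: le_measure; rewrite ?inE//.
    exact: measurableI.
  by move=> x [_ /AX].
move=> x hx; apply: contrapT => nXx.
have X0 : mrestr lambda mA (~` X) = 0%E.
  rewrite /mrestr; have -> : ~` X `&` A = set0 by apply/seteqP;
    split => // y [nX /AX].
  exact: measure0.
by have := hx _ (closed_openC kX) nXx; rewrite [X in (_ < X)%E]X0 ltxx.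
Qed.

(** The slack measure is the restriction of lambda to the points of [X] outside [S]. *)
Lemma feasible_MCI (mXI : measurable (S : set (borel 'rV[R]_n))) : exists (mu :
  {measure set (borel T) -> \bar R})
  (mu0' : {measure set (borel 'rV[R]_n) -> \bar R}),
  feasible f X U beta mu (mrestr lambda mXI) mu0'.
Proof.
have [mu [fmu smu muE]] := occupation_measure.
have mXS : measurable (X `\` S : set (borel 'rV[R]_n)) by exact: measurableD.
have M1 := mrestr_Mplus mXI MCI_sub.
have M2 : Mplus X (mrestr lambda mXS) by apply: mrestr_Mplus => x [].
have ir (A : set 'rV[R]_n) (mA : measurable (A : set (borel 'rV[R]_n))) w :
    Mplus X (mrestr lambda mA) -> {within X, continuous w} ->
    (mrestr lambda mA).-integrable (X : set (borel 'rV[R]_n)) (EFin \o w).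
  move=> [fM _] cw; apply: within_continuous_integrable => //.
  by rewrite ltey_eq fM.
exists mu, (mrestr lambda mXS); split => //.
- move=> v C1v; rewrite Rintegral_mrestr//; last first.
    apply: ir => //; apply: continuous_subspaceT; exact: C1_continuous.
  by rewrite -muE// Rintegral_generator// subrK.
- move=> w cw; rewrite !Rintegral_mrestr//; try exact: ir.
  apply/esym/Rintegral_subset => //; exact: within_continuous_integrable.
Qed.

End control_problem.

Theorem theorem2 (R : realType) (n m nX nU : nat)
    (f : 'I_n -> mpoly.mpoly (n + m) R)
    (gX : 'I_nX -> mpoly.mpoly n R) (gU : 'I_nU -> mpoly.mpoly m R)
    (beta : R) (X : set 'rV[R]_n) (U : set 'rV[R]_m)
    (XE : X = polyset gX) (UE : U = polyset gU)
    (cX : compact X) (cU : compact U) (beta_gt0 : 0 < beta) :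
  exists mXI : measurable (MCI f X U : set (borel 'rV[R]_n)),
    pstar f X U beta = lebesgue_rV (MCI f X U) /\
    exists (mu : {measure set (borel ('rV[R]_n * 'rV[R]_m)%type) -> \bar R})
      (mu0' : {measure set (borel 'rV[R]_n) -> \bar R}),
      feasible f X U beta mu (mrestr (@lebesgue_rV R n) mXI) mu0' /\
      mrestr (@lebesgue_rV R n) mXI X = pstar f X U beta.
Proof.
have mS : measurable (MCI f X U : set (borel 'rV[R]_n)).
  by apply: closed_borel; exact: (MCI_is_closed cX cU beta_gt0).
have [mu [mu0' fe]] := feasible_MCI cX cU beta_gt0 mS.
exists mS.
have rX : mrestr (@lebesgue_rV R n) mS X = lebesgue_rV (MCI f X U).
  by rewrite /mrestr; congr lebesgue_rV; apply/setIidPr => x [].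
have pE : pstar f X U beta = lebesgue_rV (MCI f X U).
  apply/eqP; rewrite eq_le; apply/andP; split.
    apply: ge_ereal_sup => _ [nu [nu0 [nu0' [feas ->]]]].
    exact: (feasible_le cX cU beta_gt0 feas).
  by apply: ereal_sup_ubound; exists mu, (mrestr (@lebesgue_rV R n) mS), mu0'.
by split => //; exists mu, mu0'; rewrite pE.
Qed.
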